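(* Let $\mathcal T_n^*$ be a uniformly random fringe subtree of the random trie $\mathcal T_n$, let $\Phi_k(\mathcal T_n)$ be the number of fringe trees of $\mathcal T_n$ with exactly $k$ leaves, and let $\psi_{\mathsf E,k}$, $\psi_{\mathsf E,\mathsf i}$, $H$, $d_{\mathbf p}$ be as in the context. Then, as $n\to\infty$, $$\mathbb P\bigl(|\mathcal T_n^*|_{\mathsf e}=k\mid\mathcal T_n\bigr)=\frac{\Phi_k(\mathcal T_n)}{|\mathcal T_n|}=\begin{cases}\dfrac{\psi_{\mathsf E,k}(\log n)}{\psi_{\mathsf E,\mathsf i}(\log n)+H}+o_p(1),&k\ge2,\\[2mm]\dfrac{H}{\psi_{\mathsf E,\mathsf i}(\log n)+H}+o_p(1),&k=1.\end{cases}$$ In particular, if $d_{\mathbf p}=0$, the distribution converges in probability: $$\mathbb P\bigl(|\mathcal T_n^*|_{\mathsf e}=k\mid\mathcal T_n\bigr)\overset{p}{\longrightarrow}\begin{cases}\dfrac{1}{(1+H)k(k-1)},&k\ge2,\\[2mm]\dfrac{H}{1+H},&k=1.\end{cases}$$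
   Context: Strings. $\mathcal A$ is a fixed finite alphabet with $|\mathcal A|\ge2$; $\mathbf p=(p_\alpha)_{\alpha\in\mathcal A}$ is a probability distribution with all $p_\alpha>0$. $\mathcal A^*=\bigcup_{m\ge0}\mathcal A^m$ is the set of finite strings, with empty string $\epsilon$. $\Xi^{(1)},\Xi^{(2)},\dots$ are i.i.d. random infinite strings, each with i.i.d. letters having distribution $\mathbf p$. Tries. Given a set of $n$ distinct infinite strings, let $\nu_{\boldsymbol\alpha}$ be the number of them having prefix $\boldsymbol\alpha\in\mathcal A^*$. The trie they generate is the empty tree $\emptyset$ if $n=0$; otherwise it is the finite rooted tree (root $\epsilon$, the children of $\boldsymbol\alpha$ being the nodes $\boldsymbol\alpha\gamma$, $\gamma\in\mathcal A$) whose nodes are all $\boldsymbol\alpha\in\mathcal A^*$ with either $\nu_{\boldsymbol\alpha}\ge2$ (internal nodes), or $\nu_{\boldsymbol\alpha}=1$ and $\boldsymbol\alpha=\epsilon$ or the parent of $\boldsymbol\alpha$ is an internal node (external nodes = leaves). $|T|$ and $|T|_{\mathsf e}$ are the numbers of nodes and of leaves of $T$. For a node $v\in T$, the fringe tree is $T^v:=\{\boldsymbol\beta\in\mathcal A^*:v\boldsymbol\beta\in T\}$. $\mathcal T_n$ is the random trie generated by $\Xi^{(1)},\dots,\Xi^{(n)}$. Given $\mathcal T_n$ ($n\ge1$), $\mathcal T_n^*:=\mathcal T_n^v$ where $v$ is a uniformly random node (internal or external) of $\mathcal T_n$. Constants. $\log$ is the natural logarithm. $H=-\sum_{\alpha}p_\alpha\log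 p_\alpha$. $d_{\mathbf p}$ is the largest $d>0$ such that $\log p_\alpha\in d\mathbb Z$ for all $\alpha\in\mathcal A$ if such a $d$ exists, and $d_{\mathbf p}=0$ otherwise. Mellin transform: $f^*(s)=\int_0^\infty f(x)x^{s-1}\,dx$. With $N_\lambda\sim\mathrm{Po}(\lambda)$, put $f_{\mathsf E,k}(\lambda):=\mathbb P(N_\lambda=k)=\frac{\lambda^k}{k!}e^{-\lambda}$ for $k\ge2$, and $f_{\mathsf E,\mathsf i}(\lambda):=\mathbb P(N_\lambda\ge2)=1-(1+\lambda)e^{-\lambda}$. For $f=f_{\mathsf E,k}$ or $f=f_{\mathsf E,\mathsf i}$, the corresponding $\psi=\psi_{\mathsf E,k}$ or $\psi_{\mathsf E,\mathsf i}$ is defined by: if $d_{\mathbf p}=0$, $\psi(t):=f^*(-1)$ for all $t$; if $d=d_{\mathbf p}>0$, $\psi(t):=d\sum_{j=-\infty}^\infty e^{jd-t}f(e^{t-jd})$, a continuous $d$-periodic function with Fourier series $\sum_{m\in\mathbb Z}f^*(-1-\frac{2\pi m}{d}\mathrm i)e^{2\pi\mathrm imt/d}$. $o_p(1)$ denotes a quantity tending to $0$ in probability. *)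

(* Defs.v *)
From mathcomp Require Export all_boot all_order all_algebra finmap.
From mathcomp Require Export all_classical all_reals all_analysis.
Export numFieldNormedType.Exports.
Export Order.TTheory GRing.Theory Num.Theory.

Set Implicit Arguments.
Unset Strict Implicit.
Unset Printing Implicit Defensive.

Local Open Scope classical_set_scope.
Local Open Scope ring_scope.

Definition infstr (A : Type) := nat -> A.

(* A rooted tree is represented by its set of nodes, which are finite strings:
   the root is [::] and the children of a are the rcons a c. *)
Definition strtree (A : finType) := set (seq A).

Definition has_prefix (A : finType) (x : infstr A) (a : seq A) : bool :=
  mkseq x (size a) == a.

Definition nu (A : finType) (n : nat) (x : 'I_n -> infstr A) (a : seq A) : nat :=
  #|[pred i : 'I_n | has_prefix (x i) a]|.

(* For n = 0 this is the empty tree. *)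
Definition trie (A : finType) (n : nat) (x : 'I_n -> infstr A) : strtree A :=
  [set a | (2 <= nu x a)%N \/
           nu x a = 1%N /\
           (a = [::] \/ exists b c, a = rcons b c /\ (2 <= nu x b)%N)].

(* fset_set sends an infinite set to fset0, so the three counts below are only
   meaningful for finite trees. Tries of pairwise distinct strings are finite;
   random strings coincide with probability 0. *)
Definition nnodes (A : finType) (T : strtree A) : nat := #|` fset_set T|.

Definition leaves (A : finType) (T : strtree A) : set (seq A) :=
  [set a | T a /\ forall c, ~ T (rcons a c)].

Definition nleaves (A : finType) (T : strtree A) : nat :=
  #|` fset_set (leaves T)|.

Definition fringe (A : finType) (T : strtree A) (v : seq A) : strtree A :=
  [set b | T (v ++ b)].

Definition Phi (A : finType) (k : nat) (T : strtree A) : nat :=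
  #|` fset_set [set v | T v /\ nleaves (fringe T v) = k]|.

Section Probability.
Context {R : realType} {disp : measure_display} {Omega : measurableType disp}.
Variable P : probability Omega R.

Definition mutually_independent (I : choiceType) (F : I -> set (set Omega)) :=
  forall (J : {fset I}) (E : I -> set Omega),
    (forall i, i \in J -> F i (E i)) ->
    P (\bigcap_(i in [set` J]) E i) = (\prod_(i <- J) P (E i))%E.

(* The sigma-algebra generated by a letter, resp. by an infinite string. *)
Definition letter_events (A : finType) (X : Omega -> A) : set (set Omega) :=
  [set E | exists B : set A, E = X @^-1` B].

Definition string_events (A : finType) (X : Omega -> infstr A) :
    set (set Omega) :=
  <<s \bigcup_j letter_events (fun w => X w j) >>.

(* The strings are identically distributed because their letters are
   independent with the common law p. *)
Record iid_strings (A : finType) (p : A -> R)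
    (Xi : nat -> Omega -> infstr A) : Prop := IidStrings {
  letter_measurable : forall i j a, measurable [set w | Xi i w j = a];
  letter_law : forall i j a, P [set w | Xi i w j = a] = (p a)%:E;
  letters_indep : forall i,
    mutually_independent (fun j => letter_events (fun w => Xi i w j));
  strings_indep : mutually_independent (fun i => string_events (Xi i)) }.

(* Elementary conditional probability; it is 0 if P F = 0. *)
Definition cprob (E F : set Omega) : R := fine (P (E `&` F)) / fine (P F).

(* P(E | X) as a random variable, for X almost surely in a countable set (such
   as a trie, which is almost surely one of the countably many finite trees). *)
Definition cprob_given (U : Type) (E : set Omega) (X : Omega -> U) : Omega -> R :=
  fun w => cprob E [set w' | X w' = X w].

(* Given T, the random node V is uniformly distributed over the nodes of T. *)
Definition uniform_node (A : finType) (T : Omega -> strtree A)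
    (V : Omega -> seq A) : Prop :=
  (forall v, measurable [set w | V w = v]) /\
  (forall (t : strtree A) (v : seq A), (0 < P [set w | T w = t])%E ->
     cprob [set w | V w = v] [set w | T w = t] = \1_t v / (nnodes t)%:R).

Definition op1 (Y : nat -> Omega -> R) : Prop :=
  forall e : R, 0 < e -> P [set w | e <= `|Y n w|] @[n --> \oo] --> 0%E.

Definition cvg_in_probability (Y : nat -> Omega -> R) (l : R) : Prop :=
  op1 (fun n w => Y n w - l).

End Probability.

Definition random_trie (Omega : Type) (A : finType)
    (Xi : nat -> Omega -> infstr A) (n : nat) (w : Omega) : strtree A :=
  trie (fun i : 'I_n => Xi i w).

Definition random_fringe (Omega : Type) (A : finType)
    (Xi : nat -> Omega -> infstr A) (V : nat -> Omega -> seq A)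
    (n : nat) (w : Omega) : strtree A :=
  fringe (random_trie Xi n w) (V n w).

Section Constants.
Context {R : realType}.

Definition entropy (A : finType) (p : A -> R) : R :=
  - \sum_(a : A) p a * ln (p a).

Definition is_span (A : finType) (p : A -> R) (d : R) : Prop :=
  0 < d /\ forall a, exists m : int, ln (p a) = m%:~R * d.

(* The largest span, or 0 if there is none. *)
Definition dp (A : finType) (p : A -> R) : R :=
  xget 0 [set d | is_span p d /\ forall d', is_span p d' -> d' <= d].

(* psi only involves f^*(-1), so real arguments s suffice. *)
Definition mellin (f : R -> R) (s : R) : R :=
  \int[lebesgue_measure]_(x in `]0, +oo[) (f x * x `^ (s - 1)).

Definition fE (k : nat) (x : R) : R := x ^+ k / k`!%:R * expR (- x).

Definition fEi (x : R) : R := 1 - (1 + x) * expR (- x).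

(* esum is the sum of a family of nonnegative terms; it is used here for
   functions f that are nonnegative on ]0, +oo[. *)
Definition psi (A : finType) (p : A -> R) (f : R -> R) (t : R) : R :=
  let d := dp p in
  if d == 0 then mellin f (-1)
  else d * fine (\esum_(j in [set: int])
                   (expR (j%:~R * d - t) * f (expR (t - j%:~R * d)))%:E).

Definition psiE (A : finType) (p : A -> R) (k : nat) : R -> R := psi p (fE k).

Definition psiEi (A : finType) (p : A -> R) : R -> R := psi p fEi.

End Constants.

(* Main.v *)
(* Up to a null event, a trie with n leaves has n + I nodes, where I counts the
   words that are prefixes of at least two strings, and its fringe trees with
   k >= 2 leaves correspond to the words that are prefixes of exactly k strings.
   Second moments show that these two counts, divided by n, are close to the
   Poissonized means (1/n) sum_s f(n p(s)), the sum running over all words s, for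
   f = fEi and f = fE k. In the variable t = log n such a mean F solves the
   renewal equation F(t) = h(t) + sum_a p_a F(t + log p_a) with
   h(t) = e^-t f(e^t). An energy argument, using the variance of F(t + log p_a)
   over the letters a, yields F(t + log p_a) - F(t) -> 0 for every letter a, hence
   for every shift in the group generated by the log p_a. This group is dense or
   generated by dp p, and a quantity conserved by the renewal equation then
   identifies the limit as psi(log n) / H. *)

Require Import Defs.
From mathcomp Require Import ring lra.

Set Implicit Arguments.
Unset Strict Implicit.
Unset Printing Implicit Defensive.

Local Open Scope classical_set_scope.
Local Open Scope ring_scope.

(** * Words and their weights *)

Section Words.
Context {R : realType} {A : finType}.
Variable p : A -> R.

(** All probabilities are computed in the finite product space of the first [M] letters of [n]
    strings, which determine the trie once these prefixes are distinct. With [q] the sum of the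
    [p a ^+ 2], this event requires [n^2 q^M -> 0], while the variance bound carries a factor
    [1 + M] and requires [M / n -> 0]; a depth of order [ln n] serves both.

    Sums over words are controlled by [bump2], a rational substitute for [min(1, x^2)], because the
    sum of the [bump2 (x * wt p s)] grows at most linearly in [x]. The Poisson approximation for a
    single word has an error of order [bump2 / n], so the errors of all words add up to a bounded
    quantity, and the limits need no separate depoissonization.

    Second moments are taken for one [k] at a time, whereas the internal nodes involve every
    [k >= 2]. The counts are therefore cut at a level [m^2], with a remainder of order [n / m]
    uniformly in [n].

    After division by [n] the leaves contribute exactly [1] and the internal nodes about
    [psiEi / H]; this is how [(psiE k / H) / (1 + psiEi / H)] becomes the quotient of the
    theorem. *)

Fixpoint words (M : nat) : seq (seq A) :=
  if M is M'.+1 then [::] :: [seq a :: s | a <- enum A, s <- words M']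
  else [::].

(** The bound is strict on purpose: once the prefixes of length [M] are distinct, only words shorter
    than [M] can be shared by two strings, so [words M] contains every internal node. *)
Lemma mem_words M s : (s \in words M) = (size s < M)%N.
Proof.
elim: M s => [|M IH] [|a s] //=.
rewrite inE /= ltnS -IH; apply/allpairsP/idP => [[[b u] /= [_ hu [_ ->]]]//|hs].
by exists (a, s); rewrite /= mem_enum.
Qed.

Lemma words_uniq M : uniq (words M).
Proof.
elim: M => //= M IH; apply/andP; split.
  by apply/negP => /allpairsP[[a s] [_ _]].
by apply: allpairs_uniq => //; [exact: enum_uniq|move=> [a s] [b u] _ _ [-> ->]].
Qed.

Lemma big_words (V : nmodType) (phi : seq A -> V) M :
  \sum_(s <- words M.+1) phi s =
  phi [::] + \sum_a \sum_(s <- words M) phi (a :: s).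
Proof. by rewrite /= big_cons big_allpairs_dep big_enum. Qed.

Definition wt (s : seq A) : R := \prod_(a <- s) p a.

Lemma wt_nil : wt [::] = 1. Proof. by rewrite /wt big_nil. Qed.
Lemma wt_cons a s : wt (a :: s) = p a * wt s.
Proof. by rewrite /wt big_cons. Qed.

Hypothesis p_gt0 : forall a, 0 < p a.
Hypothesis p_sum1 : \sum_a p a = 1.

Lemma wt_gt0 s : 0 < wt s.
Proof. by elim: s => [|a s IH]; rewrite ?wt_nil ?wt_cons// mulr_gt0. Qed.

Lemma p_le1 a : p a <= 1.
Proof.
rewrite -p_sum1 (bigD1 a)//= lerDl; apply: sumr_ge0 => i _; exact/ltW.
Qed.

(** For any letter [a] there is another letter [b], and the product of all weights is at most
    [p b <= 1 - p a]. So this product is a gap valid for all letters at once. *)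
Lemma p_gap : (2 <= #|A|)%N -> exists2 c, 0 < c <= 1 & forall a, p a <= 1 - c.
Proof.
move=> hA; exists (\prod_a p a).
  apply/andP; split; first by apply: prodr_gt0 => i _.
  by apply: prodr_ile1 => i _; rewrite (ltW (p_gt0 i)) p_le1.
move=> a; have /card_gt0P[b] : (0 < #|predC1 a|)%N.
  by rewrite cardC1 -ltnS prednK// ltnW.
rewrite inE => /= ba.
have hb : \prod_a p a <= p b.
  rewrite (bigD1 b)//= ler_piMr ?(ltW (p_gt0 b))//.
  by apply: prodr_ile1 => i _; rewrite (ltW (p_gt0 i)) p_le1.
apply: (@le_trans _ _ (1 - p b)); last by rewrite lerD2l lerN2.
rewrite lerBrDr -p_sum1 (bigD1 a)//= (bigD1 b)//= addrA lerDl.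
by apply: sumr_ge0 => i _; exact/ltW.
Qed.

(** Within a factor 4 of [min(1, x^2)], but rational, so that the supersolution inequality below
    reduces to a polynomial one. *)
Definition bump2 (x : R) : R := (x / (1 + x)) ^+ 2.

(* The function [x |-> x^2 / (c (1 + x))] is a supersolution of the renewal
   equation [U x = bump2 x + \sum_a U (x * p a)]. *)
Lemma sum_words_bump2 c M x : 0 < c -> (forall a, p a <= 1 - c) -> 0 < x ->
  \sum_(s <- words M) bump2 (x * wt s) <= c^-1 * (x ^+ 2 / (1 + x)).
Proof.
move=> c0 hc; elim: M x => [|M IH] x x0.
  by rewrite big_nil mulr_ge0 ?invr_ge0 ?(ltW c0)// divr_ge0 ?sqr_ge0//; lra.
rewrite big_words wt_nil mulr1.
have step a : \sum_(s <- words M) bump2 (x * wt (a :: s)) <=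
    p a * (c^-1 * (x ^+ 2 / (1 + x)) - bump2 x).
  under eq_bigr do rewrite wt_cons mulrA.
  apply: (le_trans (IH _ _)); first by rewrite mulr_gt0.
  have pa0 := p_gt0 a; have pa1 := hc a.
  have x1 : 0 < 1 + x by lra.
  have y1 : 0 < 1 + x * p a by rewrite addr_gt0// mulr_gt0.
  rewrite /bump2 -subr_ge0.
  (* The defect of the inequality is a nonnegative factor times an affine function of [x], whose two
     coefficients are nonnegative by [p a <= 1 - c]. *)
  have -> : p a * (c^-1 * (x ^+ 2 / (1 + x)) - (x / (1 + x)) ^+ 2) -
     c^-1 * ((x * p a) ^+ 2 / (1 + x * p a)) =
     p a * c^-1 * x ^+ 2 * ((1 + x) ^-2 * (1 + x * p a)^-1) *
      ((1 - p a - c) + x * (1 - p a - c * p a)).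
    by field; rewrite !gt_eqF.
  have e1 : 0 <= 1 - p a - c by lra.
  have e2 : 0 <= 1 - p a - c * p a.
    have : c * p a <= c by rewrite ler_piMr ?p_le1// ltW.
    lra.
  apply: mulr_ge0; last by rewrite addr_ge0// mulr_ge0// ltW.
  by rewrite !(mulr_ge0, invr_ge0, exprn_ge0)// ltW.
apply: (le_trans (lerD (lexx _) (ler_sum _ (fun a _ => step a)))).
by rewrite -mulr_suml p_sum1 mul1r addrC subrK.
Qed.

End Words.

(** * The renewal equation and its iterates *)

Section Renewal.
Context {R : realType} {A : finType}.
Variable p : A -> R.
Hypothesis p_gt0 : forall a, 0 < p a.
Hypothesis p_sum1 : \sum_a p a = 1.

(* With [x = expR t], the identity [U x = f x + \sum_a U (x * p a)] becomes an
   additive renewal equation for [expR (- t) * U (expR t)]. *)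
Definition tilt (f : R -> R) (t : R) : R := expR (- t) * f (expR t).

(** The Poissonized mean cut at depth [M]. By [fsumS] it is the [M]-th iterate of the renewal
    equation started from 0. *)
Definition fsum (f : R -> R) (M : nat) (t : R) : R :=
  expR (- t) * \sum_(s <- words M) f (expR t * wt p s).

Lemma expRDln (t x : R) : 0 < x -> expR (t + ln x) = expR t * x.
Proof. by move=> x0; rewrite expRD lnK. Qed.

Lemma expRNDln (t x : R) : 0 < x -> x * expR (- (t + ln x)) = expR (- t).
Proof.
move=> x0; rewrite opprD expRD [expR (- ln x)]expRN lnK// mulrCA divff ?mulr1//.
by rewrite gt_eqF.
Qed.

Lemma fsumS f M t :
  fsum f M.+1 t = tilt f t + \sum_a p a * fsum f M (t + ln (p a)).
Proof.
rewrite /fsum big_words mulrDr wt_nil mulr1; congr (_ + _).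
rewrite mulr_sumr; apply: eq_bigr => a _.
rewrite mulrA expRNDln//; congr (_ * _); apply: eq_bigr => s _.
by rewrite wt_cons mulrA expRDln.
Qed.

Lemma fsumE f M t :
  fsum f M t = \sum_(s <- words M) wt p s * tilt f (t + ln (wt p s)).
Proof.
rewrite /fsum mulr_sumr; apply: eq_bigr => s _.
have w0 := wt_gt0 p_gt0 s.
by rewrite /tilt mulrA expRNDln// expRDln.
Qed.

Lemma fsum_bump2 c M t : 0 < c -> (forall a, p a <= 1 - c) ->
  fsum bump2 M t <= c^-1 * (expR t / (1 + expR t)).
Proof.
move=> c0 hc; rewrite /fsum.
have := sum_words_bump2 p_gt0 p_sum1 M c0 hc (expR_gt0 t).
rewrite -(ler_pM2l (expR_gt0 (- t))) => /le_trans; apply.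
rewrite expRN le_eqVlt; apply/orP; left; apply/eqP; field.
by rewrite !gt_eqF ?expR_gt0// ltr_wpDr ?expR_ge0.
Qed.

Lemma sump_sqr c : 0 < c -> (forall a, p a <= 1 - c) ->
  0 <= \sum_a p a ^+ 2 <= 1 - c.
Proof.
move=> c0 hc; rewrite sumr_ge0 => [|a _]; last by rewrite sqr_ge0.
rewrite -[leRHS]mul1r -[X in X * _]p_sum1 mulr_suml ler_sum// => a _.
by rewrite expr2 ler_pM2l.
Qed.

(** The solution is the increasing limit of the iterates [fsum f M], bounded through [fsum_bump2].
    The Lipschitz bound survives the limit because the increments of [tilt f] are dominated by
    [tilt bump2], whose iterates are at most [c^-1]. In the last bound each level contributes
    [p a ^+ 2]: one factor is the renewal weight, the other comes from [expR (t + ln (p a))]. *)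
Lemma renewal_solution (f : R -> R) (C c : R) :
  0 < c -> (forall a, p a <= 1 - c) ->
  (forall x, 0 < x -> 0 <= f x <= C * bump2 x) ->
  (forall t s, `|s| <= 1 ->
    `|tilt f (t + s) - tilt f t| <= C * `|s| * tilt bump2 t) ->
  exists F : R -> R, [/\
    forall t, F t = tilt f t + \sum_a p a * F (t + ln (p a)),
    forall t, 0 <= F t <= C / c * (expR t / (1 + expR t)),
    forall t s, `|s| <= 1 -> `|F (t + s) - F t| <= C / c * `|s| &
    forall M t, 0 <= F t - fsum f M t <=
      C / c * expR t * (\sum_a p a ^+ 2) ^+ M].
Proof.
move=> c0 hc hf hl.
have C0 : 0 <= C.
  have /andP[a0 /(le_trans a0)] := hf _ ltr01.
  by rewrite pmulr_lge0// /bump2 exprn_gt0// divr_gt0//; lra.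
have ub M t : fsum f M t <= C / c * (expR t / (1 + expR t)).
  apply: (@le_trans _ _ (C * fsum bump2 M t)); last first.
    by rewrite -mulrA ler_wpM2l// fsum_bump2.
  rewrite /fsum mulrCA ler_pM2l ?expR_gt0// mulr_sumr ler_sum// => s _.
  by have /andP[] := hf _ (mulr_gt0 (expR_gt0 t) (wt_gt0 p_gt0 s)).
have ge0 M t : 0 <= fsum f M t.
  rewrite mulr_ge0 ?expR_ge0 ?sumr_ge0// => s _.
  by have /andP[] := hf _ (mulr_gt0 (expR_gt0 t) (wt_gt0 p_gt0 s)).
have f0 t : 0 <= tilt f t.
  by rewrite mulr_ge0 ?expR_ge0//; have /andP[] := hf _ (expR_gt0 t).
have ndS M t : fsum f M t <= fsum f M.+1 t.
  elim: M t => [|M IH] t; first by rewrite /fsum big_nil mulr0; exact: ge0.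
  by rewrite fsumS [leRHS]fsumS lerD2l ler_sum// => a _; rewrite ler_pM2l.
have nd t : {homo (fsum f)^~ t : m n / (m <= n)%N >-> m <= n}.
  by apply/nondecreasing_seqP => M; exact: ndS.
have cv t : cvgn ((fsum f)^~ t).
  apply: nondecreasing_is_cvgn; first by move=> m n; exact: nd.
  by exists (C / c * (expR t / (1 + expR t))) => _ [M _ <-]; exact: ub.
pose F t := limn ((fsum f)^~ t).
have FE t : F t = tilt f t + \sum_a p a * F (t + ln (p a)).
  have h1 : fsum f M.+1 t @[M --> \oo] --> F t.
    by rewrite (@cvg_shiftS _ ((fsum f)^~ t)); exact: cv.
  have h2 : fsum f M.+1 t @[M --> \oo] -->
      tilt f t + \sum_a p a * F (t + ln (p a)).
    under eq_fun do rewrite fsumS.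
    apply: cvgD; first exact: cvg_cst.
    by apply: cvg_big => [|a _ //]; [exact: add_continuous|
       apply: cvgMl_tmp; exact: cv].
  exact: (cvg_unique _ h1 h2).
have Fub t : 0 <= F t <= C / c * (expR t / (1 + expR t)).
  apply/andP; split; first by apply: limr_ge; [exact: cv|exact: nearW].
  by apply: limr_le; [exact: cv|exact: nearW].
exists F; split => //.
- move=> t s hs; have cd : (fsum f M (t + s) - fsum f M t) @[M --> \oo]
      --> F (t + s) - F t by apply: cvgB; exact: cv.
  have cn : `|fsum f M (t + s) - fsum f M t| @[M --> \oo] -->
      `|F (t + s) - F t| by exact: cvg_norm.
  rewrite -(cvg_lim _ cn)//; apply: limr_le; first by apply/cvg_ex; eexists; exact: cn.
  apply: nearW => M /=; rewrite !fsumE -sumrB.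
  apply: (le_trans (ler_norm_sum _ _ _)).
  apply: (@le_trans _ _ (C * `|s| * fsum bump2 M t)); last first.
    rewrite [leRHS]mulrAC ler_wpM2l ?mulr_ge0//.
    apply: (le_trans (fsum_bump2 _ _ c0 hc)); rewrite ler_piMr ?invr_ge0 ?(ltW c0)//.
    by rewrite ler_pdivrMr ?mul1r ?lerDr// ltr_wpDr ?expR_ge0.
  rewrite fsumE mulr_sumr ler_sum// => u _.
  have w0 := wt_gt0 p_gt0 u.
  rewrite -mulrBr normrM gtr0_norm// mulrCA ler_pM2l// addrAC; exact: hl.
- elim=> [|M IH] t.
    rewrite /fsum big_nil mulr0 subr0 expr0 mulr1.
    have /andP[-> h] := Fub t; rewrite (le_trans h)// ler_wpM2l//.
      by rewrite divr_ge0// ltW.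
    by rewrite ler_pdivrMr ?ler_peMr ?expR_ge0// ?lerDl ?expR_ge0//
      ltr_wpDr ?expR_ge0.
  rewrite FE fsumS opprD addrACA subrr add0r -sumrB.
  under eq_bigr do rewrite -mulrBr.
  apply/andP; split.
    by apply: sumr_ge0 => a _; have /andP[h _] := IH (t + ln (p a));
       rewrite mulr_ge0// ltW.
  rewrite exprS mulr_suml mulr_sumr ler_sum// => a _.
  have /andP[_ h] := IH (t + ln (p a)).
  apply: (le_trans (ler_wpM2l (ltW (p_gt0 a)) h)); rewrite expRDln//.
  by rewrite le_eqVlt; apply/orP; left; apply/eqP; ring.
Qed.
End Renewal.

(** * The renewal theorem *)

Section RealFunctions.
Context {R : realType}.
Implicit Types (f g : R -> R).

Definition vanishing g :=
  forall e, 0 < e -> exists T, forall t, T <= t -> `|g t| <= e.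

Lemma vanishing_eq f g : f =1 g -> vanishing f -> vanishing g.
Proof. by move=> fg hf e /hf[T hT]; exists T => t /hT; rewrite fg. Qed.

Lemma vanishingD f g : vanishing f -> vanishing g ->
  vanishing (fun t => f t + g t).
Proof.
move=> hf hg e e0; have e2 : 0 < e / 2 by rewrite divr_gt0.
have [T hT] := hf _ e2; have [U hU] := hg _ e2.
exists (Num.max T U) => t; rewrite ge_max => /andP[/hT h1 /hU h2].
by rewrite (le_trans (ler_normD _ _))// [leRHS]splitr lerD.
Qed.

Lemma vanishingZ k f : vanishing f -> vanishing (fun t => k * f t).
Proof.
move=> hf e e0; have k1 : 0 < `|k| + 1 by rewrite ltr_wpDl.
have [T hT] := hf _ (divr_gt0 e0 k1); exists T => t /hT h.
rewrite normrM (le_trans (ler_wpM2l _ h))// mulrCA ler_piMr ?(ltW e0)//.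
by rewrite ler_pdivrMr// mul1r lerDl.
Qed.

Lemma vanishingN f : vanishing f -> vanishing (fun t => - f t).
Proof. by move=> h e /h[T hT]; exists T => t /hT; rewrite normrN. Qed.

Lemma vanishing_sum (I : Type) (r : seq I) (f : I -> R -> R) :
  (forall i, vanishing (f i)) -> vanishing (fun t => \sum_(i <- r) f i t).
Proof.
move=> hf; elim: r => [|i r IH].
  by move=> e e0; exists 0 => t _; rewrite big_nil normr0 ltW.
apply: (@vanishing_eq (fun t => f i t + \sum_(j <- r) f j t)).
  by move=> t; rewrite big_cons.
exact: vanishingD.
Qed.

Lemma vanishing_shift s f : vanishing f -> vanishing (fun t => f (t + s)).
Proof.
move=> h e /h[T hT]; exists (T - s) => t; rewrite lerBlDr => /hT; exact.
Qed.

Lemma vanishing_le f g : vanishing g -> (forall t, `|f t| <= `|g t|) ->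
  vanishing f.
Proof.
by move=> hg fg e /hg[T hT]; exists T => t /hT; apply: le_trans.
Qed.

Lemma is_derive_sumf (I : Type) (r : seq I) (f : I -> R -> R) (df : I -> R) (x : R) :
  (forall i, is_derive x 1 (f i) (df i)) ->
  is_derive x 1 (fun t => \sum_(i <- r) f i t) (\sum_(i <- r) df i).
Proof.
move=> h; have -> : (fun t => \sum_(i <- r) f i t) = \sum_(i <- r) f i.
  by apply/funext => t; rewrite fct_sumE.
elim/big_ind2 : _ => //; first exact: is_derive_cst.
by move=> *; exact: is_deriveD.
Qed.

Lemma is_derive_scalef k f (df x : R) :
  is_derive x 1 f df -> is_derive x 1 (fun t => k * f t) (k * df).
Proof. by move=> h; exact: is_deriveZ. Qed.

Lemma is_derive_subf f g (df dg x : R) :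
  is_derive x 1 f df -> is_derive x 1 g dg ->
  is_derive x 1 (fun t => f t - g t) (df - dg).
Proof. by move=> hf hg; exact: is_deriveB. Qed.

Lemma is_derive_shiftf f (df s x : R) :
  is_derive (x + s) 1 f df -> is_derive x 1 (fun t => f (t + s)) df.
Proof.
move=> h; have hs : is_derive x 1 (fun t : R => t + s) 1.
  by apply: is_derive_eq; rewrite addr0.
have := @is_derive1_comp _ f (fun t => t + s) x _ _ h hs.
by rewrite mulr1.
Qed.

Lemma mean_value f (df : R -> R) (a b : R) : a <= b ->
  (forall x, a <= x <= b -> is_derive x 1 f (df x)) ->
  exists2 c, a <= c <= b & f b - f a = df c * (b - a).
Proof.
move=> ab h; have [||c hc ->] := @MVT_segment _ f df a b ab.
- move=> x; rewrite in_itv/= => /andP[/ltW ax /ltW xb]; apply: h.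
  by rewrite ax xb.
- apply: derivable_within_continuous => x; rewrite in_itv/= => /h [].
  by [].
by exists c => //; rewrite in_itv/= in hc.
Qed.

(** The primitive is differentiable only to the right of its base point, so every use places [a] to
    the left of all the arguments that occur. *)
Lemma primitive_exists f (a : R) : continuous f ->
  exists P : R -> R, forall t, a < t -> is_derive t 1 P (f t).
Proof.
move=> cf; exists (fun x => \int[lebesgue_measure]_(t in [set` `[a, x]]) f t)%R.
move=> t at_; have hi : lebesgue_measure.-integrable `[a, t + 1] (EFin \o f).
  apply: continuous_compact_integrable; first exact: segment_compact.
  exact: continuous_subspaceT.
have [||d1 d2] := @continuous_FTC1_closed _ f a t (t + 1) _ hi at_.
- by rewrite ltrDl.
- exact: cf.
by apply: DeriveDef => //; rewrite -derive1E.
Qed.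

Lemma nondecreasing_bounded_cauchy f (a b : R) :
  (forall s t, a <= s -> s <= t -> f s <= f t) -> (forall t, a <= t -> f t <= b) ->
  forall e, 0 < e -> exists2 T, a <= T &
    forall s t, T <= s -> s <= t -> f t - f s <= e.
Proof.
move=> nd ub e e0; pose S := [set f t | t in [set t | a <= t]].
have hS : has_sup S.
  split; first by exists (f a), a => /=.
  by exists b => _ [t /= /ub h <-].
have [_ [T /= aT <-] hT] := sup_adherent e0 hS.
exists T => // s t Ts st.
have h1 : f t <= sup S by apply: (ub_le_sup hS.2); exists t => //=; lra.
have := nd _ _ aT Ts; lra.
Qed.

End RealFunctions.

Section Energy.
Context {R : realType} {A : finType}.
Variable p : A -> R.
Hypothesis p_gt0 : forall a, 0 < p a.
Hypothesis p_sum1 : \sum_a p a = 1.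
Variables (F h G : R -> R) (B L : R).
Hypothesis h_ge0 : forall t, 0 <= h t.
Hypothesis FE : forall t, F t = h t + \sum_a p a * F (t + ln (p a)).
Hypothesis FB : forall t, 0 <= F t <= B.
Hypothesis FL : forall t s, `|s| <= 1 -> `|F (t + s) - F t| <= L * `|s|.
Hypothesis hL : forall t s, `|s| <= 1 -> `|h (t + s) - h t| <= L * `|s|.
Hypothesis dG : forall t : R, is_derive t 1 G (h t).
Hypothesis GB : forall t, G t <= B.
Hypothesis h0 : vanishing h.

(** Bounds the length of every renewal step; a sum rather than a maximum, since any common bound
    will do. *)
Definition maxstep : R := \sum_a - ln (p a).

Lemma ln_p_le0 a : ln (p a) <= 0.
Proof. by apply: ln_le0; exact: p_le1. Qed.

Lemma le_maxstep a : - ln (p a) <= maxstep.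
Proof.
rewrite /maxstep (bigD1 a)//= lerDl; apply: sumr_ge0 => b _.
by rewrite oppr_ge0 ln_p_le0.
Qed.

Lemma maxstep_ge0 : 0 <= maxstep.
Proof. by apply: sumr_ge0 => a _; rewrite oppr_ge0 ln_p_le0. Qed.

Lemma lipschitz_continuous (f : R -> R) (K : R) :
  (forall t s, `|s| <= 1 -> `|f (t + s) - f t| <= K * `|s|) -> continuous f.
Proof.
move=> fL t; apply/cvgrPdist_le => e e0.
have K1 : 0 < `|K| + 1 by rewrite ltr_wpDl.
near=> u; have hu : `|u - t| <= Num.min 1 (e / (`|K| + 1)).
  near: u; apply: cvgr_distC_le; [exact: cvg_id|].
  by rewrite lt_min ltr01 divr_gt0.
move: hu; rewrite le_min => /andP[h1 h2].
rewrite distrC; have := fL t (u - t) h1; rewrite [t + _]addrC subrK => /le_trans.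
apply; apply: (@le_trans _ _ ((`|K| + 1) * `|u - t|)).
  by rewrite ler_wpM2r// (le_trans (ler_norm _))// lerDl.
by rewrite mulrC -ler_pdivlMr.
Unshelve. all: by end_near. Qed.

Let B_ge0 : 0 <= B.
Proof. by have /andP[] := FB 0; exact: le_trans. Qed.

(** [F t - h t] is the mean of the [F (t + ln (p b))], so the left side is a single term of their
    variance. That variance is the mean of the squares minus [(F - h)^2], and
    [F^2 - (F - h)^2 = h (2 F - h) <= 2 B h]. *)
Let variance_ge t a :
  p a * (F (t + ln (p a)) - (F t - h t)) ^+ 2 <=
  2 * B * h t - (F t ^+ 2 - \sum_b p b * F (t + ln (p b)) ^+ 2).
Proof.
set m := F t - h t.
have hm : \sum_b p b * F (t + ln (p b)) = m by rewrite /m FE addrC addKr.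
have hv : \sum_b p b * (F (t + ln (p b)) - m) ^+ 2 =
    \sum_b p b * F (t + ln (p b)) ^+ 2 - m ^+ 2.
  under eq_bigr => b _.
    have -> : p b * (F (t + ln (p b)) - m) ^+ 2 =
      p b * F (t + ln (p b)) ^+ 2 - 2 * m * (p b * F (t + ln (p b))) +
      m ^+ 2 * p b by ring.
    over.
  rewrite big_split/= sumrB -!mulr_sumr hm p_sum1; ring.
apply: (@le_trans _ _ (\sum_b p b * (F (t + ln (p b)) - m) ^+ 2)).
  rewrite (bigD1 a)//= lerDl; apply: sumr_ge0 => b _.
  by rewrite mulr_ge0 ?sqr_ge0 ?ltW.
rewrite hv /m; have /andP[F0 FB'] := FB t; have := h_ge0 t.
have : 0 <= (B - F t) * h t by rewrite mulr_ge0// subr_ge0.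
nra.
Qed.

(* Integrate [F^2 - \sum_b p b * F(. + ln (p b))^2] from a fixed point to [t]:
   the result stays bounded, because it telescopes to integrals of [F^2] over
   bounded windows. As [F - h] is the mean of the values [F (. + ln (p b))], the
   integrand is at most [2 * B * h] minus their variance, so the variance is
   integrable. Being uniformly continuous, it vanishes at infinity. *)
Lemma renewal_deviation a : vanishing (fun t => F (t + ln (p a)) - (F t - h t)).
Proof.
set u := fun t => _; move=> e e0.
have cF : continuous F by exact: lipschitz_continuous FL.
have cF2 : continuous (fun t => F t ^+ 2).
  by under eq_fun do rewrite expr2; move=> t; apply: continuousM; exact: cF.
have [P dP] := primitive_exists 0 cF2.
pose W t := 2 * B * G t - \sum_b p b * (P t - P (t + ln (p b))).
pose w t := 2 * B * h t - \sum_b p b * (F t ^+ 2 - F (t + ln (p b)) ^+ 2).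
have hw t : p a * u t ^+ 2 <= w t.
  apply: (le_trans (variance_ge t a)).
  rewrite lerD2l lerN2 (eq_bigr (fun b => p b * F t ^+ 2 -
    p b * F (t + ln (p b)) ^+ 2)) => [|b _]; last by rewrite mulrBr.
  by rewrite sumrB -mulr_suml p_sum1 mul1r.
have dW t : maxstep < t -> is_derive t 1 W (w t).
  move=> Mt; rewrite /W; apply: is_derive_subf.
  apply: is_derive_sumf => b.
  have t0 : 0 < t by exact: le_lt_trans maxstep_ge0 Mt.
  have tb : 0 < t + ln (p b) by have := le_maxstep b; lra.
  apply: is_derive_scalef; apply: is_derive_subf; first exact: dP.
  apply: is_derive_shiftf; exact: dP.
(* Beyond [T0] all the shifted arguments [t + ln (p b)] are positive, where [P] is
   differentiable. *)
pose T0 := maxstep + 1.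
have ndW s t : T0 <= s -> s <= t -> W s <= W t.
  move=> Ts st; have [c /andP[sc _] hc] : exists2 c, s <= c <= t &
      W t - W s = w c * (t - s).
    by apply: mean_value => // x /andP[sx _]; apply: dW; rewrite /T0 in Ts; lra.
  have w0 : 0 <= w c by rewrite (le_trans _ (hw c))// mulr_ge0 ?sqr_ge0 ?ltW.
  by rewrite -subr_ge0 hc mulr_ge0// subr_ge0.
have ubW t : T0 <= t -> W t <= 2 * B * B.
  move=> Tt; rewrite lerBlDr (@le_trans _ _ (2 * B * B))//.
    by rewrite ler_wpM2l// mulr_ge0.
  rewrite lerDl; apply: sumr_ge0 => b _; rewrite mulr_ge0 ?(ltW (p_gt0 b))//.
  have hb := le_maxstep b; have h1 := ln_p_le0 b.
  have [c _ ->] : exists2 c, t + ln (p b) <= c <= t &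
      P t - P (t + ln (p b)) = F c ^+ 2 * (t - (t + ln (p b))).
    apply: mean_value => [|x /andP[x1 _]]; first by lra.
    by apply: dP; rewrite /T0 in Tt; lra.
  by rewrite mulr_ge0 ?sqr_ge0//; lra.
have L0 : 0 <= L.
  have := FL 0 (s := 1); rewrite normr1 mulr1 => /(_ (lexx _)).
  exact: le_trans.
pose d := Num.min 1 (e / (6 * L + 1)).
have L1 : 0 < 6 * L + 1 by lra.
have d0 : 0 < d by rewrite lt_min ltr01 divr_gt0.
have d1 : d <= 1 by rewrite ge_min lexx.
have dL : 6 * L * d <= e.
  have : d <= e / (6 * L + 1) by rewrite ge_min lexx orbT.
  by rewrite ler_pdivlMr// => hd; nra.
(* By the mean value theorem, an increment of [W] of at most [d * p a * (e / 2) ^+ 2] over a window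
   of length [d] yields a point of the window with [|u| <= e / 2]. Moving from there to [t] costs at
   most [3 * L * d <= e / 2], because [u] is a combination of three [L]-Lipschitz terms. *)
have [|T TT hT] := @nondecreasing_bounded_cauchy _ W T0 (2 * B * B) ndW ubW
  (d * p a * (e / 2) ^+ 2).
  by rewrite !mulr_gt0 ?exprn_gt0 ?divr_gt0.
exists T => t Tt.
have [c /andP[tc cd] hc] : exists2 c, t <= c <= t + d &
    W (t + d) - W t = w c * (t + d - t).
  apply: mean_value => [|x /andP[x1 _]]; first by lra.
  by apply: dW; rewrite /T0 in TT; lra.
have uc : `|u c| <= e / 2.
  have td : t <= t + d by lra.
  have := hT _ _ Tt td; rewrite hc addrAC subrr add0r mulrC -mulrA ler_pM2l//.
  move=> /(le_trans (hw c)); rewrite ler_pM2l//.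
  rewrite -(ler_sqr (normr_ge0 _)) ?real_normK ?num_real//.
  by rewrite nnegrE divr_ge0// ltW.
have utc : `|u t - u c| <= 3 * L * d.
  have cs : `|t - c| <= 1 by rewrite distrC ger0_norm; lra.
  have cs' : `|t - c| <= d by rewrite distrC ger0_norm; lra.
  have hF := FL c cs; have hFa := FL (c + ln (p a)) cs; have hh := hL c cs.
  rewrite [c + _]addrC subrK in hF; rewrite [c + (t - c)]addrC subrK in hh.
  rewrite (_ : c + ln (p a) + (t - c) = t + ln (p a)) in hFa; last by ring.
  have -> : u t - u c = (F (t + ln (p a)) - F (c + ln (p a))) -
     ((F t - F c) - (h t - h c)) by rewrite /u; ring.
  have hLd : L * `|t - c| <= L * d by rewrite ler_wpM2l.
  apply: (le_trans (ler_normB _ _)).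
  have := ler_normB (F t - F c) (h t - h c); lra.
have -> : u t = u t - u c + u c by rewrite subrK.
apply: (le_trans (ler_normD _ _)); lra.
Qed.

Lemma renewal_shift a : vanishing (fun t => F (t + ln (p a)) - F t).
Proof.
apply: (vanishing_eq _ (vanishingD (renewal_deviation a) (vanishingN h0))).
by move=> t /=; ring.
Qed.

End Energy.

(** * The group generated by the logarithms of the letter probabilities *)

Section Span.
Context {R : realType}.

Definition subgroup (S : set R) := S 0 /\ forall x y, S x -> S y -> S (x - y).

Lemma subgroupMz (S : set R) x (m : int) : subgroup S -> S x -> S (m%:~R * x).
Proof.
move=> hS Sx; have [S0 SB] := hS.
have Sn (n : nat) : S (n%:R * x).
  elim: n => [|n IH]; first by rewrite mul0r.
  rewrite (_ : _ * x = n%:R * x - (0 - x)); first by apply: hS.2 => //; exact: hS.2.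
  by rewrite -natr1; ring.
case: m => n; first exact: Sn.
rewrite NegzE (_ : _ * x = 0 - n.+1%:R * x); first exact: SB.
by rewrite mulrNz; ring.
Qed.

(** If no positive element lies below [e], an element within [e] of the infimum of the positive ones
    is the least of them, since a smaller one would differ from it by a positive element below [e].
    Division with remainder then shows that it generates [S]. *)
Lemma subgroup_dichotomy (S : set R) x0 : subgroup S -> S x0 -> 0 < x0 ->
  (exists d, [/\ 0 < d, S d & forall x, S x -> exists m : int, x = m%:~R * d]) \/
  (forall e, 0 < e -> exists2 x, S x & 0 < x < e).
Proof.
move=> hS Sx0 x00; have [h|/existsNP[e /not_implyP[e0 he]]] :=
  pselect (forall e, 0 < e -> exists2 x, S x & 0 < x < e); [by right|left].
have gap x : S x -> 0 < x -> e <= x.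
  move=> Sx x1; rewrite leNgt; apply/negP => xe; apply: he; exists x => //.
  by rewrite x1.
pose T := [set x | S x /\ 0 < x].
have hT : has_inf T.
  split; first by exists x0.
  by exists 0 => x [_ /ltW].
have [d [Sd d0] dT] := inf_adherent e0 hT.
have min x : S x -> 0 < x -> d <= x.
  move=> Sx x1; rewrite leNgt; apply/negP => xd.
  have := gap (d - x); rewrite subr_gt0 => /(_ (hS.2 _ _ Sd Sx) xd).
  have : inf T <= x by apply: (ge_inf hT.2).
  lra.
exists d; split => // x Sx; exists (Num.floor (x / d)).
have := hS.2 _ _ Sx (subgroupMz (Num.floor (x / d)) hS Sd).
set y := _ - _ => Sy; apply/eqP; rewrite -subr_eq0 -/y; apply/eqP.
have y0 : 0 <= y.
  by rewrite /y subr_ge0 -ler_pdivlMr// floor_le.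
have yd : y < d.
  rewrite /y ltrBlDl -[X in _ + X]mul1r -mulrDl -ltr_pdivrMr//.
  by have := floorD1_gt (x / d); rewrite intrD.
by apply/eqP; rewrite eq_le y0 andbT leNgt; apply/negP => /(min _ Sy); lra.
Qed.

Context {A : finType}.
Variable p : A -> R.
Hypothesis hA : (2 <= #|A|)%N.
Hypothesis p_gt0 : forall a, 0 < p a.
Hypothesis p_sum1 : \sum_a p a = 1.

(** The generated subgroup, encoded as an intersection: a property of shifts that is stable under
    subtraction need only be checked on the [ln (p a)]. *)
Definition step_group (x : R) :=
  forall S : set R, subgroup S -> (forall a, S (ln (p a))) -> S x.

Lemma step_group_subgroup : subgroup step_group.
Proof.
split=> [S [] //|x y hx hy S hS hp]; apply: hS.2; [exact: hx|exact: hy].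
Qed.

Lemma ln_p_lt0 a : ln (p a) < 0.
Proof.
have [c /andP[c0 _] hc] := p_gap p_gt0 p_sum1 hA.
by apply: ln_lt0; rewrite p_gt0 (le_lt_trans (hc a))// ltrBlDr ltrDl.
Qed.

Lemma is_span_step_group d x : is_span p d -> step_group x ->
  exists m : int, x = m%:~R * d.
Proof.
move=> [d0 hd] /(_ [set y | exists m : int, y = m%:~R * d]); apply=> //.
split; first by exists 0; rewrite mul0r.
by move=> _ _ [m ->] [n ->]; exists (m - n); rewrite intrB mulrBl.
Qed.

(** A generator [d] of the group is a span, and the largest one, because [d] is itself a positive
    multiple of any other span. If the group has arbitrarily small positive elements, no span
    divides them all, and [dp] takes its default value 0. *)
Lemma dpP : (0 < dp p /\ is_span p (dp p) /\ step_group (dp p)) \/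
  (dp p = 0 /\ forall e, 0 < e -> exists2 x, step_group x & 0 < x < e).
Proof.
have [a _] : exists a : A, true.
  by have /card_gt0P[a _] : (0 < #|A|)%N by [exact: ltnW]; exists a.
have Ga : step_group (0 - ln (p a)).
  by apply: step_group_subgroup.2; [exact: step_group_subgroup.1|move=> S _; exact].
have a0 : 0 < 0 - ln (p a) by rewrite sub0r oppr_gt0 ln_p_lt0.
have [[d [d0 Gd hd]]|hd] := subgroup_dichotomy step_group_subgroup Ga a0.
- left; have sd : is_span p d.
    by split=> // b; apply: hd => S _; exact.
  have max d' : is_span p d' -> d' <= d.
    move=> sd'; have [d'0 _] := sd'; have [m dE] := is_span_step_group sd' Gd.
    have m0 : 0 < m by move: d0; rewrite dE pmulr_lgt0// ltr0z.
    by rewrite dE ler_peMl ?(ltW d'0)// ler1z -gtz0_ge1.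
  have [sp mp] : [set d | is_span p d /\ forall d', is_span p d' -> d' <= d] (dp p).
    by apply: (@xgetPex _ _ _); exists d.
  have -> : dp p = d by apply/eqP; rewrite eq_le max// mp.
  by [].
- right; split=> //; apply: xgetPN => d [sd _].
  have [d0 _] := sd; have [x Gx /andP[x0 xd]] := hd _ d0.
  have [m xE] := is_span_step_group sd Gx.
  have m0 : 0 < m by move: x0; rewrite xE pmulr_lgt0// ltr0z.
  suff : d <= x by lra.
  by rewrite xE ler_peMl ?(ltW d0)// ler1z -gtz0_ge1.
Qed.

End Span.

(** * Identification of the limit *)

Section Limit.
Context {R : realType} {A : finType}.
Variable p : A -> R.
Hypothesis hA : (2 <= #|A|)%N.
Hypothesis p_gt0 : forall a, 0 < p a.
Hypothesis p_sum1 : \sum_a p a = 1.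
Variables (F h : R -> R) (B L : R).
Hypothesis h_ge0 : forall t, 0 <= h t.
Hypothesis FE : forall t, F t = h t + \sum_a p a * F (t + ln (p a)).
Hypothesis F_ge0 : forall t, 0 <= F t.
Hypothesis F_expR : forall t, F t <= B * expR t.
Hypothesis Fshift : forall a, vanishing (fun t => F (t + ln (p a)) - F t).

Let H := entropy p.

Lemma entropyE : H = \sum_a p a * - ln (p a).
Proof. by rewrite /H /entropy -sumrN; apply: eq_bigr => a _; rewrite mulrN. Qed.

Lemma entropy_gt0 : 0 < H.
Proof.
have /card_gt0P[a _] : (0 < #|A|)%N by exact: ltnW.
have hb b : 0 < p b * - ln (p b) by rewrite mulr_gt0// oppr_gt0 ln_p_lt0.
by rewrite entropyE (bigD1 a)//= ltr_pwDl// sumr_ge0// => b _; exact: ltW.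
Qed.

Let B_ge0 : 0 <= B.
Proof. by rewrite -(pmulr_lge0 _ (expR_gt0 0)) (le_trans _ (F_expR 0)). Qed.

Lemma vanishing_step_group s :
  step_group p s -> vanishing (fun t => F (t + s) - F t).
Proof.
move=> /(_ [set x | vanishing (fun t => F (t + x) - F t)]).
apply=> [|a]; last exact: Fshift.
split.
  by move=> e e0; exists 0 => t _; rewrite addr0 subrr normr0 ltW.
move=> x y /= hx hy.
apply: (vanishing_eq _ (vanishingD (vanishing_shift (- y) hx)
   (vanishingN (vanishing_shift (- y) hy)))) => t /=.
by rewrite addrNK (_ : t + (x - y) = t - y + x); ring.
Qed.

Section NonLattice.
Variables (G : R -> R) (c : R).
Hypothesis FL : forall t s, `|s| <= 1 -> `|F (t + s) - F t| <= L * `|s|.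
Hypothesis dG : forall t : R, is_derive t 1 G (h t).
Hypothesis G_Ny : vanishing (fun t => G (- t)).
Hypothesis G_y : vanishing (fun t => G t - c).
Hypothesis dense : forall e, 0 < e -> exists2 x, step_group p x & 0 < x < e.

(** Uniformity in [s] comes from a finite grid: the multiples of one small element [x] of the group
    that lie in [[0, K]]. The Lipschitz bound fills the gaps, which are shorter than [d]. *)
Lemma window K e : 0 < e -> exists T, forall t s, T <= t -> 0 <= s <= K ->
  `|F (t - s) - F t| <= e.
Proof.
move=> e0.
have L0 : 0 <= L.
  have := FL 0 (s := 1); rewrite normr1 mulr1 => /(_ (lexx _)).
  exact: le_trans.
pose d := Num.min 1 (e / (2 * L + 1)).
have L1 : 0 < 2 * L + 1 by lra.
have d0 : 0 < d by rewrite lt_min ltr01 divr_gt0.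
have d1 : d <= 1 by rewrite ge_min lexx.
have dL : 2 * L * d <= e.
  have : d <= e / (2 * L + 1) by rewrite ge_min lexx orbT.
  by rewrite ler_pdivlMr// => hd; nra.
have [x Gx /andP[x0 xd]] := dense d0.
pose N := (Num.truncn (K / x)).+1.
have hj (j : nat) : vanishing (fun t => F (t + (- j%:~R) * x) - F t).
  apply: vanishing_step_group; rewrite -mulrNz.
  exact: subgroupMz (step_group_subgroup p) Gx.
have hsum : vanishing (fun t => \sum_(j <- iota 0 N)
    `|F (t + (- j%:~R) * x) - F t|).
  by apply: vanishing_sum => j; apply: vanishing_le (hj j) _ => t; rewrite normr_id.
have [|T hT] := hsum (e / 2); first by rewrite divr_gt0.
exists T => t s /hT hs /andP[s0 sK].
pose j := Num.truncn (s / x).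
have sx0 : 0 <= s / x by rewrite divr_ge0// ltW.
have /andP[j1 j2] : j%:R <= s / x < j.+1%:R by apply: truncn_itv.
rewrite ler_pdivlMr// in j1; rewrite ltr_pdivrMr// -natr1 in j2.
have jN : j \in iota 0 N.
  by rewrite mem_iota /= add0n ltnS; apply: le_truncn; rewrite ler_pM2r ?invr_gt0.
have hjs : `|F (t + (- j%:~R) * x) - F t| <= e / 2.
  apply: le_trans hs; rewrite [leRHS]ger0_norm ?sumr_ge0//.
  by rewrite (big_rem j)//= lerDl sumr_ge0.
have ns : `|j%:R * x - s| <= d by rewrite distrC ger0_norm; lra.
have ns1 : `|j%:R * x - s| <= 1 by rewrite (le_trans ns).
have := FL (t + (- j%:~R) * x) ns1.
rewrite (_ : t + - j%:~R * x + (j%:R * x - s) = t - s); last first.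
  by rewrite -[j%:~R]/(j%:R); ring.
move=> hL; have hLd : L * `|j%:R * x - s| <= L * d by rewrite ler_wpM2l.
have -> : F (t - s) - F t = (F (t - s) - F (t + (- j%:~R) * x)) +
  (F (t + (- j%:~R) * x) - F t) by ring.
apply: (le_trans (ler_normD _ _)); lra.
Qed.

(* [D t], the [p]-average of the integrals of [F] over the windows from
   [t + ln (p a)] to [t], has derivative [h], hence tends to [c]; as [F] is
   almost constant on these windows, [D t] is close to [H * F t]. *)
Lemma renewal_nonlattice : vanishing (fun t => H * F t - c).
Proof.
move=> e e0; have e4 : 0 < e / 4 by rewrite divr_gt0.
have H0 := entropy_gt0.
have [T0 hT0] := G_Ny e4.
have cF : continuous F by exact: lipschitz_continuous FL.
have HB : 0 < 4 * (H * B) + 1 by rewrite ltr_wpDl// !mulr_ge0// ltW.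
(* So far to the left that [G t0] and [D t0] are both at most [e / 4]; the constant [D - G] is then
   small without a limit at minus infinity. *)
pose t0 := Num.min (- T0) (ln (e / (4 * (H * B) + 1))).
have ht0 : `|G t0| <= e / 4.
  by rewrite -[t0]opprK; apply: hT0; rewrite lerNr /t0 ge_min lexx.
have et0 : H * (B * expR t0) <= e / 4.
  have : expR t0 <= e / (4 * (H * B) + 1).
    by rewrite -[leRHS]lnK ?posrE ?divr_gt0// ler_expR ge_min lexx orbT.
  rewrite ler_pdivlMr// => h1; have := expR_ge0 t0; nra.
have [P dP] := primitive_exists (t0 - maxstep p - 1) cF.
have dP' t : t0 - maxstep p <= t -> is_derive t 1 P (F t).
  by move=> ht; apply: dP; lra.
have inc a t : t0 <= t -> exists2 x, t + ln (p a) <= x <= t &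
    P t - P (t + ln (p a)) = F x * - ln (p a).
  move=> ht; have := le_maxstep p_gt0 p_sum1 a; have := ln_p_le0 p_gt0 p_sum1 a.
  move=> h1 h2; have [x hx hx'] : exists2 x, t + ln (p a) <= x <= t &
      P t - P (t + ln (p a)) = F x * (t - (t + ln (p a))).
    by apply: mean_value => [|x /andP[x1 _]]; [lra|apply: dP'; lra].
  by exists x => //; rewrite hx'; ring.
pose D t := \sum_a p a * (P t - P (t + ln (p a))).
have dD t : t0 <= t -> is_derive t 1 D (h t).
  move=> ht; have -> : h t = \sum_a p a * (F t - F (t + ln (p a))).
    under eq_bigr do rewrite mulrBr.
    by rewrite sumrB -mulr_suml p_sum1 mul1r [F t in RHS]FE addrK.
  apply: is_derive_sumf => a; apply: is_derive_scalef.
  have h1 := ln_p_le0 p_gt0 p_sum1 a; have h2 := le_maxstep p_gt0 p_sum1 a.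
  apply: is_derive_subf; first by apply: dP'; have := maxstep_ge0 p_gt0 p_sum1; lra.
  by apply: is_derive_shiftf; apply: dP'; lra.
have DG t : t0 <= t -> D t - G t = D t0 - G t0.
  move=> ht; have [x _] : exists2 x, t0 <= x <= t &
      (D t - G t) - (D t0 - G t0) = (h x - h x) * (t - t0).
    apply: (@mean_value _ (fun t => D t - G t) (fun t => h t - h t)) => //.
    move=> x /andP[x1 _]; apply: is_derive_subf; exact: dD.
  by rewrite subrr mul0r => /eqP; rewrite subr_eq0 => /eqP.
have Dle t M : t0 <= t -> (forall x, t - maxstep p <= x <= t -> F x <= M) ->
    0 <= D t <= H * M.
  move=> ht hM; rewrite entropyE mulr_suml; apply/andP; split.
    apply: sumr_ge0 => a _; have [x _ ->] := inc a _ ht.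
    by rewrite !mulr_ge0// ?(ltW (p_gt0 a))// oppr_ge0 ln_p_le0.
  apply: ler_sum => a _; have [x /andP[x1 x2] ->] := inc a _ ht.
  rewrite -mulrA ler_wpM2l ?(ltW (p_gt0 a))// mulrC ler_wpM2l ?oppr_ge0 ?ln_p_le0//.
  by apply: hM; have := le_maxstep p_gt0 p_sum1 a; lra.
have Dt0 : 0 <= D t0 <= e / 4.
  have /andP[-> h1] : 0 <= D t0 <= H * (B * expR t0).
    apply: Dle => // x /andP[_ xt]; apply: (le_trans (F_expR x)).
    by rewrite ler_wpM2l// ler_expR.
  exact: le_trans h1 et0.
have [T1 hT1] := window (maxstep p) (divr_gt0 e4 H0).
have [T2 hT2] := G_y e4.
exists (Num.max t0 (Num.max T1 T2)) => t; rewrite !ge_max => /and3P[tt0 tT1 tT2].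
have hD : `|D t - H * F t| <= e / 4.
  rewrite entropyE /D mulr_suml -sumrB; apply: (le_trans (ler_norm_sum _ _ _)).
  have -> : e / 4 = \sum_a p a * - ln (p a) * (e / 4 / H).
    by rewrite -mulr_suml -entropyE [RHS]mulrC divfK// gt_eqF.
  apply: ler_sum => a _; have [x /andP[x1 x2] ->] := inc a _ tt0.
  have h1 := ln_p_le0 p_gt0 p_sum1 a.
  rewrite [F x * _]mulrC mulrA -mulrBr normrM ger0_norm; last first.
    by rewrite mulr_ge0 ?(ltW (p_gt0 a))// oppr_ge0.
  rewrite ler_wpM2l ?mulr_ge0 ?(ltW (p_gt0 a)) ?oppr_ge0//.
  have := hT1 t (t - x) tT1; rewrite subKr; apply.
  have := le_maxstep p_gt0 p_sum1 a; lra.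
have -> : H * F t - c = - (D t - H * F t) + (D t0 - G t0) + (G t - c).
  by rewrite -(DG t)//; ring.
have := hT2 t tT2; have /andP[D0 D1] := Dt0; move: hD ht0.
rewrite !ler_norml => /andP[a1 a2] /andP[b1 b2] /andP[c1 c2].
by apply/andP; split; lra.
Qed.

End NonLattice.
End Limit.

Section LatticeSum.
Context {R : realType}.
Variables (h D : R -> R) (B K d : R).
Hypothesis d_gt0 : 0 < d.
Hypothesis h_ge0 : forall t, 0 <= h t.
Hypothesis h_expR : forall t, h t <= B * expR (- t).
Hypothesis D_bnd : forall t, 0 <= D t <= K * expR t.
Hypothesis DE : forall t, D t = h t + D (t - d).

Let DN N t : D t = \sum_(j < N) h (t - j%:R * d) + D (t - N%:R * d).
Proof.
elim: N => [|N IH]; first by rewrite big_ord0 mul0r subr0 add0r.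
rewrite big_ord_recr/= IH [D (t - N%:R * d)]DE -!addrA; congr (_ + (_ + D _)).
by rewrite -natr1; ring.
Qed.

Let B_ge0 : 0 <= B.
Proof. by rewrite -(pmulr_lge0 _ (expR_gt0 (- 0))) (le_trans _ (h_expR 0)). Qed.

Lemma right_series t : (\sum_(0 <= j <oo) (h (t - j%:R * d))%:E = (D t)%:E)%E.
Proof.
apply/cvg_lim => //.
have -> : (fun n => \sum_(0 <= j < n) (h (t - j%:R * d))%:E)%E =
    (fun n => (D t - D (t - n%:R * d))%:E).
  by apply/funext => n; rewrite big_mkord sumEFin (DN n t) addrK.
apply: cvg_EFin; first exact: nearW.
rewrite -[X in _ --> X]subr0; apply: cvgB; first exact: cvg_cst.
apply: (@squeeze_cvgr _ _ _ _ (cst 0) (fun n => K * expR t * (expR (- d)) ^+ n)).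
- apply: nearW => n; have /andP[-> h1] := D_bnd (t - n%:R * d).
  by apply: (le_trans h1); rewrite expRD -mulrN [expR (_ * - d)]expRM_natl mulrA.
- exact: cvg_cst.
- rewrite -[X in _ --> X](mulr0 (K * expR t)); apply: cvgMl_tmp.
  apply: cvg_expr; rewrite ger0_norm ?expR_ge0//.
  by rewrite -expR0 ltr_expR oppr_lt0.
Qed.

Lemma left_series t :
  (0 <= \sum_(0 <= j <oo) (h (t + j.+1%:R * d))%:E <=
    (B / (1 - expR (- d)) * expR (- t))%:E)%E.
Proof.
have r1 : expR (- d) < 1 by rewrite -expR0 ltr_expR oppr_lt0.
apply/andP; split; first by apply: nneseries_ge0 => n _ _; rewrite lee_fin.
apply: lime_le; first by apply: is_cvg_nneseries => n _ _; rewrite lee_fin.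
apply: nearW => n; rewrite big_mkord sumEFin lee_fin.
apply: (@le_trans _ _ (\sum_(j < n) (B * expR (- t)) * expR (- d) ^+ j)).
  apply: ler_sum => j _; apply: (le_trans (h_expR _)).
  rewrite opprD expRD mulrA -mulrN expRM_natl ler_wpM2l ?mulr_ge0 ?expR_ge0//.
  by rewrite exprS ler_piMl ?exprn_ge0 ?expR_ge0// ltW.
rewrite -mulr_sumr [B / _ * _]mulrAC ler_wpM2l ?mulr_ge0 ?expR_ge0//.
rewrite -[leRHS]mul1r ler_pdivlMr ?subr_gt0// mulrC.
have := subrX1 (expR (- d)) n; have := exprn_ge0 n (expR_ge0 (- d)).
set S := \sum_(j < n) _; nra.
Qed.

(** The terms with [j >= 0] sum exactly to [D t], by iterating [D t = h t + D (t - d)] down to minus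
    infinity, where [D] vanishes. The terms with [j < 0] are dominated by a geometric series of size
    [expR (- t)]; in particular the sum is finite and [fine] loses nothing. *)
Lemma lattice_esum t :
  `|fine (\esum_(j in [set: int]) (h (t - j%:~R * d))%:E) - D t| <=
    B / (1 - expR (- d)) * expR (- t).
Proof.
have h0 j : (0 <= (h (t - j%:~R * d))%:E)%E by rewrite lee_fin.
rewrite (esumID (range Posz))// setTI.
have -> : [set: int] `&` ~` range Posz = range Negz.
  rewrite setTI; apply/seteqP; split=> [[n|n] /= hn|_ [n _ <-] [m _]//].
    by exfalso; apply: hn; exists n.
  by exists n.
rewrite !esum_image; last 2 first.
- by move=> m n _ _ [].
- by move=> m n _ _ [].
rewrite -!nneseries_esumT//.
rewrite (_ : \sum_(0 <= i <oo) (h (t - (Posz i)%:~R * d))%:E = (D t)%:E)%E;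
  last exact: right_series.
have -> : (\sum_(0 <= i <oo) (h (t - (Negz i)%:~R * d))%:E =
    \sum_(0 <= i <oo) (h (t + i.+1%:R * d))%:E)%E.
  by apply: eq_eseriesr => i _; rewrite NegzE mulrNz mulNr opprK.
have := left_series t; case: (\sum_(0 <= i <oo) _)%E => [x| |]//=.
- by rewrite !lee_fin => /andP[x0 xB]; rewrite addrC addrK ger0_norm.
- by rewrite leye_eq andbF.
Qed.

End LatticeSum.

Section Lattice.
Context {R : realType} {A : finType}.
Variable p : A -> R.
Hypothesis hA : (2 <= #|A|)%N.
Hypothesis p_gt0 : forall a, 0 < p a.
Hypothesis p_sum1 : \sum_a p a = 1.
Variables (F h : R -> R) (B d : R).
Hypothesis FE : forall t, F t = h t + \sum_a p a * F (t + ln (p a)).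
Hypothesis h_ge0 : forall t, 0 <= h t.
Hypothesis F_ge0 : forall t, 0 <= F t.
Hypothesis F_expR : forall t, F t <= B * expR t.
Hypothesis h_expRN : forall t, h t <= B * expR (- t).
Hypothesis Fshift : forall a, vanishing (fun t => F (t + ln (p a)) - F t).
Hypothesis d_span : is_span p d.
Hypothesis d_step : step_group p d.

Let H := entropy p.

(* The discrete counterpart of the non-lattice argument: here
   [D t = h t + D (t - d)]. *)
Lemma renewal_lattice : vanishing (fun t => H * F t -
  d * fine (\esum_(j in [set: int]) (h (t - j%:~R * d))%:E)).
Proof.
have [d0 hd] := d_span.
have hn a : exists n : nat, ln (p a) = - (n%:R * d).
  have [[n|n] hm] := hd a; last by exists n.+1; rewrite hm NegzE mulrNz mulNr.
  exists 0%N; apply/eqP; rewrite mul0r oppr0 eq_le ln_p_le0//=.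
  by rewrite hm mulr_ge0 ?ler0z ?(ltW d0).
have [n nE] := choice hn.
pose D t := \sum_a p a * \sum_(j < n a) F (t - j%:R * d).
have tel N t : \sum_(j < N) F (t - j%:R * d) - \sum_(j < N) F (t - d - j%:R * d) =
    F t - F (t - N%:R * d).
  elim: N => [|N IH]; first by rewrite !big_ord0 mul0r !subr0 subrr.
  rewrite !big_ord_recr/= opprD addrACA IH -natr1.
  rewrite (_ : t - d - N%:R * d = t - (N%:R + 1) * d); last by ring.
  by rewrite addrA subrK.
have DE t : D t = h t + D (t - d).
  apply/eqP; rewrite -subr_eq -sumrB; apply/eqP.
  transitivity (\sum_a (p a * F t - p a * F (t + ln (p a)))).
    by apply: eq_bigr => a _; rewrite -!mulrBr tel nE.
  by rewrite sumrB -mulr_suml p_sum1 mul1r [F t in LHS]FE addrK.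
pose K := \sum_a p a * \sum_(j < n a) B.
have B0 : 0 <= B by rewrite -(pmulr_lge0 _ (expR_gt0 0)) (le_trans _ (F_expR 0)).
have D_bnd t : 0 <= D t <= K * expR t.
  apply/andP; split.
    by apply: sumr_ge0 => a _; rewrite mulr_ge0 ?(ltW (p_gt0 a))// sumr_ge0.
  rewrite mulr_suml ler_sum// => a _; rewrite -mulrA ler_wpM2l ?(ltW (p_gt0 a))//.
  rewrite mulr_suml ler_sum// => j _; apply: (le_trans (F_expR _)).
  by rewrite ler_wpM2l// ler_expR lerBlDr lerDl mulr_ge0// ltW.
(* As [- ln (p a) = n a * d], the entropy is [d] times the [p]-mean of the [n a]. Hence the
   difference is a finite combination of increments of [F] over multiples of [d], which belong to
   the group. *)
have hHF : vanishing (fun t => H * F t - d * D t).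
  apply: (@vanishing_eq _ (fun t => \sum_(a <- enum A)
      (- (d * p a)) * \sum_(j <- enum 'I_(n a)) (F (t + - (j%:R * d)) - F t))).
    move=> t; rewrite big_enum/= /H entropyE mulr_suml /D mulr_sumr -sumrB.
    apply: eq_bigr => a _; rewrite nE opprK big_enum/= sumrB sumr_const card_ord.
    rewrite -mulr_natl; ring.
  apply: vanishing_sum => a; apply: vanishingZ; apply: vanishing_sum => j.
  apply: (vanishing_step_group Fshift).
  rewrite -mulNr (_ : - j%:R = (- (Posz j))%:~R); last by rewrite mulrNz.
  exact: subgroupMz (step_group_subgroup p) d_step.
apply: (vanishing_eq _ (vanishingD hHF (vanishingZ (- d)
  (f := fun t => fine (\esum_(j in [set: int]) (h (t - j%:~R * d))%:E) - D t) _))).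
  by move=> t /=; ring.
move=> e e0; pose k := B / (1 - expR (- d)) + 1.
have k0 : 0 < k.
  rewrite ltr_wpDl// divr_ge0// subr_ge0 -expR0 ler_expR oppr_le0; exact: ltW.
exists (- ln (e / k)) => t ht.
apply: (le_trans (lattice_esum d0 h_ge0 h_expRN D_bnd DE t)).
apply: (@le_trans _ _ (k * expR (- t))).
  by rewrite ler_wpM2r ?expR_ge0// lerDl.
rewrite -ler_pdivlMl// mulrC -[leRHS]lnK ?posrE ?divr_gt0// ler_expR.
by rewrite lerNl.
Qed.

End Lattice.

Section RenewalTheorem.
Context {R : realType} {A : finType}.
Variable p : A -> R.
Hypothesis hA : (2 <= #|A|)%N.
Hypothesis p_gt0 : forall a, 0 < p a.
Hypothesis p_sum1 : \sum_a p a = 1.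
Variables (f G : R -> R) (C : R).
Hypothesis f_bump : forall x, 0 < x -> 0 <= f x <= C * bump2 x.
Hypothesis f_lip : forall t s, `|s| <= 1 ->
  `|tilt f (t + s) - tilt f t| <= C * `|s| * tilt bump2 t.
Hypothesis dG : forall t : R, is_derive t 1 G (tilt f t).
Hypothesis G_le : forall t, G t <= C.
Hypothesis G_Ny : vanishing (fun t => G (- t)).
Hypothesis G_y : vanishing (fun t => G t - mellin f (-1)).

Lemma tilt_bump2_le (t : R) : tilt bump2 t <= expR (- t) /\ tilt bump2 t <= 1.
Proof.
have t0 := expR_gt0 t; have t1 : 0 < 1 + expR t by lra.
rewrite /tilt /bump2; split.
  rewrite ler_piMr ?expR_ge0// exprn_ile1// ?divr_ge0// ?(ltW t0) ?(ltW t1)//.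
  by rewrite ler_pdivrMr// mul1r lerDr.
have -> : expR (- t) * (expR t / (1 + expR t)) ^+ 2 =
    (1 + expR t)^-1 * (expR t / (1 + expR t)).
  by rewrite expRN; field; rewrite !gt_eqF.
apply: mulr_ile1; rewrite ?invr_ge0 ?divr_ge0 ?(ltW t0) ?(ltW t1)//.
  by rewrite invf_le1// lerDl ltW.
by rewrite ler_pdivrMr// mul1r lerDr.
Qed.

Theorem renewal_theorem :
  exists (F : R -> R) (K : R), [/\
    vanishing (fun t => F t - psi p f t / entropy p),
    forall t, 0 <= F t <= K &
    forall M t, 0 <= F t - fsum p f M t <=
      K * expR t * (\sum_a p a ^+ 2) ^+ M].
Proof.
have [c /andP[c0 c1] hc] := p_gap p_gt0 p_sum1 hA.
have [F [FE FB FL FM]] := renewal_solution p_gt0 p_sum1 c0 hc f_bump f_lip.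
have C0 : 0 <= C.
  have /andP[a0 /(le_trans a0)] := f_bump ltr01.
  by rewrite pmulr_lge0// /bump2 exprn_gt0// divr_gt0//; lra.
have K0 : 0 <= C / c by rewrite divr_ge0// ltW.
(* Since [c <= 1], the single constant [C / c] can serve as the bound on [F] and on [G], as the
   Lipschitz constant and in both exponential bounds. *)
have CK : C <= C / c by rewrite ler_peMr// invr_ge1 ?unitfE ?gt_eqF.
have r1 (t : R) : expR t / (1 + expR t) <= 1.
  by rewrite ler_pdivrMr ?mul1r ?lerDr// ltr_wpDr ?expR_ge0.
have rt (t : R) : expR t / (1 + expR t) <= expR t.
  have t1 : 0 < 1 + expR t by rewrite ltr_wpDr ?expR_ge0.
  by rewrite ler_pdivrMr// ler_peMr ?expR_ge0// lerDl expR_ge0.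
have f0 t : 0 <= tilt f t.
  by rewrite mulr_ge0 ?expR_ge0//; have /andP[] := f_bump (expR_gt0 t).
have fb t : tilt f t <= C * tilt bump2 t.
  rewrite /tilt mulrCA ler_wpM2l ?expR_ge0//.
  by have /andP[] := f_bump (expR_gt0 t).
have fe t : tilt f t <= C / c * expR (- t).
  apply: (le_trans (fb t)); have [h1 _] := tilt_bump2_le t.
  by rewrite (le_trans (ler_wpM2l C0 h1))// ler_wpM2r ?expR_ge0.
have FK t : 0 <= F t <= C / c.
  by have /andP[-> h] := FB t; apply: (le_trans h); rewrite ler_piMr ?r1.
have Fe t : F t <= C / c * expR t.
  by have /andP[_ h] := FB t; apply: (le_trans h); rewrite ler_wpM2l ?rt.
have F0 t : 0 <= F t by have /andP[] := FK t.
have fL t s : `|s| <= 1 -> `|tilt f (t + s) - tilt f t| <= C / c * `|s|.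
  move=> s1; apply: (le_trans (f_lip t s1)).
  apply: (@le_trans _ _ (C * `|s|)); last by rewrite ler_wpM2r.
  by rewrite ler_piMr ?mulr_ge0//; have [] := tilt_bump2_le t.
have fv : vanishing (tilt f).
  move=> e e0; exists (- ln (e / (C / c + 1))) => t ht.
  have k0 : 0 < C / c + 1 by rewrite ltr_wpDl.
  rewrite ger0_norm//; apply: (le_trans (fe t)).
  apply: (@le_trans _ _ ((C / c + 1) * expR (- t))).
    by rewrite ler_wpM2r ?expR_ge0// lerDl.
  rewrite -ler_pdivlMl// mulrC -[leRHS]lnK ?posrE ?divr_gt0// ler_expR.
  by rewrite lerNl.
have GK t : G t <= C / c by exact: le_trans (G_le t) CK.
have Fs := renewal_shift p_gt0 p_sum1 f0 FE FK FL fL dG GK fv.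
exists F, (C / c); split=> //.
have H0 := entropy_gt0 hA p_gt0 p_sum1.
suff hv : vanishing (fun t => entropy p * F t - psi p f t).
  apply: (vanishing_eq _ (vanishingZ (entropy p)^-1 hv)) => t /=.
  by field; rewrite gt_eqF.
have [[d0 [sp Gd]]|[d0 dense]] := dpP hA p_gt0 p_sum1.
  have hl := renewal_lattice p_gt0 p_sum1 FE f0 F0 Fe fe Fs sp Gd.
  apply: (vanishing_eq _ hl) => t; congr (_ - _).
  rewrite /psi gt_eqF//; congr (_ * fine _).
  by apply: eq_esum => j _; rewrite /tilt opprB.
have hl := renewal_nonlattice hA p_gt0 p_sum1 FE F0 Fe Fs FL dG G_Ny G_y dense.
by apply: (vanishing_eq _ hl) => t; rewrite /psi d0 eqxx.
Qed.

End RenewalTheorem.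

(** * Poisson weights *)

Section Poisson.
Context {R : realType}.
Implicit Types (x t s : R).

Lemma fE_ge0 j x : 0 <= x -> 0 <= fE j x.
Proof. by move=> x0; rewrite /fE !mulr_ge0 ?expR_ge0 ?exprn_ge0 ?invr_ge0. Qed.

Lemma fE0 x : fE 0%N x = expR (- x).
Proof. by rewrite /fE expr0 fact0 divr1 mul1r. Qed.

Lemma mulr_fE j x : x * fE j x = j.+1%:R * fE j.+1 x.
Proof.
rewrite /fE exprS factS natrM.
have j0 : j.+1%:R != 0 :> R by rewrite pnatr_eq0.
have j1 : j`!%:R != 0 :> R by rewrite pnatr_eq0 -lt0n fact_gt0.
by move: (j.+1%:R) j0 (j`!%:R) j1 => u u0 v v0; field; rewrite u0 v0.
Qed.

Lemma fE_le1 j x : 0 <= x -> fE j x <= 1.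
Proof.
move=> x0; rewrite /fE expRN ler_pdivrMr ?expR_gt0// mul1r; case: j => [|j].
  by rewrite expr0 fact0 divr1 -expR0 ler_expR.
by apply: le_trans (expR_ge1Dxn j x0); rewrite lerDr.
Qed.

Lemma is_derive_expRN x : is_derive x 1 (fun y : R => expR (- y)) (- expR (- x)).
Proof.
have := @is_derive1_comp _ expR -%R x _ _ (is_derive_expR (- x)) (is_deriveNid x 1).
by rewrite mulrN1.
Qed.

Lemma is_derive_fE0 x : is_derive x 1 (fE 0%N) (- fE 0%N x).
Proof.
have -> : fE 0%N = (fun y : R => expR (- y)) by apply/funext => y; exact: fE0.
exact: is_derive_expRN.
Qed.

Lemma is_derive_fE j x : is_derive x 1 (fE j.+1) (fE j x - fE j.+1 x).
Proof.
have h1 := is_derive_expRN x.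
have -> : fE j.+1 = (fun y => (j.+1`!%:R^-1) * (y ^+ j.+1 * expR (- y))) :> (R -> R).
  by apply/funext => y; rewrite /fE; ring.
have h2 : is_derive x 1 (fun y : R => y ^+ j.+1) (j.+1%:R * x ^+ j).
  have -> : (fun y : R => y ^+ j.+1) = id ^+ j.+1.
    by apply/funext => y; rewrite exprfctE.
  by have := is_deriveX j.+1 (is_derive_id x (1 : R)); rewrite /= scaler1.
have h3 := is_deriveM h2 h1.
have := is_derive_scalef (j.+1`!%:R^-1) h3.
congr is_derive; rewrite /fE factS natrM /GRing.scale/=.
have j0 : j.+1%:R != 0 :> R by rewrite pnatr_eq0.
have j1 : j`!%:R != 0 :> R by rewrite pnatr_eq0 -lt0n fact_gt0.
by move: (j.+1%:R) j0 (j`!%:R) j1 => u u0 v v0; field; rewrite u0 v0.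
Qed.

(** The probability that a Poisson variable of mean [x] is at least [K]. The derivatives of the
    weights telescope, so that for [K >= 1] its derivative is the single weight [fE K.-1]; the mean
    value theorem then gives its sign and its size near 0. *)
Definition fE_tail (K : nat) x := 1 - \sum_(k < K) fE k x.

Lemma is_derive_fE_tail K x : is_derive x 1 (fE_tail K.+1) (fE K x).
Proof.
elim: K => [|K IH].
  have -> : fE_tail 1%N = (fun y : R => 1 - fE 0%N y).
    by apply/funext => y; rewrite /fE_tail big_ord1.
  have := is_derive_subf (is_derive_cst (1 : R) x 1) (is_derive_fE0 x).
  by rewrite sub0r opprK.
have -> : fE_tail K.+2 = (fun y => fE_tail K.+1 y - fE K.+1 y) :> (R -> R).
  by apply/funext => y; rewrite /fE_tail big_ord_recr /= opprD addrA.
have := is_derive_subf IH (is_derive_fE K x).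
by rewrite subKr.
Qed.

Lemma fE_tail0 K : fE_tail K.+1 0 = 0 :> R.
Proof.
rewrite /fE_tail big_ord_recl /= fE0 oppr0 expR0 big1 ?addr0 ?subrr// => i _.
by rewrite /fE exprS !mul0r.
Qed.

Lemma fE_tail_ge0 K x : 0 <= x -> 0 <= fE_tail K.+1 x.
Proof.
move=> x0; have [c /andP[c0 _]] := mean_value x0 (fun y _ => is_derive_fE_tail K y).
by rewrite fE_tail0 !subr0 => ->; rewrite mulr_ge0 ?fE_ge0.
Qed.

Lemma fE_tail_le1 K x : 0 <= x -> fE_tail K x <= 1.
Proof.
by move=> x0; rewrite /fE_tail lerBlDr lerDl sumr_ge0// => i _; rewrite fE_ge0.
Qed.

(* The order [1/K] is not optimal; it is the reason for truncating at squares
   [K = m^2] below. *)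
Lemma fE_tail_sqr K x : 0 <= x -> (0 < K)%N -> fE_tail K.+1 x <= x ^+ 2 / K%:R.
Proof.
case: K => // K x0 _.
have [c /andP[c0 cx]] := mean_value x0 (fun y _ => is_derive_fE_tail K.+1 y).
rewrite fE_tail0 !subr0 => ->; rewrite ler_pdivlMr// mulrAC [fE _ _ * _]mulrC -mulr_fE.
rewrite expr2 ler_wpM2r// (le_trans _ cx)// ler_piMr//; exact: fE_le1.
Qed.

Lemma fEiE x : fEi x = fE_tail 2%N x.
Proof.
rewrite /fE_tail big_ord_recr/= big_ord1 fE0 /fEi /fE expr1 (_ : 1`! = 1)%N// divr1; ring.
Qed.

Lemma is_derive_fEi x : is_derive x 1 fEi (fE 1%N x).
Proof.
have -> : fEi = fE_tail 2%N :> (R -> R) by apply/funext => y; exact: fEiE.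
exact: is_derive_fE_tail.
Qed.

Lemma bump2_ge0 x : 0 <= bump2 x. Proof. exact: sqr_ge0. Qed.

(** The constant 4 comes from [(1 + x)^2], which is at most 4 for [x <= 1] and at most [4 x^2]
    beyond. *)
Lemma min_le_bump2 x y : 0 <= x -> y <= 1 -> y <= x ^+ 2 -> y <= 4 * bump2 x.
Proof.
move=> x0 y1 yx; have x2 : 0 < (1 + x) ^+ 2 by rewrite exprn_gt0//; lra.
rewrite /bump2 expr_div_n mulrA ler_pdivlMr//.
have [x1|x1] := leP x 1.
  apply: (@le_trans _ _ (x ^+ 2 * (1 + x) ^+ 2)); first by rewrite ler_pM2r.
  by rewrite mulrC ler_wpM2r ?sqr_ge0//; nra.
by apply: (@le_trans _ _ ((1 + x) ^+ 2)); [rewrite ler_piMl// ltW|nra].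
Qed.

(** By the recurrence [mulr_fE] and the bound 1 on the weights, [fE k x], [x * fE k x] and
    [x^2 * fE k x] are all at most [x^2]. Expanding [fE k x * (1 + x)^2] gives [4 x^2], a constant
    that does not depend on [k]. *)
Lemma fE_bump k x : (2 <= k)%N -> 0 < x -> 0 <= fE k x <= 4 * bump2 x.
Proof.
case: k => [|[|j]]// _ x0; rewrite fE_ge0 ?(ltW x0)//=.
have x2 : 0 < (1 + x) ^+ 2 by rewrite exprn_gt0//; lra.
rewrite /bump2 expr_div_n mulrA ler_pdivlMr//.
have h1 := mulr_fE j x; have h2 := mulr_fE j.+1 x.
have h3 := mulr_fE j.+2 x; have h4 := mulr_fE j.+3 x.
have b0 := fE_le1 j (ltW x0); have b1 := fE_le1 j.+1 (ltW x0).
have b2 := fE_le1 j.+2 (ltW x0).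
have c0 := fE_ge0 j (ltW x0); have c1 := fE_ge0 j.+1 (ltW x0).
have c2 := fE_ge0 j.+2 (ltW x0).
have e2 : fE j.+2 x <= x ^+ 2 * fE j x.
  rewrite expr2 -mulrA h1 mulrCA h2 mulrA ler_peMl//.
  by rewrite -natrM ler1n muln_gt0.
have e3 : x * fE j.+2 x <= x ^+ 2.
  apply: (@le_trans _ _ (x * (x * fE j.+1 x))); last by nra.
  by rewrite h2 ler_wpM2l ?(ltW x0)// ler_peMl// ler1n.
have -> : fE j.+2 x * (1 + x) ^+ 2 =
  fE j.+2 x + 2 * (x * fE j.+2 x) + x ^+ 2 * fE j.+2 x by ring.
nra.
Qed.

Lemma fEi_bump x : 0 < x -> 0 <= fEi x <= 4 * bump2 x.
Proof.
move=> x0; have x1 := ltW x0.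
rewrite fEiE fE_tail_ge0//= min_le_bump2 ?fE_tail_le1//.
by have := fE_tail_sqr x1 (ltn0Sn 0); rewrite divr1.
Qed.

End Poisson.

(** * Regularity of tilted functions, and Mellin transforms at -1 *)

Section TiltRegularity.
Context {R : realType}.
Implicit Types (x t s : R).

(** With [x = expR t], [tilt bump2 t] is [x / (1 + x)^2], whose logarithmic derivative
    [(1 - x) / (1 + x)] lies between -1 and 1. The bound moves an estimate at an intermediate point
    back to [t]. *)
Lemma tilt_bump2_shift t u : tilt bump2 (t + u) <= expR `|u| * tilt bump2 t.
Proof.
rewrite /tilt /bump2 opprD !expRD.
have x0 := expR_gt0 t; have y0 := expR_gt0 u; rewrite !expRN.
move: (expR t) x0 => x x0.
have xx : 0 < 1 + x by lra.
have -> : x^-1 * (x / (1 + x)) ^+ 2 = x / (1 + x) ^+ 2.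
  by field; rewrite !gt_eqF.
have [u0|u0] := leP 0 u.
  have y1 : 1 <= expR u by rewrite -expR0 ler_expR.
  rewrite ger0_norm//; move: (expR u) y0 y1 => y y0 y1.
  have xy : 0 < 1 + x * y by rewrite addr_gt0// mulr_gt0.
  have -> : x^-1 * y^-1 * (x * y / (1 + x * y)) ^+ 2 = y * (x / (1 + x * y) ^+ 2).
    by field; rewrite !gt_eqF.
  rewrite ler_pM2l// ler_pM2l// lef_pV2 ?posrE ?exprn_gt0//.
  by rewrite lerXn2r ?nnegrE ?(ltW xx) ?(ltW xy)// lerD2l ler_peMr ?(ltW x0).
have y1 : expR u <= 1 by rewrite -expR0 ler_expR ltW.
rewrite ltr0_norm// expRN; move: (expR u) y0 y1 => y y0 y1.
have xy : 0 < 1 + x * y by rewrite addr_gt0// mulr_gt0.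
have -> : x^-1 * y^-1 * (x * y / (1 + x * y)) ^+ 2 = y * x / (1 + x * y) ^+ 2.
  by field; rewrite !gt_eqF.
rewrite -subr_ge0.
have -> : y^-1 * (x / (1 + x) ^+ 2) - y * x / (1 + x * y) ^+ 2 =
   x / (y * (1 + x) ^+ 2 * (1 + x * y) ^+ 2) * ((1 - y) * (1 + 2 * x * y + y)).
  by field; rewrite !gt_eqF.
apply: mulr_ge0; first by rewrite divr_ge0 ?mulr_ge0 ?exprn_ge0 ?ltW.
by rewrite mulr_ge0 ?subr_ge0// !addr_ge0 ?mulr_ge0 ?ltW.
Qed.

(** At [x = expR t] the derivative of [tilt f] is [expR (- t) * (x * f' x) - tilt f t]: two terms,
    each at most [C * tilt bump2]. The factor [expR 1] pays for evaluating [tilt bump2] at [t]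
    instead of the mean value point. *)
Lemma tilt_lipschitz (f f' : R -> R) (C : R) :
  (forall x, 0 < x -> `|f x| <= C * bump2 x) ->
  (forall x, 0 < x -> is_derive x 1 f (f' x)) ->
  (forall x, 0 < x -> `|x * f' x| <= C * bump2 x) ->
  forall t s, `|s| <= 1 -> `|tilt f (t + s) - tilt f t| <=
    2 * C * expR 1 * `|s| * tilt bump2 t.
Proof.
move=> fC df f'C t s s1.
have C0 : 0 <= C.
  have := le_trans (normr_ge0 _) (fC 1 ltr01).
  by rewrite pmulr_lge0// /bump2 exprn_gt0// divr_gt0//; lra.
have dt (u : R) : is_derive u 1 (tilt f) (expR (- u) * (expR u * f' (expR u)) - tilt f u).
  have h1 := is_derive_expRN u.
  have h2 := @is_derive1_comp _ f expR u _ _ (df _ (expR_gt0 u)) (is_derive_expR u).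
  have := is_deriveM h1 h2; congr is_derive.
  by rewrite /GRing.scale/= /tilt; ring.
have dbound u : `|expR (- u) * (expR u * f' (expR u)) - tilt f u| <=
    2 * C * tilt bump2 u.
  apply: (le_trans (ler_normB _ _)); rewrite /tilt !normrM.
  rewrite (ger0_norm (expR_ge0 (- u))) -mulrDr mulrCA ler_wpM2l ?expR_ge0//.
  rewrite -normrM -mulrA mulr_natl mulr2n lerD ?f'C ?fC ?expR_gt0//.
have main a b c : a <= c <= b -> `|c - t| <= 1 ->
  `|(expR (- c) * (expR c * f' (expR c)) - tilt f c) * (b - a)| <=
    2 * C * expR 1 * `|b - a| * tilt bump2 t.
  move=> _ ct; rewrite normrM mulrAC ler_wpM2r// (le_trans (dbound c))//.
  rewrite -[leRHS]mulrA ler_wpM2l ?mulr_ge0//.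
  have := tilt_bump2_shift t (c - t); rewrite [t + _]addrC subrK => /le_trans; apply.
  rewrite ler_wpM2r ?ler_expR// /tilt mulr_ge0 ?expR_ge0// bump2_ge0//.
have [s0|s0] := leP 0 s.
  have [c hc ->] : exists2 c, t <= c <= t + s & tilt f (t + s) - tilt f t =
    (expR (- c) * (expR c * f' (expR c)) - tilt f c) * (t + s - t).
    by apply: mean_value => //; lra.
  have -> : `|s| = `|t + s - t| by congr `| _ |; ring.
  apply: (main t (t + s)) => //; rewrite ger0_norm// in s1.
  by case/andP: hc => h1 h2; rewrite ger0_norm; lra.
have [c hc e] : exists2 c, t + s <= c <= t & tilt f t - tilt f (t + s) =
    (expR (- c) * (expR c * f' (expR c)) - tilt f c) * (t - (t + s)).
  by apply: mean_value => //; lra.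
rewrite distrC e; have -> : `|s| = `|t - (t + s)| by rewrite -normrN; congr `| _ |; ring.
apply: (main (t + s) t) => //; rewrite ltr0_norm// in s1.
by case/andP: hc => h1 h2; rewrite ler0_norm; lra.
Qed.

(** The substitution [x = expR t] turns [tilt f t dt] into [f x / x^2 dx], the integrand of
    [mellin f (-1)]. One primitive thus provides both the [G] of the renewal theorem and the value
    of the Mellin transform. *)
Lemma tilt_primitive (f G : R -> R) :
  (forall x, 0 < x -> is_derive x 1 G (f x / x ^+ 2)) ->
  forall t : R, is_derive t 1 (G \o expR) (tilt f t).
Proof.
move=> dG t.
have := @is_derive1_comp _ G expR t _ _ (dG _ (expR_gt0 t)) (is_derive_expR t).
congr is_derive; rewrite /tilt expRN; field.
by rewrite gt_eqF ?expR_gt0.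
Qed.

Lemma vanishing_comp_expR (g : R -> R) K : (forall x, 0 < x -> `|g x| <= K / x) ->
  vanishing (g \o expR).
Proof.
move=> hg e e0; have K0 : 0 <= K.
  by have := le_trans (normr_ge0 _) (hg 1 ltr01); rewrite divr1.
have K1 : 0 < K + 1 by lra.
exists (ln ((K + 1) / e)) => t ht /=; apply: (le_trans (hg _ (expR_gt0 t))).
rewrite ler_pdivrMr ?expR_gt0// mulrC -ler_pdivrMr//.
apply: (@le_trans _ _ ((K + 1) / e)); first by rewrite ler_pM2r ?invr_gt0//; lra.
by rewrite -[leLHS]lnK ?posrE ?divr_gt0// ler_expR.
Qed.

(** The primitive [G] goes from 0 at [0+] to [c] at infinity. The fundamental theorem of calculus
    applies on [[a, +oo[] for [a > 0], and monotone convergence along [a = 1 / (i + 1)] reaches the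
    open half-line. *)
Lemma mellinN1 (f G : R -> R) (K c : R) : 0 <= K ->
  (forall x, 0 < x -> 0 <= f x) -> {in `]0, +oo[, continuous f} ->
  (forall x, 0 < x -> is_derive x 1 G (f x / x ^+ 2)) ->
  (forall x, 0 < x -> `|G x| <= K * x) ->
  (forall x, 0 < x -> `|G x - c| <= K / x) ->
  mellin f (-1) = c.
Proof.
move=> K0 f0 cf dG G0 Gc; rewrite /mellin /Rintegral.
pose g x := f x * x ^- 2.
have cg x : 0 < x -> {for x, continuous g}.
  move=> x0; apply: continuousM; first by apply: cf; rewrite in_itv/= x0.
  apply: continuousV; last exact: exprn_continuous.
  by rewrite expf_neq0// gt_eqF.
have Gy : G x @[x --> +oo] --> c.
  apply/cvgrPdist_le => e e0; exists (K / e); split; first exact: num_real.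
  move=> x Kx; have x0 : 0 < x by rewrite (le_lt_trans _ Kx)// divr_ge0// ltW.
  rewrite distrC (le_trans (Gc _ x0))// ler_pdivrMr// -ler_pdivrMl// mulrC.
  exact: ltW.
have I (a : R) : 0 < a ->
    (\int[lebesgue_measure]_(x in `[a, +oo[) (g x)%:E = (c - G a)%:E)%E.
  move=> a0; rewrite (@ge0_continuous_FTC2y _ g G a c)//.
  - move=> x ax; have x0 := lt_le_trans a0 ax.
    by rewrite mulr_ge0 ?f0// invr_ge0 exprn_ge0// ltW.
  - apply: continuous_in_subspaceT => x; rewrite inE/= in_itv/= andbT => ax.
    exact/cg/(lt_le_trans a0 ax).
  - by move=> x ax; have [] := dG x (lt_trans a0 ax).
  - apply: cvg_at_right_filter; have [d _] := dG a a0.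
    exact/differentiable_continuous/derivable1_diffP.
  - move=> x; rewrite in_itv/= andbT => ax.
    by rewrite derive1E; have [_ ->] := dG x (lt_trans a0 ax).
have -> : (\int[lebesgue_measure]_(x in `](0%R : R), +oo[) (f x * x `^ (-1 - 1)%R)%:E =
    \int[lebesgue_measure]_(x in `](0%R : R), +oo[) (g x)%:E)%E.
  apply: eq_integral => x; rewrite inE/= in_itv/= andbT => x0; rewrite /g.
  by congr (_ * _)%:E; rewrite (_ : -1 - 1 = - (2%:R)) ?powR_invn ?ltW//; ring.
pose u (i : nat) : R := i.+1%:R^-1.
have u0 i : 0 < u i by rewrite invr_gt0.
have -> : [set` `](0%R : R), +oo[] = \bigcup_i [set` `[u i, +oo[].
  apply/seteqP; split=> [x /=|x [i _] /=]; rewrite !in_itv/= !andbT; last first.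
    exact: lt_le_trans.
  move=> x0; exists (Num.truncn x^-1) => //=; rewrite in_itv/= andbT.
  rewrite /u -[leRHS]invrK lef_pV2 ?posrE ?invr_gt0// ltW//.
  by rewrite truncnS_gt.
have cv : (\int[lebesgue_measure]_(x in [set` `[u i, +oo[]) (g x)%:E
    @[i --> \oo] --> c%:E)%E.
  under eq_fun do rewrite I//.
  apply: cvg_EFin; first exact: nearW.
  rewrite -[X in _ --> X]subr0; apply: cvgB; first exact: cvg_cst.
  apply: norm_cvg0; apply: (@squeeze_cvgr _ _ _ _ (cst 0)
    (fun i : nat => K * u i)).
  - by apply: nearW => i; rewrite normr_ge0 G0.
  - exact: cvg_cst.
  - by rewrite -[X in _ --> X](mulr0 K); apply: cvgMl_tmp; exact: cvg_harmonic.
suff cv' : (\int[lebesgue_measure]_(x in [set` `[u i, +oo[]) (g x)%:E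
    @[i --> \oo] -->
    \int[lebesgue_measure]_(x in \bigcup_i [set` `[u i, +oo[]) (g x)%:E)%E.
  by rewrite (cvg_unique _ cv' cv).
apply: ge0_nondecreasing_set_cvg_integral.
- apply/nondecreasing_seqP => i; rewrite subsetEset => x /=.
  rewrite !in_itv/= !andbT; apply: le_trans.
  by rewrite /u lef_pV2 ?posrE// ler_nat.
- by move=> i; exact: measurable_itv.
- move=> i; apply/measurable_realfun.measurable_EFinP.
  have mg : measurable_fun [set` `](0%R : R), +oo[] g.
    apply: measurable_realfun.open_continuous_measurable_fun; first exact: interval_open.
    by move=> x; rewrite inE/= in_itv/= andbT => x0; exact: cg.
  apply: (measurable_funS _ _ mg); first exact: measurable_itv.
  by move=> x /=; rewrite !in_itv/= !andbT; exact: lt_le_trans.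
- move=> i x /=; rewrite in_itv/= andbT => ix; rewrite lee_fin.
  have x0 : 0 < x by exact: lt_le_trans ix.
  by rewrite mulr_ge0 ?f0// invr_ge0 exprn_ge0// ltW.
Qed.

End TiltRegularity.

Section Instances.
Context {R : realType} {A : finType}.
Variable p : A -> R.
Hypothesis hA : (2 <= #|A|)%N.
Hypothesis p_gt0 : forall a, 0 < p a.
Hypothesis p_sum1 : \sum_a p a = 1.

Definition renewal_asymptotics (f : R -> R) :=
  exists (F : R -> R) (K : R), [/\
    vanishing (fun t => F t - psi p f t / entropy p),
    forall t, 0 <= F t <= K &
    forall M t, 0 <= F t - fsum p f M t <=
      K * expR t * (\sum_a p a ^+ 2) ^+ M].

Lemma renewal_of_primitive (f f' G : R -> R) (C K c : R) :
  (forall x, 0 < x -> 0 <= f x <= C * bump2 x) ->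
  (forall x : R, 0 < x -> is_derive x 1 f (f' x)) ->
  (forall x, 0 < x -> `|x * f' x| <= C * bump2 x) ->
  (forall x : R, 0 < x -> is_derive x 1 G (f x / x ^+ 2)) ->
  (forall x, 0 < x -> `|G x| <= K * x) ->
  (forall x, 0 < x -> `|G x - c| <= K / x) ->
  mellin f (-1) = c /\ renewal_asymptotics f.
Proof.
move=> fC df f'C dG G0 Gc.
have K0 : 0 <= K by have := le_trans (normr_ge0 _) (G0 1 ltr01); rewrite mulr1.
have C0 : 0 <= C.
  have /andP[a0 /(le_trans a0)] := fC _ ltr01.
  by rewrite pmulr_lge0// /bump2 exprn_gt0// divr_gt0//; lra.
have hm : mellin f (-1) = c.
  apply: (mellinN1 K0) dG G0 Gc => [x /fC/andP[]//|x].
  rewrite in_itv/= andbT => /df [d _].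
  exact/differentiable_continuous/derivable1_diffP.
split=> //.
have e1 : 1 <= expR 1 :> R by rewrite -expR0 ler_expR.
have Ce : C <= 2 * C * expR 1 by nra.
(* The first summand is the constant of [tilt_lipschitz]. The second bounds [G], by [K * x] for
   [x <= 1] and by [c + K / x] beyond. *)
pose C' := 2 * C * expR 1 + (`|c| + K).
have CC' : 2 * C * expR 1 <= C' by rewrite lerDl addr_ge0.
apply: (@renewal_theorem _ _ p hA p_gt0 p_sum1 f (G \o expR) C').
- move=> x x0; have /andP[-> h] := fC x x0; rewrite (le_trans h)//.
  by rewrite ler_wpM2r ?bump2_ge0// (le_trans Ce).
- move=> t s s1; apply: (le_trans (@tilt_lipschitz _ f f' C _ df f'C t s s1)).
    by move=> x /fC/andP[h1 h2]; rewrite ger0_norm.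
  apply: ler_wpM2r; first by rewrite /tilt mulr_ge0 ?expR_ge0 ?bump2_ge0.
  by rewrite ler_wpM2r.
- by move=> t; exact: tilt_primitive.
- move=> t /=; have x0 := expR_gt0 t; move: (expR t) x0 => x x0.
  apply: (@le_trans _ _ (`|c| + K)); last by rewrite lerDr !mulr_ge0// expR_ge0.
  have [x1|/ltW x1] := leP x 1.
    apply: (le_trans (ler_norm _)); apply: (le_trans (G0 _ x0)).
    by apply: (@le_trans _ _ K); [rewrite ler_piMr|rewrite lerDr].
  rewrite -[G x](subrK c) addrC lerD ?ler_norm// (le_trans (ler_norm _))//.
  by rewrite (le_trans (Gc _ x0))// ler_piMr// invf_le1.
- apply: (@vanishing_eq _ ((fun x => G x^-1) \o expR)).
    by move=> t; rewrite /= expRN.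
  apply: (@vanishing_comp_expR _ _ K) => x x0.
  by apply: G0; rewrite invr_gt0.
- apply: (@vanishing_eq _ ((fun x => G x - c) \o expR)).
    by move=> t; rewrite /= hm.
  exact: (@vanishing_comp_expR _ _ K).
Qed.

Lemma renewal_fEi : mellin fEi (-1) = 1 :> R /\ renewal_asymptotics fEi.
Proof.
(* The derivative of [(1 - expR (- x)) / x] is [- fEi x / x^2]. The constant is [8 = 2 * 4] because
   [x * fE 1 x = 2 * fE 2 x]. *)
apply: (@renewal_of_primitive _ (fE 1%N) (fun x => 1 - (1 - expR (- x)) / x) 8 1).
- move=> x x0; have /andP[-> h] := fEi_bump x0; rewrite (le_trans h)//.
  by rewrite ler_wpM2r ?bump2_ge0//; lra.
- by move=> x _; exact: is_derive_fEi.
- move=> x x0; rewrite mulr_fE ger0_norm ?mulr_ge0 ?fE_ge0 ?(ltW x0)//.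
  rewrite (_ : 8 = 2 * 4) -?mulrA ?ler_pM2l//; last by ring.
  by have /andP[] := @fE_bump R 2 x isT x0.
- move=> x x0.
  have h1 := is_derive_expRN x.
  have h2 := is_derive_subf (is_derive_cst (1 : R) x 1) h1.
  have h3 := is_deriveV (lt0r_neq0 x0) (is_derive_id x 1).
  have := is_derive_subf (is_derive_cst (1 : R) x 1) (is_deriveM h2 h3).
  congr is_derive; rewrite /GRing.scale/= /fEi; field.
  by rewrite gt_eqF.
- move=> x x0; rewrite mul1r.
  have h1 := expR_ge1Dx (- x); have h2 := expR_ge1Dx x.
  have e0 := expR_gt0 (- x).
  have h3 : (1 + x) * expR (- x) <= 1.
    by rewrite expRN ler_pdivrMr ?expR_gt0// mul1r.
  rewrite ger0_norm; last by rewrite subr_ge0 ler_pdivrMr// mul1r; lra.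
  have h4 : x * (1 - x) <= x * expR (- x) by rewrite ler_pM2l.
  rewrite lerBlDr -lerBlDl ler_pdivlMr// [leLHS]mulrC (le_trans h4)// lerBrDl.
  by rewrite -[X in X + _]mul1r -mulrDl.
- move=> x x0; have h1 := expR_ge1Dx (- x); have e0 := expR_gt0 (- x).
  have e1 : expR (- x) <= 1 by rewrite -expR0 ler_expR oppr_le0 ltW.
  rewrite addrAC subrr add0r normrN ger0_norm ?divr_ge0 ?subr_ge0 ?(ltW x0)//.
  by rewrite ler_pM2r ?invr_gt0//; lra.
Qed.

(** Applying the recurrence twice gives [fE k x / x^2 = fE (k - 2) x / (k (k - 1))], so the
    primitive is a multiple of the Poisson tail of order [k - 1], which rises from 0 to 1. The
    constant [K] covers [x] times the complementary sum, since [x * fE i x = (i + 1) * fE (i + 1) x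
    <= i + 1]. *)
Lemma renewal_fE k : (2 <= k)%N ->
  mellin (fE k) (-1) = (k%:R * (k%:R - 1))^-1 :> R /\ renewal_asymptotics (fE k).
Proof.
case: k => [|[|j]]// _; rewrite -[X in _ - X]/(1%:R) -natrB// subn1 /=.
set c : R := _^-1.
have c0 : 0 < c by rewrite invr_gt0 mulr_gt0.
have c1 : c <= 1 by rewrite invf_le1 ?mulr_gt0// -natrM ler1n muln_gt0.
have j1 : j.+1%:R != 0 :> R by rewrite pnatr_eq0.
have j2 : j.+2%:R != 0 :> R by rewrite pnatr_eq0.
pose C : R := 4 * (j.+2%:R + j.+3%:R).
have C4 : 4 <= C.
  have : 1 <= j.+2%:R :> R by rewrite ler1n.
  by have : 0 <= j.+3%:R :> R by []; rewrite /C; lra.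
pose K : R := 1 + \sum_(i < j.+1) i.+1%:R.
have K1 : 1 <= K by rewrite lerDl sumr_ge0.
apply: (@renewal_of_primitive _ (fun x => fE j.+1 x - fE j.+2 x)
  (fun x => c * fE_tail j.+1 x) C K).
- move=> x x0; have /andP[-> h] := @fE_bump R j.+2 x isT x0; rewrite (le_trans h)//.
  by rewrite ler_wpM2r ?bump2_ge0.
- by move=> x _; exact: is_derive_fE.
- move=> x x0; rewrite mulrBr !mulr_fE; apply: (le_trans (ler_normB _ _)).
  have n1 (i l : nat) : `|i%:R * fE l x| = i%:R * fE l x.
    by rewrite ger0_norm// mulr_ge0// fE_ge0// ltW.
  rewrite !n1.
  have /andP[_ b2] := @fE_bump R j.+2 x isT x0.
  have /andP[_ b3] := @fE_bump R j.+3 x isT x0.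
  have -> : C * bump2 x = j.+2%:R * (4 * bump2 x) + j.+3%:R * (4 * bump2 x).
    by rewrite /C; move: (j.+2%:R) (j.+3%:R) => u v; ring.
  by rewrite lerD// ler_wpM2l.
- move=> x x0; have := is_derive_scalef c (is_derive_fE_tail j x).
  congr is_derive; rewrite /c.
  have -> : fE j x = j.+1%:R * j.+2%:R * fE j.+2 x / x ^+ 2.
    have := mulr_fE j x; have := mulr_fE j.+1 x.
    move: (j.+1%:R) (j.+2%:R) j1 j2 => u v u0 v0 h2 h1.
    have -> : u * v * fE j.+2 x = x ^+ 2 * fE j x.
      by rewrite -mulrA -h2 mulrCA -h1; ring.
    by rewrite mulrAC mulfV ?mul1r// expf_neq0// gt_eqF.
  move: (j.+1%:R) (j.+2%:R) j1 j2 => u v u0 v0; field.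
  by rewrite u0 v0 gt_eqF.
- move=> x x0; have t0 := fE_tail_ge0 j (ltW x0).
  rewrite ger0_norm ?mulr_ge0 ?(ltW c0)//.
  apply: (@le_trans _ _ (fE_tail j.+1 x)); first by rewrite ler_piMl.
  apply: (@le_trans _ _ x); last by rewrite ler_peMl// ltW.
  rewrite /fE_tail lerBlDr big_ord_recl fE0 addrA -lerBlDr.
  apply: (@le_trans _ _ 1); last by have := expR_ge1Dx (- x); lra.
  by rewrite lerBlDr lerDl sumr_ge0// => i _; rewrite fE_ge0// ltW.
- move=> x x0; rewrite /fE_tail mulrBr mulr1 addrAC subrr add0r normrN.
  rewrite ger0_norm; last first.
    by rewrite mulr_ge0 ?(ltW c0)// sumr_ge0// => i _; rewrite fE_ge0 ?ltW.
  rewrite ler_pdivlMr// -mulrA.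
  set S := \sum_(k < _) _; have S0 : 0 <= S.
    by rewrite sumr_ge0// => i _; rewrite fE_ge0 ?ltW.
  apply: (@le_trans _ _ (S * x)); first by rewrite ler_piMl// mulr_ge0// ltW.
  rewrite mulr_suml; apply: (@le_trans _ _ (\sum_(i < j.+1) i.+1%:R)); last first.
    by rewrite lerDr.
  by apply: ler_sum => i _; rewrite mulrC mulr_fE ler_piMr// fE_le1// ltW.
Qed.

End Instances.

(** * Finitely many letters of finitely many strings *)

Local Close Scope classical_set_scope.

Section ProductSpace.
Context {R : realType} {U : finType}.
Variable mu : U -> R.
Hypothesis mu_ge0 : forall u, 0 <= mu u.
Hypothesis mu_sum1 : \sum_u mu u = 1.
Variable n : nat.
Implicit Types (E : pred U) (tau : {ffun 'I_n -> U}).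

(** Used on two levels: for the [M] letters of one string, and for [n] strings of [M] letters
    each. *)
Definition pweight tau : R := \prod_i mu (tau i).

Lemma pweight_ge0 tau : 0 <= pweight tau.
Proof. by apply: prodr_ge0 => i _. Qed.

Lemma sum_prod_ffun (phi : 'I_n -> U -> R) :
  \sum_(tau : {ffun 'I_n -> U}) \prod_i phi i (tau i) = \prod_i \sum_u phi i u.
Proof. by rewrite bigA_distr_bigA. Qed.

Lemma pweight_sum1 : \sum_tau pweight tau = 1.
Proof. by rewrite (sum_prod_ffun (fun=> mu)) big1. Qed.

Definition mass E : R := \sum_(u | E u) mu u.

Lemma mass_ge0 E : 0 <= mass E. Proof. exact: sumr_ge0. Qed.

Lemma mass_indic E : \sum_u mu u * (E u)%:R = mass E.
Proof.
rewrite /mass [RHS]big_mkcond/=; apply: eq_bigr => u _.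
by case: (E u); rewrite ?mulr1 ?mulr0.
Qed.

Lemma massC E : mass (predC E) = 1 - mass E.
Proof. by rewrite -mu_sum1 (bigID E)/= addrC addrK. Qed.

Lemma prod_indic (I : finType) (b : pred I) :
  \prod_i (b i)%:R = [forall i, b i]%:R :> R.
Proof.
case: (boolP [forall i, b i]) => [/forallP h|].
  by rewrite big1// => i _; rewrite h.
by rewrite negb_forall => /existsP[i /negbTE hi]; rewrite (bigD1 i)//= hi mul0r.
Qed.

Lemma card_setC_ord (I : {set 'I_n}) : #|~: I| = (n - #|I|)%N.
Proof. by rewrite cardsCs finset.setCK card_ord. Qed.

Definition hits E tau : {set 'I_n} := [set i | E (tau i)].

Lemma hits_eq E tau (I : {set 'I_n}) :
  (hits E tau == I) = [forall i, E (tau i) == (i \in I)].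
Proof.
apply/eqP/forallP => [<- i|h]; first by rewrite inE.
by apply/setP => i; rewrite inE; exact/eqP.
Qed.

Lemma sum_pweight_hits E (I : {set 'I_n}) :
  \sum_tau pweight tau * (hits E tau == I)%:R =
  mass E ^+ #|I| * (1 - mass E) ^+ (n - #|I|).
Proof.
transitivity (\sum_(tau : {ffun 'I_n -> U})
    \prod_i (mu (tau i) * (E (tau i) == (i \in I))%:R)).
  by apply: eq_bigr => tau _; rewrite hits_eq -prod_indic -big_split.
rewrite (sum_prod_ffun (fun i u => mu u * (E u == (i \in I))%:R)).
transitivity (\prod_i ((if i \in I then mass E else 1) *
    (if i \in ~: I then 1 - mass E else 1))).
  apply: eq_bigr => i _; rewrite inE; case: (i \in I) => /=.
    by rewrite mulr1 -mass_indic; apply: eq_bigr => u _; rewrite eqb_id.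
  by rewrite mul1r -massC -mass_indic; apply: eq_bigr => u _; rewrite eqbF_neg.
by rewrite big_split/= -!big_mkcond !prodr_const card_setC_ord.
Qed.

Lemma card_indic_sum (F : finType) (Q : pred F) (x : F) :
  (Q x)%:R = \sum_(y | Q y) (x == y)%:R :> R.
Proof.
have [Qx|nQx] := boolP (Q x).
  rewrite (bigD1 x)//= eqxx big1 ?addr0// => y /andP[_ /negbTE].
  by rewrite eq_sym => ->.
by rewrite big1// => y Qy; case: eqP => // e; rewrite e Qy in nQx.
Qed.

Lemma card_ksets k : #|[set I : {set 'I_n} | #|I| == k]| = 'C(n, k).
Proof. by rewrite card_draws card_ord. Qed.

Lemma prob_count E k :
  \sum_tau pweight tau * (#|hits E tau| == k)%:R =
  'C(n, k)%:R * (mass E ^+ k * (1 - mass E) ^+ (n - k)).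
Proof.
under eq_bigr do rewrite (card_indic_sum (fun I : {set 'I_n} => #|I| == k)) mulr_sumr.
rewrite exchange_big/=; under eq_bigr do rewrite sum_pweight_hits.
rewrite (eq_bigr (fun=> mass E ^+ k * (1 - mass E) ^+ (n - k))) => [|I /eqP->//].
rewrite sumr_const mulr_natl -card_ksets; congr (_ *+ _).
by apply: eq_card => I; rewrite !inE.
Qed.

(** Sum over the sets [I] and [J] of indices that hit [E] and [E']. Overlapping pairs have
    probability 0 and disjoint ones the stated product; counting all pairs of [k]-sets, disjoint or
    not, makes this an upper bound. *)
Lemma prob_count2 E E' k : (forall u, ~~ (E u && E' u)) ->
  \sum_tau pweight tau * ((#|hits E tau| == k) && (#|hits E' tau| == k))%:R <=
  ('C(n, k) ^ 2)%:R * (mass E ^+ k * mass E' ^+ k *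
    (1 - mass E - mass E') ^+ (n - k - k)).
Proof.
move=> dis; set x := mass E; set y := mass E'.
have zE : \sum_u mu u * (~~ E u && ~~ E' u)%:R = 1 - x - y.
  rewrite -[X in _ = X - _ - _]mu_sum1 /x /y -!mass_indic -!sumrB; apply: eq_bigr => u _.
  by have := dis u; case: (E u); case: (E' u) => //= _; ring.
have z0 : 0 <= 1 - x - y by rewrite -zE sumr_ge0// => u _; rewrite mulr_ge0.
have h (I J : {set 'I_n}) : #|I| == k -> #|J| == k ->
  \sum_tau pweight tau * ((hits E tau == I)%:R * (hits E' tau == J)%:R) <=
    x ^+ k * y ^+ k * (1 - x - y) ^+ (n - k - k).
  move=> /eqP cI /eqP cJ.
  have -> : \sum_tau pweight tau * ((hits E tau == I)%:R * (hits E' tau == J)%:R) =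
      \prod_i \sum_u mu u * ((E u == (i \in I)) && (E' u == (i \in J)))%:R.
    rewrite -(sum_prod_ffun
      (fun i u => mu u * ((E u == (i \in I)) && (E' u == (i \in J)))%:R)).
    apply: eq_bigr => tau _; rewrite !hits_eq -!prod_indic -!big_split /=.
    by apply: eq_bigr => i _; rewrite -natrM mulnb.
  have [dIJ|/pred0Pn[i /andP[/= iI iJ]]] := boolP [disjoint I & J]; last first.
    rewrite (bigD1 i)//= [X in X * _]big1 ?mul0r.
      by rewrite !mulr_ge0 ?exprn_ge0 ?mass_ge0.
    move=> u _; rewrite [i \in I]iI [i \in J]iJ !eqb_id.
    by rewrite (negbTE (dis u)) mulr0.
  have -> : \prod_i \sum_u mu u * ((E u == (i \in I)) && (E' u == (i \in J)))%:R =
    \prod_i ((if i \in I then x else 1) * (if i \in J then y else 1) *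
      (if i \in ~: (I :|: J) then 1 - x - y else 1)).
    apply: eq_bigr => i _; rewrite !inE.
    case iI: (i \in I); case iJ: (i \in J) => /=.
    - by move/pred0P/(_ i): dIJ; rewrite /= iI iJ.
    - rewrite !mulr1 /x -mass_indic; apply: eq_bigr => u _.
      by have := dis u; case: (E u); case: (E' u).
    - rewrite mul1r mulr1 /y -mass_indic; apply: eq_bigr => u _.
      by have := dis u; case: (E u); case: (E' u).
    - rewrite !mul1r -zE; apply: eq_bigr => u _.
      by case: (E u); case: (E' u).
  rewrite !big_split/= -!big_mkcond !prodr_const card_setC_ord cardsU.
  have -> : I :&: J = finset.set0 by apply/eqP; rewrite setI_eq0.
  by rewrite cards0 subn0 cI cJ subnDA.
under eq_bigr => tau _.
  rewrite -mulnb natrM (card_indic_sum (fun I : {set 'I_n} => #|I| == k)).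
  rewrite (card_indic_sum (fun I : {set 'I_n} => #|I| == k) (hits E' tau)).
  rewrite big_distrlr/= mulr_sumr; under eq_bigr do rewrite mulr_sumr.
  over.
rewrite exchange_big/=; under eq_bigr do rewrite exchange_big/=.
set b := x ^+ k * y ^+ k * _.
apply: (@le_trans _ _ (\sum_(I : {set 'I_n} | #|I| == k)
    \sum_(J : {set 'I_n} | #|J| == k) b)).
  by apply: ler_sum => I cI; apply: ler_sum => J cJ; exact: h.
have cK : #|[pred I : {set 'I_n} | #|I| == k]| = 'C(n, k).
  by rewrite -card_ksets; apply: eq_card => I; rewrite !inE.
by rewrite !sumr_const cK -mulrnA -[leLHS]mulr_natl mulnn.
Qed.

Lemma prob_subset_hits E (S : {set 'I_n}) :
  \sum_tau pweight tau * (S \subset hits E tau)%:R = mass E ^+ #|S|.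
Proof.
have h tau : (S \subset hits E tau) = [forall i, (i \in S) ==> E (tau i)].
  apply/fintype.subsetP/forallP => [h i|h i iS]; first by apply/implyP => /h; rewrite inE.
  by rewrite inE; have := h i; rewrite iS.
transitivity (\sum_(tau : {ffun 'I_n -> U})
    \prod_i (mu (tau i) * ((i \in S) ==> E (tau i))%:R)).
  by apply: eq_bigr => tau _; rewrite h -prod_indic -big_split.
rewrite (sum_prod_ffun (fun i u => mu u * ((i \in S) ==> E u)%:R)).
rewrite -prodr_const [RHS]big_mkcond/=; apply: eq_bigr => i _.
case: (i \in S) => /=; first exact: mass_indic.
by rewrite -[RHS]mu_sum1; apply: eq_bigr => u _; rewrite mulr1.
Qed.

(** A factorial moment: the binomial coefficient counts the [k]-sets of indices all of which hit
    [E]. *)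
Lemma mean_binomial_hits E k :
  \sum_tau pweight tau * ('C(#|hits E tau|, k))%:R = 'C(n, k)%:R * mass E ^+ k.
Proof.
have h tau : ('C(#|hits E tau|, k))%:R =
    \sum_(S : {set 'I_n} | #|S| == k) (S \subset hits E tau)%:R :> R.
  rewrite -cards_draws -sum1_card natr_sum big_mkcond [RHS]big_mkcond/=.
  apply: eq_bigr => S _; rewrite inE.
  by case: (S \subset _); case: (#|S| == k).
under eq_bigr do rewrite h mulr_sumr.
rewrite exchange_big/=; under eq_bigr do rewrite prob_subset_hits.
rewrite (eq_bigr (fun=> mass E ^+ k)) => [|I /eqP->//].
rewrite sumr_const mulr_natl -card_ksets; congr (_ *+ _).
by apply: eq_card => I; rewrite !inE.
Qed.

(** Markov's inequality for the number of pairs of hits: more than [K] hits give at least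
    ['C(K.+1, 2)] pairs, and the mean number of pairs is ['C(n, 2) * mass E ^+ 2]. *)
Lemma prob_hits_gt E K : (0 < K)%N ->
  \sum_tau pweight tau * (K < #|hits E tau|)%N%:R <= (n%:R * mass E / K%:R) ^+ 2.
Proof.
move=> K0; have hK : 0 < 'C(K.+1, 2)%:R :> R by rewrite ltr0n bin_gt0.
have := mean_binomial_hits E 2.
set X := \sum_tau _ => hX.
apply: (@le_trans _ _ (X / 'C(K.+1, 2)%:R)).
  rewrite mulr_suml; apply: ler_sum => tau _; rewrite -mulrA ler_wpM2l ?pweight_ge0//.
  rewrite ler_pdivlMr//; case: ltnP => h; last by rewrite mul0r.
  by rewrite mul1r ler_nat leq_bin2l.
have bin2E l : ('C(l, 2) * 2 = l * l.-1)%N.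
  by have := bin_ffact l 2; rewrite ffactnS ffactn1.
have n2 : 'C(n, 2)%:R <= n%:R ^+ 2 / 2 :> R.
  rewrite ler_pdivlMr// -natrM -natrX ler_nat bin2E -mulnn leq_mul2l.
  by rewrite leq_pred orbT.
have K2 : 2^-1 <= 'C(K.+1, 2)%:R / K%:R ^+ 2 :> R.
  rewrite ler_pdivlMr ?exprn_gt0 ?ltr0n// mulrC ler_pdivrMr// -natrM -natrX.
  by rewrite ler_nat bin2E -mulnn leq_mul2r leqnSn orbT.
have m2 := exprn_ge0 2 (mass_ge0 E).
rewrite hX ler_pdivrMr//; apply: (le_trans (ler_wpM2r m2 n2)).
have -> : (n%:R * mass E / K%:R) ^+ 2 * 'C(K.+1, 2)%:R =
    n%:R ^+ 2 * mass E ^+ 2 * ('C(K.+1, 2)%:R / K%:R ^+ 2).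
  by rewrite !exprMn exprVn; ring.
by rewrite mulrAC ler_wpM2l// mulr_ge0// exprn_ge0.
Qed.

(** A collision is a pair of hits of some singleton, so its indicator is at most the number of such
    pairs, whose mean is known for each singleton. *)
Lemma prob_not_injective :
  \sum_tau pweight tau * (~~ injectiveb tau)%:R <=
  n%:R ^+ 2 * \sum_u mu u ^+ 2.
Proof.
have n2 : 'C(n, 2)%:R <= n%:R ^+ 2 :> R.
  rewrite -natrX ler_nat; have := bin_ffact n 2; rewrite ffactnS ffactn1 => e.
  rewrite (@leq_trans ('C(n, 2) * 2)%N) ?leq_pmulr// e -mulnn leq_mul2l.
  by rewrite leq_pred orbT.
apply: (@le_trans _ _ (\sum_u 'C(n, 2)%:R * mu u ^+ 2)); last first.
  by rewrite -mulr_sumr ler_wpM2r// sumr_ge0// => u _; rewrite exprn_ge0.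
under [leRHS]eq_bigr => u _.
  rewrite (_ : mu u = mass (pred1 u)); last by rewrite /mass big_pred1_eq.
  rewrite -mean_binomial_hits; over.
rewrite exchange_big/=; apply: ler_sum => tau _; rewrite -mulr_sumr.
rewrite ler_wpM2l ?pweight_ge0//.
have [|/injectivePn[i [j ij tij]]] := boolP (injectiveb tau).
  by rewrite sumr_ge0.
rewrite (bigD1 (tau i))//=.
apply: (@le_trans _ _ 'C(#|hits (pred1 (tau i)) tau|, 2)%:R); last first.
  by rewrite lerDl sumr_ge0.
rewrite ler_nat bin_gt0; apply/card_gt1P; exists i, j; split=> //; rewrite inE//=.
by rewrite tij.
Qed.

End ProductSpace.

Section Prefixes.
Context {A : finType}.
Implicit Types (x : infstr A) (s t : seq A).

Lemma has_prefixP (a0 : A) x s :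
  reflect (forall j, (j < size s)%N -> x j = nth a0 s j) (has_prefix x s).
Proof.
apply: (iffP eqP) => [<- j|h].
  by rewrite size_mkseq => js; rewrite nth_mkseq.
apply: (@eq_from_nth _ a0); rewrite size_mkseq// => j js.
by rewrite nth_mkseq// h.
Qed.

Lemma has_prefix_total x s t : has_prefix x s -> has_prefix x t ->
  prefix s t || prefix t s.
Proof.
wlog le_st : s t / (size s <= size t)%N => [hwlog hs ht|].
  by have [/hwlog->//|/ltnW/hwlog] := leqP (size s) (size t); rewrite orbC; apply.
move=> /eqP hs /eqP ht; apply/orP; left; rewrite prefixE -ht -[in X in _ == X]hs.
by rewrite /mkseq -map_take take_iota (minn_idPl le_st).
Qed.

Lemma has_prefix_prefix x s t : prefix s t -> has_prefix x t -> has_prefix x s.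
Proof.
case: s => [|a s] // st /(has_prefixP a) h; apply/(has_prefixP a) => j js.
have /prefixP[u tE] := st; rewrite h tE ?nth_cat ?js// size_cat.
exact: ltn_addr.
Qed.

(** Prefixes of one word are determined by their lengths, all of which are below [M]. *)
Lemma count_prefixes M s : (size s < M)%N ->
  (count (fun t => prefix t s) (words M) <= M)%N.
Proof.
move=> sM; rewrite -size_filter -(size_map size) -{2}(size_iota 0 M).
apply: uniq_leq_size.
  rewrite map_inj_in_uniq ?filter_uniq ?words_uniq// => t u.
  rewrite !mem_filter => /andP[/prefixP[t' st] _] /andP[/prefixP[u' su] _] e.
  by have := congr1 (take (size t)) st; rewrite {1}su {1}e !take_size_cat.
move=> l /mapP[t]; rewrite mem_filter mem_words => /andP[_ tM] ->.
by rewrite mem_iota.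
Qed.

End Prefixes.

Section WordSpace.
Context {R : realType} {A : finType}.
Variable p : A -> R.
Hypothesis p_gt0 : forall a, 0 < p a.
Hypothesis p_sum1 : \sum_a p a = 1.
Variables (a0 : A) (M : nat).

(** Padding makes the trie functions, which expect infinite strings, applicable to finite words;
    tests against words of length at most [M] do not see the padding. *)
Definition ext (u : {ffun 'I_M -> A}) : infstr A :=
  fun j => if insub j is Some i then u i else a0.

Lemma extE u (i : 'I_M) : ext u i = u i.
Proof. by rewrite /ext valK. Qed.

Definition wordweight (u : {ffun 'I_M -> A}) : R := pweight p u.

Lemma has_prefix_ext u s : (size s <= M)%N -> has_prefix (ext u) s =
  [forall j : 'I_M, (j < size s)%N ==> (u j == nth a0 s j)].
Proof.
move=> sM; apply/(has_prefixP a0)/forallP => [h j|h j js].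
  by apply/implyP => js; rewrite -extE h.
have := h (Ordinal (leq_trans js sM)); rewrite /= js => /eqP <-.
by rewrite -extE.
Qed.

Lemma wordweight_ge0 u : 0 <= wordweight u.
Proof. by apply: pweight_ge0 => a; exact: ltW. Qed.

Lemma wordweight_sum1 : \sum_u wordweight u = 1.
Proof. exact: pweight_sum1. Qed.

Lemma sum_wordweight_sqr : \sum_u wordweight u ^+ 2 = (\sum_a p a ^+ 2) ^+ M.
Proof.
transitivity (\sum_(u : {ffun 'I_M -> A}) \prod_j (p (u j) ^+ 2)).
  by apply: eq_bigr => u _; rewrite /wordweight /pweight prodrXl.
by rewrite (sum_prod_ffun (fun=> fun a => p a ^+ 2)) prodr_const card_ord.
Qed.

Lemma mass_has_prefix s : (size s <= M)%N ->
  mass wordweight (fun u => has_prefix (ext u) s) = wt p s.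
Proof.
move=> sM; rewrite -mass_indic.
transitivity (\sum_(u : {ffun 'I_M -> A})
    \prod_j (p (u j) * ((j < size s)%N ==> (u j == nth a0 s j))%:R)).
  by apply: eq_bigr => u _; rewrite has_prefix_ext// -prod_indic -big_split.
rewrite (sum_prod_ffun (fun j a => p a * ((j < size s)%N ==> (a == nth a0 s j))%:R)).
rewrite /wt (big_nth a0) big_mkord (big_ord_widen _ (fun i => p (nth a0 s i)) sM).
rewrite [RHS]big_mkcond/=; apply: eq_bigr => j _; case: ifP => /= js.
  rewrite (bigD1 (nth a0 s j))//= eqxx mulr1 big1 ?addr0// => a /negbTE ->.
  by rewrite mulr0.
by rewrite -[RHS]p_sum1; apply: eq_bigr => a _; rewrite mulr1.
Qed.

Lemma nu_ext n (tau : {ffun 'I_n -> {ffun 'I_M -> A}}) s :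
  nu (fun i => ext (tau i)) s = #|hits (fun u => has_prefix (ext u) s) tau|.
Proof. by rewrite /nu cardsE; apply: eq_card => i; rewrite !inE. Qed.

End WordSpace.

(** * Binomial against Poisson probabilities *)

Section BinomialPoisson.
Context {R : realType}.
Implicit Types (x y : R).

Lemma onem_le_expRN x : 1 - x <= expR (- x).
Proof. by have := expR_ge1Dx (- x). Qed.

Lemma expR_le1DMexpR x : 0 <= x -> expR x <= 1 + x * expR x.
Proof.
move=> x0; have := onem_le_expRN x; rewrite expRN -(ler_pM2l (expR_gt0 x)).
by rewrite divff ?gt_eqF ?expR_gt0// mulrBr mulr1; lra.
Qed.

Lemma bernoulli_onem x n : 0 <= x <= 1 -> 1 - n%:R * x <= (1 - x) ^+ n.
Proof.
move=> /andP[x0 x1]; elim: n => [|n IH]; first by rewrite mul0r subr0 expr0.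
rewrite exprSr; have h : 0 <= 1 - x by rewrite subr_ge0.
apply: le_trans (ler_wpM2r h IH); rewrite -natr1 -subr_ge0.
have -> : (1 - n%:R * x) * (1 - x) - (1 - (n%:R + 1) * x) = n%:R * x ^+ 2 by ring.
by rewrite mulr_ge0 ?sqr_ge0.
Qed.

Lemma ffact_le_expn n k : (n ^_ k <= n ^ k)%N.
Proof.
elim: k => [|k IH]; first by rewrite ffactn0 expn0.
by rewrite ffactnSr expnSr leq_mul// leq_subr.
Qed.

Lemma expn_le_ffact n k : ((n - k) ^ k <= n ^_ k)%N.
Proof.
suff h j : (j <= k)%N -> ((n - k) ^ j <= n ^_ j)%N by exact: h.
elim: j => [|j IH] jk; first by rewrite ffactn0 expn0.
rewrite ffactnSr expnSr leq_mul ?IH ?(ltnW jk)// leq_sub2l// ltnW//.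
Qed.

Lemma bin_ffactR n k : 'C(n, k)%:R = (n ^_ k)%:R / k`!%:R :> R.
Proof.
by rewrite -bin_ffact natrM mulfK// pnatr_eq0 -lt0n fact_gt0.
Qed.

Lemma bin_leX n k : 'C(n, k)%:R <= n%:R ^+ k / k`!%:R :> R.
Proof.
by rewrite bin_ffactR ler_pM2r ?invr_gt0 ?ltr0n ?fact_gt0// -natrX ler_nat ffact_le_expn.
Qed.

Lemma onem_expn_le x n k : 0 <= x <= 1 -> (k <= n)%N ->
  (1 - x) ^+ (n - k) <= expR (- (n%:R * x)) * expR (k%:R * x).
Proof.
move=> /andP[x0 x1] kn; rewrite -expRD.
have -> : - (n%:R * x) + k%:R * x = (n - k)%N%:R * (- x) by rewrite natrB//; ring.
rewrite expRM_natl lerXn2r ?nnegrE ?expR_ge0 ?subr_ge0//.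
exact: onem_le_expRN.
Qed.

Lemma bin_term_le n k x : 0 <= x <= 1 -> (k <= n)%N ->
  'C(n, k)%:R * (x ^+ k * (1 - x) ^+ (n - k)) <=
  fE k (n%:R * x) * expR (k%:R * x).
Proof.
move=> x01 kn; have /andP[x0 x1] := x01.
rewrite /fE exprMn mulrA -[leRHS]mulrA.
have h1 := bin_leX n k; have h2 := onem_expn_le x01 kn.
apply: ler_pM => //; rewrite ?mulr_ge0 ?exprn_ge0 ?subr_ge0//.
by rewrite [leRHS]mulrAC ler_wpM2r ?exprn_ge0.
Qed.

(** Two applications of Bernoulli's inequality. The falling factorial is at least
    [n^k (1 - k/n)^k >= n^k (1 - u)], and [(1 - x)^n >= expR (- (n x)) (1 - x^2)^n >= expR (- (n x))
    (1 - v)]. When [1 - u - v <= 0] the left side is not positive. *)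
Lemma bin_term_ge n k x : 0 <= x <= 1 -> (k <= n)%N -> (0 < n)%N ->
  fE k (n%:R * x) * (1 - (k%:R ^+ 2 + (n%:R * x) ^+ 2) / n%:R) <=
  'C(n, k)%:R * (x ^+ k * (1 - x) ^+ (n - k)).
Proof.
move=> x01 kn n0; have /andP[x0 x1] := x01.
have N0 : 0 < n%:R :> R by rewrite ltr0n.
have f0 : 0 < k`!%:R :> R by rewrite ltr0n fact_gt0.
pose u : R := k%:R ^+ 2 / n%:R; pose v := n%:R * x ^+ 2.
have -> : 1 - (k%:R ^+ 2 + (n%:R * x) ^+ 2) / n%:R = 1 - u - v.
  by rewrite /u /v; field; rewrite gt_eqF.
have u0 : 0 <= u by rewrite divr_ge0 ?exprn_ge0// ltW.
have v0 : 0 <= v by rewrite mulr_ge0 ?exprn_ge0// ltW.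
have F0 : 0 <= fE k (n%:R * x) by rewrite fE_ge0// mulr_ge0// ltW.
have rhs0 : 0 <= 'C(n, k)%:R * (x ^+ k * (1 - x) ^+ (n - k)).
  by rewrite !mulr_ge0 ?exprn_ge0 ?subr_ge0.
have [uv|uv] := leP (1 - u - v) 0.
  by apply: le_trans rhs0; rewrite mulr_ge0_le0.
have hu : n%:R ^+ k * (1 - u) <= (n ^_ k)%:R.
  have h1 : 1 - u <= (1 - k%:R / n%:R) ^+ k.
    rewrite (_ : u = k%:R * (k%:R / n%:R)); last by rewrite /u expr2 mulrA.
    apply: bernoulli_onem; rewrite divr_ge0 ?(ltW N0)//= ler_pdivrMr// mul1r.
    by rewrite ler_nat.
  apply: (le_trans (ler_wpM2l (exprn_ge0 k (ltW N0)) h1)).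
  rewrite -exprMn mulrBr mulr1 mulrCA divff ?gt_eqF// mulr1 -natrB// -natrX ler_nat.
  exact: expn_le_ffact.
have hv : expR (- (n%:R * x)) * (1 - v) <= (1 - x) ^+ (n - k).
  apply: (@le_trans _ _ ((1 - x) ^+ n)); last first.
    by rewrite ler_wiXn2l ?leq_subr// ?subr_ge0// lerBlDr lerDl.
  have h1 : 1 - v <= (1 - x ^+ 2) ^+ n.
    by apply: bernoulli_onem; rewrite exprn_ge0//= expr_le1.
  rewrite -mulrN expRM_natl.
  apply: (le_trans (ler_wpM2l (exprn_ge0 n (expR_ge0 (- x))) h1)).
  have x2 : 0 <= 1 - x ^+ 2 by rewrite subr_ge0 expr_le1.
  have x3 : 0 <= 1 - x by rewrite subr_ge0.
  rewrite -exprMn lerXn2r ?nnegrE// ?mulr_ge0 ?expR_ge0//.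
  rewrite expRN mulrC ler_pdivrMr ?expR_gt0//.
  have -> : 1 - x ^+ 2 = (1 - x) * (1 + x) by ring.
  by rewrite ler_wpM2l ?subr_ge0// expR_ge1Dx.
have u1 : 0 <= 1 - u by lra.
have v1 : 0 <= 1 - v by lra.
apply: (@le_trans _ _ (fE k (n%:R * x) * ((1 - u) * (1 - v)))).
  by rewrite ler_wpM2l//; have := mulr_ge0 u0 v0; lra.
rewrite bin_ffactR /fE exprMn.
have -> : n%:R ^+ k * x ^+ k / k`!%:R * expR (- (n%:R * x)) * ((1 - u) * (1 - v)) =
   (x ^+ k / k`!%:R) * ((n%:R ^+ k * (1 - u)) * (expR (- (n%:R * x)) * (1 - v))) by ring.
have -> : (n ^_ k)%:R / k`!%:R * (x ^+ k * (1 - x) ^+ (n - k)) =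
  (x ^+ k / k`!%:R) * ((n ^_ k)%:R * (1 - x) ^+ (n - k)) by ring.
rewrite ler_wpM2l ?divr_ge0 ?exprn_ge0//; apply: ler_pM => //.
  by rewrite mulr_ge0 ?exprn_ge0.
by rewrite mulr_ge0 ?expR_ge0.
Qed.

(** The relative errors involve [x = l / n] from above and [(k^2 + l^2) / n] from below, where
    [l = n x]. The recurrence absorbs these powers of [l] into the weights [fE k.+1] and [fE k.+2],
    which are again at most [4 * bump2 l]; only the factor [1 / n] remains. *)
Lemma binomial_poisson k : (2 <= k)%N -> exists2 D : R, 0 <= D &
  forall n x, (k <= n)%N -> 0 < x <= 1 ->
  `|'C(n, k)%:R * (x ^+ k * (1 - x) ^+ (n - k)) - fE k (n%:R * x)| <=
  D / n%:R * bump2 (n%:R * x).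
Proof.
move=> k2; pose K : R := k%:R.
pose D1 := 4 * (K * expR K * k.+1%:R).
pose D2 := 4 * (K ^+ 2 + k.+1%:R * k.+2%:R).
have K0 : 0 <= K by [].
have D10 : 0 <= D1 by rewrite /D1 !mulr_ge0// expR_ge0.
have D20 : 0 <= D2 by rewrite /D2 mulr_ge0// addr_ge0// ?mulr_ge0 ?exprn_ge0.
exists (D1 + D2); first by rewrite addr_ge0.
move=> n x kn /andP[x0 x1].
have n0 : (0 < n)%N by apply: leq_trans kn; exact: ltnW.
have N0 : 0 < n%:R :> R by rewrite ltr0n.
have x01 : 0 <= x <= 1 by rewrite x1 ltW.
have l0 : 0 < n%:R * x by rewrite mulr_gt0.
have := bin_term_le x01 kn; have := bin_term_ge x01 kn n0.
set b := 'C(n, k)%:R * _; set l := n%:R * x in l0 *; move=> hlow hup.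
have /andP[f0 fb] := fE_bump k2 l0.
have /andP[_ fb1] := @fE_bump R k.+1 l (ltnW k2) l0.
have /andP[_ fb2] := @fE_bump R k.+2 l (ltnW (ltnW k2)) l0.
have e1 := mulr_fE k l; have e2 := mulr_fE k.+1 l.
have B0 := bump2_ge0 l.
have xE : x = l / n%:R by rewrite /l mulrC mulKf// gt_eqF.
rewrite ler_norml; apply/andP; split.
  apply: (@le_trans _ _ (- (D2 / n%:R * bump2 l))).
    by rewrite lerN2 ler_wpM2r// ler_pM2r ?invr_gt0// lerDr.
  rewrite lerBrDr; apply: le_trans hlow.
  rewrite mulrBr mulr1 addrC lerD2l lerN2 mulrA [leRHS]mulrAC ler_pM2r ?invr_gt0//.
  have -> : fE k l * (k%:R ^+ 2 + l ^+ 2) =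
     K ^+ 2 * fE k l + k.+1%:R * k.+2%:R * fE k.+2 l.
    have -> : k.+1%:R * k.+2%:R * fE k.+2 l = l ^+ 2 * fE k l.
      by rewrite -mulrA -e2 mulrCA -e1 expr2 mulrA.
    by rewrite -/K; ring.
  have h1 : K ^+ 2 * fE k l <= K ^+ 2 * (4 * bump2 l) by rewrite ler_wpM2l ?exprn_ge0.
  have h2 : k.+1%:R * k.+2%:R * fE k.+2 l <= k.+1%:R * k.+2%:R * (4 * bump2 l).
    by rewrite ler_wpM2l ?mulr_ge0.
  by apply: (le_trans (lerD h1 h2)); rewrite /D2 -mulrDl mulrA [4 * _]mulrC.
apply: (@le_trans _ _ (D1 / n%:R * bump2 l)); last first.
  by rewrite ler_wpM2r// ler_pM2r ?invr_gt0// lerDl.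
rewrite lerBlDr; apply: (le_trans hup).
have kx : K * x <= K by rewrite ler_piMr.
have kx0 : 0 <= K * x by rewrite mulr_ge0// ltW.
have he : expR (K * x) <= 1 + K * x * expR K.
  apply: (le_trans (expR_le1DMexpR kx0)); rewrite lerD2l ler_wpM2l//.
  by rewrite ler_expR.
apply: (le_trans (ler_wpM2l f0 he)); rewrite mulrDr mulr1 addrC lerD2r.
have -> : fE k l * (K * x * expR K) = K * expR K / n%:R * (l * fE k l).
  by rewrite [in LHS]xE; ring.
rewrite e1 /D1.
have -> : 4 * (K * expR K * k.+1%:R) / n%:R * bump2 l =
  K * expR K / n%:R * (k.+1%:R * (4 * bump2 l)) by ring.
by rewrite ler_wpM2l ?divr_ge0 ?mulr_ge0 ?expR_ge0 ?(ltW N0)// ler_wpM2l.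
Qed.

(** One-sided, as it serves to bound a second moment from above. The constant comes from
    [expR (K z) <= 1 + K * expR K * z] with [K = 2k] and [z = x + y <= 1]. *)
Lemma binomial_poisson_pair k : exists2 D : R, 0 <= D &
  forall n x y, (k + k <= n)%N -> 0 <= x -> 0 <= y -> x + y <= 1 ->
  ('C(n, k) ^ 2)%:R * (x ^+ k * y ^+ k * (1 - x - y) ^+ (n - k - k)) <=
  fE k (n%:R * x) * fE k (n%:R * y) * (1 + D * (x + y)).
Proof.
pose K : R := (k + k)%:R; exists (K * expR K); first by rewrite mulr_ge0 ?expR_ge0.
move=> n x y kn x0 y0 xy.
have z01 : 0 <= x + y <= 1 by rewrite xy addr_ge0.
have := onem_expn_le z01 kn; rewrite subnDA opprD addrA => hz.
have he : expR (K * (x + y)) <= 1 + K * expR K * (x + y).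
  have k0 : 0 <= K * (x + y) by rewrite mulr_ge0// addr_ge0.
  apply: (le_trans (expR_le1DMexpR k0)); rewrite lerD2l mulrAC ler_wpM2r ?addr_ge0//.
  by rewrite ler_wpM2l// ler_expR ler_piMr.
apply: (@le_trans _ _ (fE k (n%:R * x) * fE k (n%:R * y) * expR (K * (x + y)))); last first.
  by rewrite ler_wpM2l// mulr_ge0 ?fE_ge0 ?mulr_ge0.
have -> : fE k (n%:R * x) * fE k (n%:R * y) * expR (K * (x + y)) =
   (n%:R ^+ k / k`!%:R) ^+ 2 * (x ^+ k * y ^+ k *
    (expR (- (n%:R * (x + y))) * expR (K * (x + y)))).
  by rewrite /fE [n%:R * (x + y)]mulrDr opprD expRD !exprMn; ring.
rewrite natrX; apply: ler_pM; rewrite ?mulr_ge0 ?exprn_ge0//.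
- by rewrite -addrA -opprD subr_ge0.
- by rewrite lerXn2r ?nnegrE ?divr_ge0 ?exprn_ge0// bin_leX.
- by rewrite ler_wpM2l// mulr_ge0 ?exprn_ge0.
Qed.

End BinomialPoisson.

(** * Second moments of the profiles *)

Section Concentration.
Context {R : realType} {A : finType}.
Variable p : A -> R.
Hypothesis hA : (2 <= #|A|)%N.
Hypothesis p_gt0 : forall a, 0 < p a.
Hypothesis p_sum1 : \sum_a p a = 1.
Variable (a0 : A).

Definition nuw n M (tau : {ffun 'I_n -> {ffun 'I_M -> A}}) (s : seq A) : nat :=
  nu (fun i => ext a0 (tau i)) s.

Definition tweight n M (tau : {ffun 'I_n -> {ffun 'I_M -> A}}) : R :=
  pweight (@wordweight R A p M) tau.

Definition profile n M k (tau : {ffun 'I_n -> {ffun 'I_M -> A}}) : R :=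
  \sum_(s <- words M) (nuw tau s == k)%:R.

Lemma tweight_ge0 n M tau : 0 <= @tweight n M tau.
Proof. by apply: pweight_ge0 => u; exact: wordweight_ge0. Qed.

Lemma tweight_sum1 n M : \sum_tau @tweight n M tau = 1.
Proof. by apply: pweight_sum1; exact: wordweight_sum1. Qed.

Lemma wt_le1 s : wt p s <= 1.
Proof.
elim: s => [|a s IH]; rewrite ?wt_nil ?wt_cons//.
by rewrite mulr_ile1 ?(ltW (p_gt0 a)) ?(ltW (wt_gt0 p_gt0 s))// p_le1.
Qed.

Lemma prob_nuw n M k s : (s \in words M) ->
  \sum_tau @tweight n M tau * (nuw tau s == k)%:R =
  'C(n, k)%:R * (wt p s ^+ k * (1 - wt p s) ^+ (n - k)).
Proof.
rewrite mem_words => /ltnW sM; rewrite -(mass_has_prefix p_sum1 a0 sM).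
rewrite -prob_count; last exact: wordweight_sum1.
by apply: eq_bigr => tau _; rewrite /nuw nu_ext.
Qed.

Lemma sum_bump2_linear : exists2 C : R, 0 <= C & forall M (y : R), 0 < y ->
  \sum_(s <- words M) bump2 (y * wt p s) <= C * y.
Proof.
have [c /andP[c0 _] hc] := p_gap p_gt0 p_sum1 hA.
exists c^-1; first by rewrite invr_ge0 ltW.
move=> M y y0; apply: (le_trans (sum_words_bump2 p_gt0 p_sum1 M c0 hc y0)).
rewrite ler_wpM2l ?invr_ge0 ?(ltW c0)// ler_pdivrMr; last by lra.
by rewrite expr2 ler_pM2l//; lra.
Qed.

(** For each word the probability is at most 1 and at most the square of [n * wt p s / K], hence at
    most [4 * bump2] of that quantity; the sum over words is then linear in [n / K]. *)
Lemma prob_nuw_gt : exists2 C : R, 0 <= C & forall n M K, (0 < n)%N -> (0 < K)%N ->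
  \sum_tau @tweight n M tau * \sum_(s <- words M) (K < nuw tau s)%N%:R <=
  C * (n%:R / K%:R).
Proof.
have [C C0 hC] := sum_bump2_linear.
exists (4 * C); first by rewrite mulr_ge0.
move=> n M K n0 K0; under eq_bigr do rewrite mulr_sumr.
have y0 : 0 < n%:R / K%:R :> R by rewrite divr_gt0 ?ltr0n.
rewrite exchange_big/= -mulrA; apply: le_trans (ler_wpM2l _ (hC M _ y0)) => //.
rewrite mulr_sumr big_seq [leRHS]big_seq; apply: ler_sum => s sM.
have w0 := wt_gt0 p_gt0 s.
apply: min_le_bump2; first by rewrite mulr_ge0// ltW.
  rewrite -[leRHS](tweight_sum1 n M); apply: ler_sum => tau _.
  by rewrite ler_piMr ?tweight_ge0// lern1 leq_b1.
move: sM; rewrite mem_words => /ltnW sM.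
have := @prob_hits_gt R _ _ (@wordweight_ge0 _ _ _ p_gt0 M) (wordweight_sum1 p_sum1 M) n
  (fun u => has_prefix (ext a0 u) s) K K0.
rewrite (mass_has_prefix p_sum1 a0 sM) mulrAC; apply: le_trans.
by apply: ler_sum => tau _; rewrite /nuw nu_ext.
Qed.

(* Two incomparable words are prefixes of disjoint sets of strings, and the joint
   law is then nearly a product. A word has at most [M] prefixes, so that
   comparable pairs contribute only [M] times the mean. *)
Lemma profile_concentration k : (2 <= k)%N -> exists2 D : R, 0 <= D &
  forall n M, (k + k <= n)%N ->
  \sum_tau @tweight n M tau *
    (profile k tau - \sum_(s <- words M) fE k (n%:R * wt p s)) ^+ 2 <=
  D * (1 + M%:R) * n%:R.
Proof.
move=> k2; have [C C0 hC] := sum_bump2_linear.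
have [D1 D10 hD1] := @binomial_poisson R k k2.
have [D2 D20 hD2] := @binomial_poisson_pair R k.
pose D3 := 2 * D2 * (4 * C) * (4 * k.+1%:R * C).
have D30 : 0 <= D3 by rewrite /D3 !mulr_ge0.
exists (2 * (4 * C) * (D1 * C) + 2 * (4 * C + D1 * C) + D3).
  by rewrite !addr_ge0// !mulr_ge0// ?addr_ge0// ?mulr_ge0.
move=> n M kn; have n0 : (0 < n)%N by apply: leq_trans kn; rewrite addn_gt0 (ltnW k2).
have N1 : 1 <= n%:R :> R by rewrite ler1n.
have N0 : 0 < n%:R :> R by rewrite ltr0n.
have dm (u v : R) : u / n%:R * (v * n%:R) = u * v by field; rewrite gt_eqF.
have kn' : (k <= n)%N by apply: leq_trans kn; exact: leq_addl.
pose f s := fE k (n%:R * wt p s).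
pose b s := 'C(n, k)%:R * (wt p s ^+ k * (1 - wt p s) ^+ (n - k)).
pose c := \sum_(s <- words M) f s.
pose e := \sum_(s <- words M) b s.
have w0 s := wt_gt0 p_gt0 s.
have l0 s : 0 < n%:R * wt p s by rewrite mulr_gt0.
have f0 s : 0 <= f s by rewrite fE_ge0// ltW.
have b0 s : 0 <= b s.
  by rewrite /b !mulr_ge0 ?exprn_ge0 ?(ltW (w0 s))// subr_ge0 wt_le1.
have c0 : 0 <= c by apply: sumr_ge0.
have cn : c <= 4 * C * n%:R.
  rewrite -mulrA; apply: le_trans (ler_wpM2l _ (hC M _ N0)) => //.
  by rewrite mulr_sumr; apply: ler_sum => s _; have /andP[] := fE_bump k2 (l0 s).
have ec : `|e - c| <= D1 * C.
  rewrite /e /c -sumrB; apply: (le_trans (ler_norm_sum _ _ _)).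
  apply: (@le_trans _ _ (\sum_(s <- words M) D1 / n%:R * bump2 (n%:R * wt p s))).
    by apply: ler_sum => s _; apply: hD1 => //; rewrite w0 wt_le1.
  rewrite -mulr_sumr.
  apply: (@le_trans _ _ (D1 / n%:R * (C * n%:R))).
    by rewrite ler_wpM2l ?hC// divr_ge0// ltW.
  by rewrite dm.
have en : e <= (4 * C + D1 * C) * n%:R.
  have := le_trans (ler_norm _) ec; rewrite lerBlDr mulrDl => /le_trans; apply.
  by rewrite addrC lerD// ler_peMr// mulr_ge0.
(* Bounded independently of [n]: the recurrence gives [f s * wt p s = k.+1 / n * fE k.+1], and the
   weights of order [k.+1] add up to order [n]. *)
have fw : \sum_(s <- words M) f s * wt p s <= 4 * k.+1%:R * C.
  apply: (@le_trans _ _ (4 * k.+1%:R / n%:R * (C * n%:R))); last first.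
    by rewrite dm.
  apply: le_trans (ler_wpM2l _ (hC M _ N0)); last by rewrite divr_ge0 ?mulr_ge0// ltW.
  rewrite mulr_sumr; apply: ler_sum => s _.
  have -> : f s * wt p s = k.+1%:R / n%:R * fE k.+1 (n%:R * wt p s).
    by rewrite [RHS]mulrAC -mulr_fE /f; move: (fE k _) => g; field; rewrite gt_eqF.
  have -> : 4 * k.+1%:R / n%:R * bump2 (n%:R * wt p s) =
    k.+1%:R / n%:R * (4 * bump2 (n%:R * wt p s)) by ring.
  rewrite ler_wpM2l ?divr_ge0 ?(ltW N0)//.
  by have /andP[] := @fE_bump R k.+1 _ (ltnW k2) (l0 s).
have ES : \sum_tau @tweight n M tau * profile k tau = e.
  under eq_bigr do rewrite mulr_sumr.
  rewrite exchange_big/= /e big_seq [RHS]big_seq; apply: eq_bigr => s sM.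
  exact: prob_nuw.
pose Q s t := \sum_tau @tweight n M tau * ((nuw tau s == k) && (nuw tau t == k))%:R.
have Ql s t : s \in words M -> Q s t <= b s.
  move=> sM; rewrite /b -(prob_nuw n k sM); apply: ler_sum => tau _.
  by rewrite ler_wpM2l ?tweight_ge0// ler_nat; case: (_ == k); case: (_ == k).
have Qs s t : Q s t = Q t s by apply: eq_bigr => tau _; rewrite andbC.
(* The two prefix indicators charge a comparable pair to its longer word; the last bracket is the
   near-product bound for incomparable pairs. All terms are nonnegative, so that the sum covers
   every case. *)
have Qb s t : s \in words M -> t \in words M ->
  Q s t <= (prefix t s)%:R * b s + (prefix s t)%:R * b t +
    (f s * f t + D2 * (f s * wt p s * f t + f s * (f t * wt p t))).
  move=> sM tM; have fft : 0 <= f s * f t + D2 * (f s * wt p s * f t + f s * (f t * wt p t)).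
    apply: addr_ge0; first exact: mulr_ge0.
    apply: mulr_ge0 => //; apply: addr_ge0.
      exact: (mulr_ge0 (mulr_ge0 (f0 s) (ltW (w0 s))) (f0 t)).
    exact: (mulr_ge0 (f0 s) (mulr_ge0 (f0 t) (ltW (w0 t)))).
  case: (boolP (prefix t s)) => [ts|nts].
    rewrite mul1r -addrA (le_trans (Ql _ _ sM))// lerDl addr_ge0//.
    by rewrite mulr_ge0.
  case: (boolP (prefix s t)) => [st|nst].
    by rewrite mul0r add0r mul1r Qs (le_trans (Ql _ _ tM))// lerDl.
  rewrite !mul0r !add0r.
  have dis (u : {ffun 'I_M -> A}) :
      ~~ (has_prefix (ext a0 u) s && has_prefix (ext a0 u) t).
    apply/negP => /andP[hs ht]; have := has_prefix_total hs ht.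
    by rewrite (negbTE nst) (negbTE nts).
  have hQ := @prob_count2 R _ _ (@wordweight_ge0 _ _ _ p_gt0 M)
    (wordweight_sum1 p_sum1 M) n _ _ k dis.
  have sM' : (size s <= M)%N by move: sM; rewrite mem_words => /ltnW.
  have tM' : (size t <= M)%N by move: tM; rewrite mem_words => /ltnW.
  have hm : wt p s + wt p t <= 1.
    rewrite -(mass_has_prefix p_sum1 a0 sM') -(mass_has_prefix p_sum1 a0 tM').
    rewrite -[leRHS](wordweight_sum1 p_sum1 M) -!mass_indic -big_split/=.
    apply: ler_sum => u _; rewrite -mulrDr ler_piMr ?wordweight_ge0// -natrD lern1.
    by have := dis u; case: has_prefix; case: has_prefix.
  rewrite !(mass_has_prefix p_sum1 a0) in hQ => //.
  have -> : f s * f t + D2 * (f s * wt p s * f t + f s * (f t * wt p t)) =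
    f s * f t * (1 + D2 * (wt p s + wt p t)) by ring.
  apply: le_trans (hD2 n _ _ kn (ltW (w0 s)) (ltW (w0 t)) hm).
  apply: le_trans hQ; apply: ler_sum => tau _.
  by rewrite /nuw !nu_ext.
have ES2 : \sum_tau @tweight n M tau * profile k tau ^+ 2 <=
    2 * M%:R * e + c ^+ 2 + D3 * n%:R.
  have -> : \sum_tau @tweight n M tau * profile k tau ^+ 2 =
      \sum_(s <- words M) \sum_(t <- words M) Q s t.
    rewrite /Q; under [RHS]eq_bigr do rewrite exchange_big/=.
    rewrite [RHS]exchange_big/=; apply: eq_bigr => tau _.
    rewrite expr2 /profile big_distrlr/= mulr_sumr; apply: eq_bigr => s _.
    rewrite mulr_sumr; apply: eq_bigr => t _.
    by rewrite -natrM mulnb.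
  have pc : \sum_(s <- words M) \sum_(t <- words M) (prefix t s)%:R * b s <= M%:R * e.
    rewrite mulr_sumr big_seq [leRHS]big_seq; apply: ler_sum => s sM.
    rewrite -mulr_suml ler_wpM2r// -natr_sum ler_nat.
    have -> : (\sum_(t <- words M) (prefix t s : nat) =
        count (fun t => prefix t s) (words M))%N.
      by rewrite -sum1_count [RHS]big_mkcond; apply: eq_bigr => t _; case: prefix.
    by apply: count_prefixes; rewrite -mem_words.
  apply: (@le_trans _ _ (\sum_(s <- words M) \sum_(t <- words M)
    ((prefix t s)%:R * b s + (prefix s t)%:R * b t +
    (f s * f t + D2 * (f s * wt p s * f t + f s * (f t * wt p t)))))).
    rewrite big_seq [leRHS]big_seq; apply: ler_sum => s sM.
    by rewrite big_seq [leRHS]big_seq; apply: ler_sum => t tM; exact: Qb.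
  have -> : \sum_(s <- words M) \sum_(t <- words M)
      ((prefix t s)%:R * b s + (prefix s t)%:R * b t +
      (f s * f t + D2 * (f s * wt p s * f t + f s * (f t * wt p t)))) =
    \sum_(s <- words M) \sum_(t <- words M) (prefix t s)%:R * b s +
    \sum_(s <- words M) \sum_(t <- words M) (prefix s t)%:R * b t +
    \sum_(s <- words M) \sum_(t <- words M)
      (f s * f t + D2 * (f s * wt p s * f t + f s * (f t * wt p t))).
    by rewrite -!big_split; apply: eq_bigr => s _; rewrite -!big_split.
  have -> : \sum_(s <- words M) \sum_(t <- words M)
      (f s * f t + D2 * (f s * wt p s * f t + f s * (f t * wt p t))) =
    c ^+ 2 + 2 * D2 * c * \sum_(s <- words M) f s * wt p s.
    set g := \sum_(s <- words M) f s * wt p s.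
    transitivity (\sum_(s <- words M) (f s * c + D2 * (f s * wt p s * c + f s * g))).
      by apply: eq_bigr => s _; rewrite big_split/= -!mulr_sumr big_split/= -!mulr_sumr.
    rewrite big_split/= -mulr_suml -mulr_sumr big_split/= -!mulr_suml -/c -/g.
    by ring.
  have pc' : \sum_(s <- words M) \sum_(t <- words M) (prefix s t)%:R * b t <= M%:R * e.
    by rewrite exchange_big.
  have h3 : 2 * D2 * c * \sum_(s <- words M) f s * wt p s <= D3 * n%:R.
    have -> : D3 * n%:R = 2 * D2 * (4 * C * n%:R) * (4 * k.+1%:R * C) by rewrite /D3; ring.
    apply: ler_pM => //; first by rewrite !mulr_ge0.
      by apply: sumr_ge0 => s _; exact: mulr_ge0 (f0 s) (ltW (w0 s)).
    by rewrite ler_wpM2l// mulr_ge0.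
  rewrite (_ : 2 * M%:R * e = M%:R * e + M%:R * e); last by ring.
  rewrite -[leRHS]addrA; exact: lerD (lerD pc pc') (lerD (lexx _) h3).
have expand (q : R) : \sum_tau @tweight n M tau * (profile k tau - q) ^+ 2 =
    \sum_tau @tweight n M tau * profile k tau ^+ 2 - 2 * q * e + q ^+ 2.
  transitivity (\sum_tau @tweight n M tau * profile k tau ^+ 2 -
     2 * q * (\sum_tau @tweight n M tau * profile k tau) +
     q ^+ 2 * \sum_tau @tweight n M tau); last by rewrite ES tweight_sum1 mulr1.
  rewrite !mulr_sumr -sumrB -big_split/=; apply: eq_bigr => tau _.
  by move: (tweight tau) (profile k tau) => w z; ring.
rewrite expand.
apply: (@le_trans _ _ (2 * M%:R * e + c ^+ 2 + D3 * n%:R - 2 * c * e + c ^+ 2)).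
  by rewrite !lerD2r.
(* The terms of order [n^2] combine into [2 c (c - e)], where [c] is of order [n] and [c - e] is
   bounded. *)
have -> : 2 * M%:R * e + c ^+ 2 + D3 * n%:R - 2 * c * e + c ^+ 2 =
  2 * M%:R * e + D3 * n%:R + 2 * c * (c - e) by ring.
have hce : c - e <= D1 * C.
  by rewrite (le_trans (ler_norm _))// distrC.
have h1 : 2 * c * (c - e) <= 2 * (4 * C * n%:R) * (D1 * C).
  apply: (@le_trans _ _ (2 * c * (D1 * C))); first by rewrite ler_wpM2l// mulr_ge0.
  by rewrite ler_wpM2r ?mulr_ge0// ler_wpM2l.
have h2 : 2 * M%:R * e <= 2 * M%:R * ((4 * C + D1 * C) * n%:R).
  by rewrite ler_wpM2l// mulr_ge0.
apply: (le_trans (lerD (lerD h2 (lexx _)) h1)).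
set X := 2 * (4 * C) * (D1 * C); set Y := 2 * (4 * C + D1 * C).
have X0 : 0 <= X by rewrite !mulr_ge0.
have Y0 : 0 <= Y by rewrite mulr_ge0// addr_ge0// mulr_ge0.
have m0 : 0 <= M%:R * n%:R :> R by rewrite mulr_ge0.
have -> : 2 * M%:R * ((4 * C + D1 * C) * n%:R) + D3 * n%:R +
    2 * (4 * C * n%:R) * (D1 * C) = Y * (M%:R * n%:R) + (D3 + X) * n%:R.
  by rewrite /X /Y; ring.
have -> : (X + Y + D3) * (1 + M%:R) * n%:R = Y * (M%:R * n%:R) + (D3 + X) * n%:R +
  (Y * n%:R + (X + D3) * (M%:R * n%:R)) by ring.
rewrite lerDl; apply: addr_ge0; first by apply: mulr_ge0 => //; exact: ltW.
by apply: mulr_ge0 => //; apply: addr_ge0.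
Qed.

End Concentration.

(** * Counting nodes of a trie *)

Local Open Scope classical_set_scope.
Local Open Scope nat_scope.

Section TrieCounts.
Context {A : finType}.

Lemma card_fset_set_seq (T : choiceType) (S : set T) (l : seq T) :
  uniq l -> (forall a, S a <-> a \in l) -> #|` fset_set S| = size l.
Proof.
move=> ul hl; have -> : S = [set` [fset a in l]%fset].
  by apply/seteqP; split=> a /=; rewrite !inE => /hl.
by rewrite set_fsetK card_fseq undup_id.
Qed.

Variables (n M : nat) (x : 'I_n -> infstr A).
Hypothesis sep : forall s, M <= size s -> nu x s <= 1.
Implicit Types (s t v : seq A) (i j : 'I_n).

Lemma nu_prefix s t : prefix s t -> nu x t <= nu x s.
Proof.
move=> st; apply/subset_leq_card/fintype.subsetP => i.
by rewrite !inE; exact: has_prefix_prefix.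
Qed.

Lemma has_prefix_mkseq (y : infstr A) m : has_prefix y (mkseq y m).
Proof. by rewrite /has_prefix size_mkseq. Qed.

Lemma nu_mkseq_gt0 i m : 0 < nu x (mkseq (x i) m).
Proof. by apply/card_gt0P; exists i; rewrite inE has_prefix_mkseq. Qed.

Lemma prefix_mkseq (y : infstr A) m k : m <= k -> prefix (mkseq y m) (mkseq y k).
Proof.
move=> mk; rewrite prefixE size_mkseq /mkseq -map_take take_iota.
by rewrite (minn_idPl mk).
Qed.

Let exleaf i : exists m, nu x (mkseq (x i) m) <= 1.
Proof. by exists M; apply: sep; rewrite size_mkseq. Qed.

(** The leaf that stores string [i]: its shortest prefix that no other string shares. *)
Definition leafword i : seq A := mkseq (x i) (ex_minn (exleaf i)).

Definition is_leaf s := nu x s = 1 /\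
  (s = [::] \/ exists b c, s = rcons b c /\ 2 <= nu x b).

Lemma nu_leafword i : nu x (leafword i) = 1.
Proof.
rewrite /leafword; case: ex_minnP => m hm _; apply/eqP.
by rewrite eqn_leq hm nu_mkseq_gt0.
Qed.

Lemma has_prefix_leafword i : has_prefix (x i) (leafword i).
Proof. exact: has_prefix_mkseq. Qed.

Lemma nu_eq1_inj s i j : nu x s = 1 -> has_prefix (x i) s -> has_prefix (x j) s -> i = j.
Proof.
move=> s1 hi hj; apply/eqP/negPn/negP => ij.
suff : 1 < nu x s by rewrite s1.
by apply/card_gt1P; exists i, j; split; rewrite ?inE.
Qed.

Lemma leafword_inj : injective leafword.
Proof.
move=> i j e; apply: (nu_eq1_inj (nu_leafword i)) (has_prefix_leafword i) _.
by rewrite e has_prefix_leafword.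
Qed.

Lemma is_leaf_leafword i : is_leaf (leafword i).
Proof.
split; first exact: nu_leafword.
rewrite /leafword; case: ex_minnP => -[|m] hm hmin; [by left|right].
exists (mkseq (x i) m), (x i m); split; first by rewrite mkseqS.
by rewrite ltnNge; apply/negP => /hmin; rewrite ltnn.
Qed.

(** The parent of a leaf is still shared by two strings, so no prefix of [x i] shorter than [s]
    isolates it. *)
Lemma is_leafE s i : is_leaf s -> has_prefix (x i) s -> s = leafword i.
Proof.
move=> [s1 hs] /eqP si; rewrite /leafword -{1}si; congr mkseq.
case: ex_minnP => m hm hmin; apply/eqP; rewrite eqn_leq andbC.
rewrite hmin ?si ?s1//= leqNgt; apply/negP => ms.
case: hs => [s0|[b [c [sE b2]]]]; first by rewrite s0 in ms.
suff : 2 <= nu x (mkseq (x i) m) by rewrite ltnNge hm.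
apply: leq_trans b2 (nu_prefix _).
have bi : has_prefix (x i) b.
  apply: (@has_prefix_prefix _ _ _ s); first by rewrite sE prefix_rcons.
  by apply/eqP.
rewrite -(eqP bi); apply: prefix_mkseq.
by move: ms; rewrite sE size_rcons ltnS.
Qed.

Lemma is_leaf_exists s : is_leaf s -> exists i, s = leafword i.
Proof.
move=> hs; have /card_gt0P[i] : 0 < nu x s by rewrite hs.1.
by rewrite inE => hi; exists i; exact: is_leafE.
Qed.

(** An internal node has a child in the trie, namely the extension by the next letter of any string
    through it. A node with a single string has none, since a child would need a shared parent. *)
Lemma trie_leafP s :
  (trie x s /\ forall c, ~ trie x (rcons s c)) <-> is_leaf s.
Proof.
split=> [[[s2|//] hc]|hs].
  have /card_gt0P[i] : 0 < nu x s by exact: leq_trans s2.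
  rewrite inE => hi; case: (hc (x i (size s))).
  have h1 : 0 < nu x (rcons s (x i (size s))).
    by rewrite -[in X in rcons X _](eqP hi) -mkseqS nu_mkseq_gt0.
  have [h2|h2] := leqP 2 (nu x (rcons s (x i (size s)))); first by left.
  right; split; first by apply/eqP; rewrite eqn_leq h1 -ltnS h2.
  by right; exists s, (x i (size s)).
split; first by right.
have s1 := hs.1 => c [c2|[_ [/(congr1 size)|[b [d [/rcons_inj[<- _]]]]]]].
- by have := leq_trans c2 (nu_prefix (prefix_rcons s c)); rewrite s1.
- by rewrite size_rcons.
- by rewrite s1.
Qed.

Lemma trie_prefix_leafword v i : trie x v -> has_prefix (x i) v ->
  prefix v (leafword i).
Proof.
move=> [v2|hv] hi; last by rewrite -(is_leafE hv hi) prefix_refl.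
have /orP[//|h] := has_prefix_total hi (has_prefix_leafword i).
by have := leq_trans v2 (nu_prefix h); rewrite nu_leafword.
Qed.

(** The leaves below a node [v] are the leaf words of the strings that pass through [v], with the
    prefix [v] dropped; distinct strings have distinct leaf words. *)
Lemma nleaves_fringe v : trie x v -> nleaves (fringe (trie x) v) = nu x v.
Proof.
move=> hv; rewrite /nleaves.
pose l := [seq drop (size v) (leafword i) | i <- enum 'I_n & has_prefix (x i) v].
have lE i : has_prefix (x i) v -> v ++ drop (size v) (leafword i) = leafword i.
  by move=> /(trie_prefix_leafword hv)/prefixP[u ->]; rewrite drop_size_cat.
rewrite (@card_fset_set_seq _ _ l).
- rewrite size_map size_filter -sum1_count big_enum_cond /nu -sum1_card.
  by apply: eq_bigl => i; rewrite inE.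
- rewrite map_inj_in_uniq; first by rewrite filter_uniq ?enum_uniq.
  move=> i j.
  rewrite !mem_filter => /andP[hi _] /andP[hj _] e.
  by apply: leafword_inj; rewrite -(lE i hi) -(lE j hj) e.
move=> b; have -> : leaves (fringe (trie x) v) b = is_leaf (v ++ b).
  rewrite -(propext (trie_leafP _)); apply/propext; split=> -[h1 h2]; split=> // c.
    by rewrite rcons_cat; exact: h2.
  by rewrite /fringe /= -rcons_cat; exact: h2.
split=> [hb|/mapP[i]].
  have [i bi] := is_leaf_exists hb; have hi : has_prefix (x i) v.
    apply: (@has_prefix_prefix _ _ _ (v ++ b)); first exact: prefix_prefix.
    by rewrite bi has_prefix_leafword.
  apply/mapP; exists i; first by rewrite mem_filter hi mem_enum.
  by rewrite -bi drop_size_cat.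
rewrite mem_filter => /andP[hi _] ->; rewrite lE//; exact: is_leaf_leafword.
Qed.

Lemma internal_size s : 2 <= nu x s -> size s < M.
Proof. by rewrite !ltnNge; apply: contra; exact: sep. Qed.

Let leafwords := [seq leafword i | i <- enum 'I_n].

Let mem_leafwords s : is_leaf s <-> s \in leafwords.
Proof.
split=> [/is_leaf_exists[i ->]|/mapP[i _ ->]]; last exact: is_leaf_leafword.
by apply/mapP; exists i; rewrite ?mem_enum.
Qed.

Let leafwords_uniq : uniq leafwords.
Proof. by rewrite map_inj_uniq ?enum_uniq//; exact: leafword_inj. Qed.

Lemma nnodes_trie :
  nnodes (trie x) = n + count (fun s => 2 <= nu x s) (words M).
Proof.
rewrite /nnodes (@card_fset_set_seq _ _
  (leafwords ++ [seq s <- words M | 2 <= nu x s])).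
- by rewrite size_cat size_map size_enum_ord size_filter.
- rewrite cat_uniq leafwords_uniq filter_uniq ?words_uniq// andbT.
  apply/hasPn => s; rewrite mem_filter => /andP[s2 _]; apply/negP.
  by move=> /mem_leafwords[s1 _]; rewrite s1 in s2.
move=> s; rewrite mem_cat mem_filter mem_words; split.
  move=> [s2|hs]; first by rewrite s2 internal_size// orbT.
  by apply/orP; left; apply/mem_leafwords.
by move=> /orP[/mem_leafwords|/andP[s2 _]]; [right|left].
Qed.

Lemma Phi_trie k : 2 <= k ->
  Phi k (trie x) = count (fun s => nu x s == k) (words M).
Proof.
move=> k2; rewrite /Phi (@card_fset_set_seq _ _ [seq s <- words M | nu x s == k]).
- by rewrite size_filter.
- by rewrite filter_uniq ?words_uniq.
move=> s; rewrite mem_filter mem_words; split=> [[hs]|/andP[/eqP sk sM]].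
  rewrite nleaves_fringe// => sk; rewrite sk eqxx internal_size//.
  by rewrite sk.
have hs : trie x s by left; rewrite sk.
by split=> //; rewrite nleaves_fringe.
Qed.

(** The case [k = 1] stands apart because a word that is a prefix of exactly one string need not be
    a node: in the trie only the leaf words remain, one for each string. *)
Lemma Phi1_trie : Phi 1 (trie x) = n.
Proof.
rewrite /Phi (@card_fset_set_seq _ _ leafwords) //.
  by rewrite size_map size_enum_ord.
move=> s; split=> [[hs]|/mem_leafwords hs].
  rewrite nleaves_fringe// => s1; apply/mem_leafwords.
  by case: hs => // s2; rewrite s1 in s2.
have ts : trie x s by right.
by split=> //; rewrite nleaves_fringe// hs.1.
Qed.

Lemma trie_size s : trie x s -> size s <= M.
Proof.
move=> [/internal_size/ltnW//|[_ [->//|[b [c [-> b2]]]]]].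
by rewrite size_rcons internal_size.
Qed.

Lemma trie_finite : finite_set (trie x).
Proof.
apply: sub_finite_set (finite_seq (words M.+1)) => s /trie_size h.
by rewrite /mkset mem_words ltnS.
Qed.

End TrieCounts.

(** * Random tries *)

Local Open Scope ring_scope.

(** Stated for an arbitrary sigma-algebra because it is applied both to the measurable sets and to
    the sigma-algebra generated by one string. *)
Lemma sigma_algebra_bigcap_lt (T : Type) (S : set (set T)) (F : nat -> set T) M :
  sigma_algebra setT S -> (forall j, (j < M)%N -> S (F j)) ->
  S (\bigcap_(j in [set j | (j < M)%N]) F j).
Proof.
move=> [S0 SC SU] SF; rewrite -[X in S X]setCK setC_bigcap -setTD; apply: (SC).
have -> : \bigcup_(j in [set j | (j < M)%N]) ~` F j =
    \bigcup_j (if (j < M)%N then ~` F j else set0).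
  apply/seteqP; split=> [w [j /= jM Fj]|w [j _]]; first by exists j => //; rewrite jM.
  by case: ifP => // jM Fj; exists j.
apply: SU => j; case: ifP => // jM.
by rewrite -setTD; apply: SC; exact: SF.
Qed.

Lemma bigcap_fset_iota (T : Type) (F : nat -> set T) M :
  \bigcap_(i in [set` [fset j in iota 0 M]%fset]) F i =
  \bigcap_(i in [set j | (j < M)%N]) F i.
Proof.
by congr bigcap; apply/seteqP; split=> j /=; rewrite !inE mem_iota /= add0n.
Qed.

Lemma prod_fset_iota (R : realType) (F : nat -> \bar R) M :
  (\prod_(i <- [fset j in iota 0 M]%fset) F i = \prod_(i < M) F i)%E.
Proof.
rewrite -(big_mkord xpredT F) /index_iota subn0; apply: perm_big.
apply: uniq_perm; rewrite ?fset_uniq ?iota_uniq// => j.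
by rewrite inE.
Qed.

Lemma prod_EFin (R : realType) (I : Type) (r : seq I) (F : I -> R) :
  (\prod_(i <- r) (F i)%:E = (\prod_(i <- r) F i)%:E)%E.
Proof. by elim: r => [|i r IH]; rewrite ?big_nil// !big_cons IH EFinM. Qed.

Lemma measure_fibers (R : realType) (disp : measure_display)
    (Omega : measurableType disp) (P : probability Omega R) (T : eqType)
    (f : Omega -> T) (F : set Omega) (s : seq T) :
  measurable F -> (forall v, measurable [set w | f w = v]) -> uniq s ->
  measurable ([set w | f w \in s] `&` F) /\
  P ([set w | f w \in s] `&` F) =
    (\sum_(v <- s) P ([set w | f w = v] `&` F))%E.
Proof.
move=> mF mf; elim: s => [_|v s IH /= /andP[ns /IH[ms ps]]].
  rewrite (_ : _ `&` F = set0) ?big_nil ?measure0//.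
  by apply/seteqP; split=> // w [].
have -> : [set w | f w \in v :: s] `&` F =
    ([set w | f w = v] `&` F) `|` ([set w | f w \in s] `&` F).
  rewrite -setIUl; congr (_ `&` _); apply/seteqP; split=> w /=; rewrite inE.
    by move=> /orP[/eqP|]; [left|right].
  by move=> [->|->]; rewrite ?eqxx ?orbT.
have mv : measurable ([set w | f w = v] `&` F) by exact: measurableI.
split; first exact: measurableU.
rewrite measureU//.
  transitivity (P ([set w | f w = v] `&` F) + P ([set w | f w \in s] `&` F))%E;
    first by [].
  by rewrite ps big_cons.
by apply/seteqP; split=> // w [[/= -> _] [/=]]; rewrite (negbTE ns).
Qed.

Section Strings.
Context {R : realType} {A : finType} {disp : measure_display}
  {Omega : measurableType disp}.
Variables (p : A -> R) (P : probability Omega R) (Xi : nat -> Omega -> infstr A).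
Hypothesis hXi : iid_strings P p Xi.
Variable a0 : A.

Definition prefixes n M (w : Omega) : {ffun 'I_n -> {ffun 'I_M -> A}} :=
  [ffun i : 'I_n => [ffun j : 'I_M => Xi i w j]].

Lemma prefixesP n M w (tau : {ffun 'I_n -> {ffun 'I_M -> A}}) :
  prefixes n M w = tau <->
  forall (i : 'I_n) (j : 'I_M), Xi i w j = tau i j.
Proof.
split=> [<- i j|h]; first by rewrite !ffunE.
by apply/ffunP => i; apply/ffunP => j; rewrite !ffunE.
Qed.

Section Cylinder.
Variables (n M : nat) (tau : {ffun 'I_n -> {ffun 'I_M -> A}}).

(** Extended by [a0] to all natural indices, because independence is formulated for families indexed
    by [nat]. *)
Let letter (i j : nat) : A :=
  if insub i is Some i' then (if insub j is Some j' then tau i' j' else a0) else a0.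

Let letterE (i : 'I_n) (j : 'I_M) : letter i j = tau i j.
Proof. by rewrite /letter !valK. Qed.

Let cyl (i : nat) : set Omega :=
  \bigcap_(j in [set j | (j < M)%N]) [set w | Xi i w j = letter i j].

Let prefixesE :
  [set w | prefixes n M w = tau] = \bigcap_(i in [set i | (i < n)%N]) cyl i.
Proof.
apply/seteqP; split=> w /=.
  move=> /prefixesP h i /= hi j /= hj.
  by have := h (Ordinal hi) (Ordinal hj); rewrite -letterE.
by move=> h; apply/prefixesP => i j; rewrite -letterE; exact: (h i (ltn_ord i) j (ltn_ord j)).
Qed.

Lemma measurable_prefixes_eq : measurable [set w | prefixes n M w = tau].
Proof.
rewrite prefixesE; apply: sigma_algebra_bigcap_lt.
  exact: sigma_algebra_measurable.
move=> i _; apply: sigma_algebra_bigcap_lt; first exact: sigma_algebra_measurable.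
move=> j _; exact: letter_measurable hXi _ _ _.
Qed.

Lemma prob_prefixes_eq : P [set w | prefixes n M w = tau] = (tweight p tau)%:E.
Proof.
rewrite prefixesE -bigcap_fset_iota (strings_indep hXi); last first.
  move=> i _; apply: sigma_algebra_bigcap_lt; first exact: smallest_sigma_algebra.
  move=> j _; apply: sub_sigma_algebra; exists j => //.
  by exists [set letter i j].
rewrite prod_fset_iota /tweight /pweight -prod_EFin; apply: eq_bigr => i _.
rewrite /cyl -bigcap_fset_iota (@letters_indep _ _ _ _ _ _ _ hXi i); last first.
  by move=> j _; exists [set letter i j].
rewrite prod_fset_iota /wordweight /pweight -prod_EFin; apply: eq_bigr => j _.
by rewrite (letter_law hXi) letterE.
Qed.

End Cylinder.

Lemma prob_prefixes n M (B : pred {ffun 'I_n -> {ffun 'I_M -> A}}) :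
  measurable [set w | B (prefixes n M w)] /\
  P [set w | B (prefixes n M w)] = (\sum_tau tweight p tau * (B tau)%:R)%:E.
Proof.
have [] := measure_fibers P (s := [seq tau <- index_enum _ | B tau])
  measurableT (@measurable_prefixes_eq n M).
  by rewrite filter_uniq ?index_enum_uniq.
rewrite setIT; have -> : [set w | prefixes n M w \in [seq tau <- index_enum _ | B tau]] =
    [set w | B (prefixes n M w)].
  by apply/seteqP; split=> w /=; rewrite mem_filter mem_index_enum andbT.
move=> mB ->; split=> //; rewrite -sumEFin big_filter big_mkcond/=.
apply: eq_bigr => tau _; rewrite setIT prob_prefixes_eq.
by case: (B tau); rewrite ?mulr1 ?mulr0.
Qed.

End Strings.

Section Agreement.
Context {A : finType}.
Implicit Types (s : seq A).

Definition agree n M (x y : 'I_n -> infstr A) :=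
  forall i j, (j < M)%N -> x i j = y i j.

Lemma has_prefix_agree M (x y : infstr A) s :
  (forall j, (j < M)%N -> x j = y j) -> (size s <= M)%N ->
  has_prefix x s = has_prefix y s.
Proof.
move=> xy sM; rewrite /has_prefix; congr (_ == _).
apply/eq_in_map => j; rewrite mem_iota => /andP[_ /= js].
by apply: xy; exact: leq_trans js sM.
Qed.

Lemma nu_agree n M (x y : 'I_n -> infstr A) s :
  agree M x y -> (size s <= M)%N -> nu x s = nu y s.
Proof.
move=> xy sM; apply: eq_card => i; rewrite !inE.
by apply: has_prefix_agree sM => j; exact: xy.
Qed.

Lemma trie_agree_size n M (x y : 'I_n -> infstr A) s :
  agree M x y -> (size s <= M)%N -> trie x s -> trie y s.
Proof.
move=> xy sM; have nE t : (size t <= M)%N -> nu x t = nu y t by exact: nu_agree.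
rewrite /trie /= -nE// => -[h|[h1 h2]]; [by left|right; split=> //].
case: h2 => [->|[b [c [sE b2]]]]; [by left|right; exists b, c; split=> //].
by rewrite -nE// ltnW// (leq_trans _ sM)// sE size_rcons.
Qed.

Definition separated n M (x : 'I_n -> infstr A) :=
  forall s, (M <= size s)%N -> (nu x s <= 1)%N.

Lemma separatedP n M (x : 'I_n -> infstr A) :
  separated M x <-> injective (fun i => mkseq (x i) M).
Proof.
split=> [h i j e|h s Ms].
  apply/eqP/negPn/negP => ij.
  have := h (mkseq (x i) M); rewrite size_mkseq => /(_ (leqnn _)).
  rewrite leqNgt => /negP; apply; apply/card_gt1P; exists i, j; split=> //.
    by rewrite inE /has_prefix size_mkseq.
  by rewrite inE e /has_prefix size_mkseq.
rewrite leqNgt; apply/negP => /card_gt1P[i [j [hi hj /eqP ij]]]; apply: ij; move: hi hj.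
rewrite !inE /has_prefix => /eqP si /eqP sj; apply: h.
have tk y : mkseq (x y) (size s) = s -> mkseq (x y) M = take M s.
  by move=> <-; rewrite /mkseq -map_take take_iota (minn_idPl Ms).
by rewrite (tk _ si) (tk _ sj).
Qed.

(** Separation at depth [M] bounds the length of every node by [M], and membership of such words
    depends on the first [M] letters only. Separation itself passes from [x] to [y]. *)
Lemma trie_agree n M (x y : 'I_n -> infstr A) :
  agree M x y -> separated M x -> trie x = trie y.
Proof.
move=> xy sx; have sy : separated M y.
  apply/separatedP => i j; have mE z : mkseq (y z) M = mkseq (x z) M.
    by apply/eq_in_map => k; rewrite mem_iota => /andP[_ /= kM]; rewrite xy.
  by rewrite !mE; exact: (separatedP M x).1 sx i j.
have yx : agree M y x by move=> i j jM; rewrite xy.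
apply/seteqP; split=> s hs; [apply: (trie_agree_size xy)|apply: (trie_agree_size yx)] => //.
  exact: trie_size sx _ hs.
exact: trie_size sy _ hs.
Qed.

(** Tries are closed under prefixes. Consequently a value of the random node outside the trie
    produces no leaves and does not enter an event with [k > 0]. *)
Lemma fringe_notin n (x : 'I_n -> infstr A) v : ~ trie x v -> fringe (trie x) v = set0.
Proof.
move=> nv; apply/seteqP; split=> // b hb; apply: nv; move: hb; rewrite /fringe /=.
elim/last_ind: b => [|b c IH]; rewrite ?cats0//.
rewrite -rcons_cat => -[h|[h [|[b' [c' [/rcons_inj[<- _]]]]]]].
- by apply: IH; left; apply: leq_trans h (nu_prefix _ (prefix_rcons _ _)).
- by move=> /(congr1 size); rewrite size_rcons.
- by move=> h'; apply: IH; left.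
Qed.

End Agreement.

Section Conditioning.
Context {R : realType} {A : finType} {disp : measure_display}
  {Omega : measurableType disp}.
Variables (p : A -> R) (P : probability Omega R) (Xi : nat -> Omega -> infstr A).
Hypothesis p_gt0 : forall a, 0 < p a.
Hypothesis p_sum1 : \sum_a p a = 1.
Hypothesis hXi : iid_strings P p Xi.
Variable a0 : A.
Variable n : nat.

Let x w : 'I_n -> infstr A := fun i => Xi i w.
Let T := random_trie Xi n.
Let ext_prefixes M (tau : {ffun 'I_n -> {ffun 'I_M -> A}}) : 'I_n -> infstr A :=
  fun i => ext a0 (tau i).

Lemma agree_prefixes M w : agree M (x w) (ext_prefixes (prefixes Xi n M w)).
Proof.
move=> i j jM; rewrite /ext_prefixes /x.
by have := extE a0 (prefixes Xi n M w i) (Ordinal jM); rewrite /= => ->; rewrite !ffunE.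
Qed.

Lemma agree_sym M (y z : 'I_n -> infstr A) : agree M y z -> agree M z y.
Proof. by move=> h i j jM; rewrite h. Qed.

Lemma separated_ext M (tau : {ffun 'I_n -> {ffun 'I_M -> A}}) :
  separated M (ext_prefixes tau) <-> injectiveb tau.
Proof.
have e i j : mkseq (ext_prefixes tau i) M = mkseq (ext_prefixes tau j) M <->
    tau i = tau j.
  split=> [h|h]; last by rewrite /ext_prefixes h.
  apply/ffunP => k; rewrite -!(extE a0).
  by have := congr1 (fun s => nth a0 s k) h; rewrite !nth_mkseq.
rewrite separatedP; split=> [h|/injectiveP h i j /e/h//].
by apply/injectiveP => i j /e/h.
Qed.

Definition good M w := injectiveb (prefixes Xi n M w).

Lemma goodP M w : good M w <-> separated M (x w).
Proof.
rewrite /good -separated_ext !separatedP.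
have e i : mkseq (ext_prefixes (prefixes Xi n M w) i) M = mkseq (x w i) M.
  by apply/eq_in_map => k; rewrite mem_iota => /andP[_ /= kM]; rewrite -agree_prefixes.
by split=> h i j; [rewrite -!e|rewrite !e]; exact: h.
Qed.

Lemma trie_good M w : good M w -> T w = trie (ext_prefixes (prefixes Xi n M w)).
Proof. by move=> /goodP h; apply: trie_agree (@agree_prefixes M w) h. Qed.

Lemma measurable_trie_mem s : measurable [set w | T w s].
Proof.
have [+ _] := prob_prefixes hXi a0 (fun tau : {ffun 'I_n -> {ffun 'I_(size s) -> A}} =>
  `[< trie (ext_prefixes tau) s >]).
congr measurable; apply/seteqP; split=> w /=.
  move=> /asboolP; apply: trie_agree_size (leqnn _).
  exact/agree_sym/agree_prefixes.
move=> h; apply/asboolP; move: h; apply: trie_agree_size (leqnn _).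
exact: agree_prefixes.
Qed.

(** Trees are arbitrary sets of words, but there are only countably many words: equality with [t] is
    a countable intersection of membership events, each determined by finitely many letters. *)
Lemma measurable_trie_eq (t : strtree A) : measurable [set w | T w = t].
Proof.
have -> : [set w | T w = t] = ~` \bigcup_(s : seq A)
    (if `[< t s >] then ~` [set w | T w s] else [set w | T w s]).
  apply/seteqP; split=> w /=.
    by move=> Tt [s _]; case: asboolP => /=; rewrite -Tt.
  move=> h; apply/seteqP; split=> s hs; apply: contrapT => h'; apply: h; exists s => //;
    by case: asboolP.
apply: measurableC; apply: countable_bigcupT_measurable => [|s].
  exact: countableP.
by case: asboolP => _; [apply: measurableC|]; exact: measurable_trie_mem.
Qed.

(** The event that the [n] strings are pairwise distinct. *)
Definition all_good : set Omega := \bigcup_M [set w | good M w].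

Lemma measurable_good M : measurable [set w | good M w].
Proof. exact: (prob_prefixes hXi a0 (fun tau => injectiveb tau)).1. Qed.

Lemma prob_not_good M :
  (P (~` [set w | good M w]) <= (n%:R ^+ 2 * (\sum_a p a ^+ 2) ^+ M)%:E)%E.
Proof.
have [_ h] := prob_prefixes hXi a0
  (fun tau : {ffun 'I_n -> {ffun 'I_M -> A}} => ~~ injectiveb tau).
have -> : ~` [set w | good M w] = [set w | ~~ injectiveb (prefixes Xi n M w)].
  by apply/seteqP; split=> w /= /negP.
rewrite h lee_fin -sum_wordweight_sqr; apply: prob_not_injective.
  by move=> u; exact: wordweight_ge0.
exact: wordweight_sum1.
Qed.

Hypothesis hA : (2 <= #|A|)%N.

Lemma measurable_all_good : measurable all_good.
Proof. by apply: bigcupT_measurable => M; exact: measurable_good. Qed.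

Lemma prob_not_all_good : P (~` all_good) = 0%E.
Proof.
apply/eqP; rewrite eq_le measure_ge0 andbT.
set q := \sum_a p a ^+ 2.
have [c /andP[c0 c1] hc] := p_gap p_gt0 p_sum1 hA.
have /andP[q0 q1] : 0 <= q <= 1 - c := sump_sqr p_gt0 p_sum1 c0 hc.
have cv : (n%:R ^+ 2 * q ^+ M)%:E @[M --> \oo] --> (0 : \bar R).
  apply: cvg_EFin; first exact: nearW.
  rewrite -(mulr0 (n%:R ^+ 2)); apply: cvgMl_tmp; apply: cvg_expr.
  by rewrite ger0_norm// (le_lt_trans q1)// ltrBlDr ltrDl.
rewrite -(cvg_lim _ cv)//; apply: lime_ge; first by apply/cvg_ex; exists 0%E.
apply: nearW => M; apply: le_trans (prob_not_good M).
apply: le_measure; rewrite ?inE; [exact/measurableC/measurable_all_good|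
  exact/measurableC/measurable_good|].
by apply: subsetC => w h; exists M.
Qed.

(** The trie alone decides whether the strings are distinct: if its nodes have length at most [M],
    no word of length [M.+1] is shared. So the fibre of a bad trie consists of bad outcomes and is
    null. *)
Lemma bad_trie_eq w w' : ~ all_good w -> T w' = T w -> ~ all_good w'.
Proof.
move=> nw e [M _ /goodP hM]; apply: nw; exists M.+1 => //.
apply/goodP => s Ms; rewrite leqNgt; apply/negP => s2.
have : T w' s by rewrite e; left.
by move=> /(trie_size hM); rewrite leqNgt Ms.
Qed.

(** The fibre contains a cylinder, whose probability is a product of positive letter weights.
    Positivity matters since [uniform_node] speaks only of tries with positive probability. *)
Lemma prob_trie_gt0 M w : good M w -> (0 < P [set w' | T w' = T w])%E.
Proof.
move=> gw; apply: (@lt_le_trans _ _ (P [set w' | prefixes Xi n M w' = prefixes Xi n M w])).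
  rewrite (prob_prefixes_eq hXi a0) lte_fin /tweight /pweight.
  by apply: prodr_gt0 => i _; apply: prodr_gt0 => j _; exact: p_gt0.
apply: le_measure; rewrite ?inE; [exact: (measurable_prefixes_eq hXi a0)|
  exact: measurable_trie_eq|].
move=> w' /= e; rewrite (trie_good gw) -e; apply: trie_good.
by rewrite /good e.
Qed.

Variable V : Omega -> seq A.
Hypothesis hV : uniform_node P T V.
Variable k : nat.
Hypothesis k_gt0 : (0 < k)%N.

Let prob : Omega -> R :=
  cprob_given P [set w | nleaves (fringe (T w) (V w)) = k] T.

(** On the fibre of the trie [t] the event is the disjoint union of the events [V = v] over the
    nodes [v] whose fringe has [k] leaves, each of conditional probability [1 / nnodes t]. *)
Lemma cprob_good w : all_good w ->
  prob w = (Phi k (T w))%:R / (nnodes (T w))%:R.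
Proof.
move=> [M _ gw]; rewrite /prob /cprob_given /cprob.
set t := T w; set F := [set w' | T w' = t].
have F0 : (0 < P F)%E by exact: prob_trie_gt0 gw.
have fin : finite_set t by rewrite /t /T /random_trie; apply: trie_finite ((goodP M w).1 gw).
have mF : measurable F by exact: measurable_trie_eq.
have f0 : 0 < fine (P F) by rewrite fine_gt0// F0 -ge0_fin_numE ?fin_num_measure// ltW.
pose S := [set v | t v /\ nleaves (fringe t v) = k].
have finS : finite_set S by apply: sub_finite_set fin => v [].
have SE : [set w' | nleaves (fringe (T w') (V w')) = k] `&` F =
    [set w' | V w' \in (fset_set S : seq _)] `&` F.
  apply/seteqP; split=> w' /= [h Ft]; split=> //.
    rewrite in_fset_set// inE; rewrite Ft in h; split=> //.
    apply: contrapT => nt; move: h; rewrite /t fringe_notin//.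
    move=> h; move: k_gt0; rewrite -h /nleaves /leaves.
    rewrite (_ : [set a | _] = set0) ?fset_set0 ?cardfs0//.
    by apply/seteqP; split=> // a [].
  by move: h; rewrite in_fset_set// inE => -[_ <-]; rewrite Ft.
have [_] := measure_fibers P mF hV.1 (fset_uniq (fset_set S)).
rewrite SE => ->.
have hv v : v \in fset_set S -> P ([set w' | V w' = v] `&` F) =
    (fine (P F) / (nnodes t)%:R)%:E.
  rewrite in_fset_set// inE => -[tv _].
  have := hV.2 t v F0; rewrite /cprob indicE mem_set// mul1r => e.
  rewrite -[LHS]fineK ?fin_num_measure//; last exact: measurableI (hV.1 v) mF.
  by congr EFin; rewrite -[LHS](divfK (lt0r_neq0 f0)) e mulrC.
rewrite big_seq (eq_bigr (fun=> (fine (P F) / (nnodes t)%:R)%:E)); last by move=> v /hv.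
rewrite -big_seq sumEFin /= big_const_seq count_predT iter_addr_0.
rewrite /Phi -/S; have e (y u : R) m : y != 0 -> (y * u) *+ m / y = m%:R * u.
  by move=> y0; rewrite -mulr_natr; field.
by rewrite e// lt0r_neq0.
Qed.

(* The measure of a set is only meaningful if the set is measurable, so the value
   on the null event of coinciding strings matters: it is [0 / 0 = 0]. *)
Lemma cprob_bad w : ~ all_good w -> prob w = 0.
Proof.
move=> nw; rewrite /prob /cprob_given /cprob.
rewrite (_ : P [set w' | T w' = T w] = 0%E) ?invr0 ?mulr0//.
apply/eqP; rewrite eq_le measure_ge0 andbT -prob_not_all_good.
apply: le_measure; rewrite ?inE; [exact: measurable_trie_eq|
  exact/measurableC/measurable_all_good|].
by move=> w' /= /(bad_trie_eq nw).
Qed.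

Lemma cprob_ae : \forall w \ae P,
  prob w = (Phi k (T w))%:R / (nnodes (T w))%:R.
Proof.
exists (~` all_good); split; first exact/measurableC/measurable_all_good.
  exact: prob_not_all_good.
by apply: subsetC => w; exact: cprob_good.
Qed.

(** A union bound with the event [~ good M], and on [good M] a finite sum over prefixes. The
    deviation event must first be shown measurable: it is the union of its traces on the events
    [good N], which are determined by finitely many letters, and of its trace on the null event,
    where [prob] is constantly 0. *)
Lemma prob_deviation_le (c e : R) M :
  (P [set w | (e <= `|prob w - c|)%R] <=
  (n%:R ^+ 2 * (\sum_a p a ^+ 2) ^+ M + \sum_(tau : {ffun 'I_n -> {ffun 'I_M -> A}})
    tweight p tau * (injectiveb tau && (e <=
      `|(Phi k (trie (ext_prefixes tau)))%:R /
        (nnodes (trie (ext_prefixes tau)))%:R - c|))%:R)%:E)%E.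
Proof.
set B := [set w | _].
pose Q M (tau : {ffun 'I_n -> {ffun 'I_M -> A}}) := injectiveb tau && (e <=
      `|(Phi k (trie (ext_prefixes tau)))%:R /
        (nnodes (trie (ext_prefixes tau)))%:R - c|).
have ag N w : good N w -> all_good w by move=> h; exists N.
have BE N : B `&` [set w | good N w] = [set w | Q N (prefixes Xi n N w)].
  apply/seteqP; split=> w /=; rewrite /B /Q /= -/(good N w).
    move=> [+ gw]; rewrite cprob_good; last exact: ag gw.
    by rewrite (trie_good gw) gw => ->.
  move=> /andP[gw]; rewrite cprob_good; last exact: ag gw.
  by rewrite (trie_good gw).
have mBN N : measurable (B `&` [set w | good N w]).
  by rewrite BE; exact: (prob_prefixes hXi a0 (@Q N)).1.
have mBG : measurable (B `&` ~` all_good).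
  have [h|h] := boolP (e <= `|0 - c|).
    rewrite (_ : _ `&` _ = ~` all_good); first exact/measurableC/measurable_all_good.
    by apply/seteqP; split=> [w []//|w nw]; split=> //; rewrite /B /= cprob_bad.
  rewrite (_ : _ `&` _ = set0)//.
  by apply/seteqP; split=> // w [+ nw]; rewrite /B /= cprob_bad// (negbTE h).
have mB : measurable B.
  have -> : B = (\bigcup_N (B `&` [set w | good N w])) `|` (B `&` ~` all_good).
    apply/seteqP; split=> w.
      move=> Bw; have [[N _ gN]|nw] := pselect (all_good w); last by right.
      by left; exists N.
    by move=> [[N _ []]//|[]].
  by apply: measurableU => //; apply: bigcupT_measurable.
apply: (@le_trans _ _ (P (~` [set w | good M w] `|` B `&` [set w | good M w]))).
  apply: le_measure; rewrite ?inE //.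
    by apply: measurableU => //; exact/measurableC/measurable_good.
  by move=> w Bw; have [|] := boolP (good M w) => /= h; [right|left; exact/negP].
apply: (le_trans (measureU2 _ _ _)) => //; first exact/measurableC/measurable_good.
rewrite EFinD; apply: leeD; first exact: prob_not_good.
apply: (@le_trans _ _ (P [set w | Q M (prefixes Xi n M w)])); first by rewrite BE.
have e2 := (prob_prefixes hXi a0 (@Q M)).2; rewrite le_eqVlt; apply/orP; left.
by apply/eqP; exact: e2.
Qed.

End Conditioning.

(** * Limits *)

Section Sequences.
Context {R : realType}.

Lemma cvgn0P (u : nat -> R) :
  (forall e, 0 < e -> exists N, forall n, (N <= n)%N -> `|u n| <= e) ->
  u @ \oo --> 0.
Proof.
move=> h; apply/cvgr0Pnorm_le => e /h[N hN]; near=> n; apply: hN.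
near: n; exact: nbhs_infty_ge.
Unshelve. all: by end_near. Qed.

Lemma cvgn0_le (u : nat -> R) :
  u @ \oo --> 0 ->
  forall e, 0 < e -> exists N, forall n, (N <= n)%N -> `|u n| <= e.
Proof. by move=> /cvgr0Pnorm_le h e /h [N _ hN]; exists N => n /hN. Qed.

Lemma cvgn0_sum (I : Type) (r : seq I) (u : I -> nat -> R) :
  (forall i, u i @ \oo --> 0) -> (fun n => \sum_(i <- r) u i n) @ \oo --> 0.
Proof.
move=> hu; elim: r => [|i r IH].
  by under eq_fun do rewrite big_nil; exact: cvg_cst.
under eq_fun do rewrite big_cons.
have := cvgD (hu i) IH; rewrite addr0; exact.
Qed.

Lemma cvgn0D (u v : nat -> R) : u @ \oo --> 0 -> v @ \oo --> 0 ->
  (fun n => u n + v n) @ \oo --> 0.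
Proof. by move=> hu hv; have := cvgD hu hv; rewrite addr0; exact. Qed.

Lemma cvgn0Z (k : R) (u : nat -> R) : u @ \oo --> 0 ->
  (fun n => k * u n) @ \oo --> 0.
Proof. by move=> hu; rewrite -[X in _ --> X](mulr0 k); apply: cvgMl_tmp. Qed.

Lemma cvgn0_norm (u : nat -> R) : u @ \oo --> 0 -> (fun n => `|u n|) @ \oo --> 0.
Proof. by move=> hu; rewrite -[X in _ --> X](@normr0 _ R); apply: cvg_norm. Qed.

Lemma cvgn0_squeeze (u v : nat -> R) : v @ \oo --> 0 ->
  (forall n, (0 < n)%N -> `|u n| <= v n) -> u @ \oo --> 0.
Proof.
move=> hv uv; apply: cvgn0P => e /(cvgn0_le hv)[N hN].
exists (maxn 1 N) => n; rewrite geq_max => /andP[/uv h /hN h'].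
by rewrite (le_trans h)// (le_trans (ler_norm _)).
Qed.

Lemma cvgn_vanishing (g : R -> R) : vanishing g ->
  (fun n : nat => g (ln n%:R)) @ \oo --> 0.
Proof.
move=> hg; apply: cvgn0P => e /hg[T hT].
exists (Num.truncn (expR T)).+1 => n hn; apply: hT.
rewrite -[T]expRK ler_ln ?posrE ?expR_gt0 ?ltr0n ?(leq_trans _ hn)//.
rewrite (le_trans (ltW (truncnS_gt _)))// ler_nat//.
Qed.

(* A depth of order [ln n] separates [n] strings with high probability. *)
Lemma depth_sequence (q : R) : 0 <= q < 1 ->
  exists d : nat -> nat, (fun n => n%:R ^+ 2 * q ^+ d n) @ \oo --> 0 /\
    (fun n => (1 + (d n)%:R) / n%:R : R) @ \oo --> 0.
Proof.
move=> /andP[q0 q1].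
have cq : (fun r => q ^+ r) @ \oo --> 0 by apply: cvg_expr; rewrite ger0_norm.
(* With [q^r <= 1/8] and [L = trunc_log 2 n], [q^(r L) <= 8^-L] beats [n^2 <= 4 * 4^L] and leaves
   [4 / 2^L]. *)
have [|r /(_ r (leqnn _))] := cvgn0_le cq (e := 8^-1); first by rewrite invr_gt0.
rewrite ger0_norm ?exprn_ge0// => qr.
exists (fun n => r * trunc_log 2 n)%N.
(* The inequality [(half n + 1)^2 <= 2^(trunc_log 2 n) <= n] yields rates of order
   [1 / (half n + 1)] for both limits by integer arithmetic alone. *)
pose half n := ((trunc_log 2 n)./2)%N.
have sq n : (0 < n)%N -> ((half n).+1 ^ 2 <= 2 ^ trunc_log 2 n)%N.
  move=> n0; apply: (@leq_trans (2 ^ (half n).*2)).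
    by rewrite -muln2 expnM leq_exp2r// ltn_expl.
  rewrite leq_pexp2l// -[leqRHS]odd_double_half; exact: leq_addl.
have lb n : (0 < n)%N -> (2 ^ trunc_log 2 n <= n)%N.
  by move=> n0; have /andP[] := trunc_log_bounds (ltnSn 1) n0.
have ub n : (0 < n)%N -> (n <= 2 ^ (trunc_log 2 n).+1)%N.
  by move=> n0; have /andP[_ /ltnW] := trunc_log_bounds (ltnSn 1) n0.
have h1 n : (0 < n)%N -> n%:R ^+ 2 * q ^+ (r * trunc_log 2 n) <= 4 / (half n).+1%:R :> R.
  move=> n0; set L := trunc_log 2 n.
  have nL : n%:R <= 2 * 2 ^+ L :> R by rewrite -exprS -natrX ler_nat ub.
  apply: (@le_trans _ _ ((2 * 2 ^+ L) ^+ 2 * (8^-1) ^+ L)).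
    apply: ler_pM; rewrite ?exprn_ge0//; first by rewrite lerXn2r ?nnegrE ?mulr_ge0 ?exprn_ge0.
    by rewrite exprM lerXn2r ?nnegrE ?exprn_ge0.
  have -> : (2 * 2 ^+ L) ^+ 2 * (8^-1) ^+ L = 4 / 2 ^+ L :> R.
    have -> : (8^-1) ^+ L = ((2 ^+ L) ^+ 3)^-1 :> R.
      by rewrite exprVn -exprM mulnC exprM; congr ((_ ^+ L)^-1); ring.
    have : 2 ^+ L != 0 :> R by rewrite expf_neq0.
    by move: (2 ^+ L) => y y0; field.
  rewrite ler_wpM2l// lef_pV2 ?posrE ?exprn_gt0// -natrX ler_nat.
  by apply: leq_trans (sq _ n0); rewrite -mulnn leq_pmulr.
have h2 n : (0 < n)%N -> (1 + (r * trunc_log 2 n)%:R) / n%:R <=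
    (1 + 2 * r%:R) / (half n).+1%:R :> R.
  move=> n0; rewrite ler_pdivrMr ?ltr0n// mulrAC ler_pdivlMr// -!natrM.
  rewrite -[1]/(1%:R) -!natrD -!natrM ler_nat.
  have hL : (trunc_log 2 n <= (half n).*2.+1)%N.
    by rewrite -[leqLHS]odd_double_half -[leqRHS]add1n leq_add2r leq_b1.
  apply: (@leq_trans ((1 + 2 * r) * ((half n).+1 * (half n).+1))).
    rewrite mulnA leq_mul2r /=.
    apply: (@leq_trans (1 + r * (half n).*2.+1)); first by rewrite leq_add2l leq_mul2l hL orbT.
    rewrite mulnDl mul1n leq_add// [(2 * r)%N]mulnC -mulnA leq_mul2l.
    by rewrite mul2n doubleS ltnS leqnSn orbT.
  by rewrite leq_mul2l mulnn (leq_trans (sq _ n0)) ?lb ?orbT.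
have hlim (C : R) : 0 <= C -> forall e, 0 < e -> exists N, forall n, (N <= n)%N ->
    (0 < n)%N /\ C / (half n).+1%:R <= e.
  move=> C0 e e0; pose J := Num.truncn (C / e).
  exists (2 ^ J.*2)%N => n hn.
  have n0 : (0 < n)%N by apply: leq_trans hn; rewrite expn_gt0.
  split=> //; rewrite ler_pdivrMr// mulrC -ler_pdivrMr//.
  apply: (le_trans (ltW (truncnS_gt _))); rewrite ler_nat ltnS -/J.
  by rewrite -[J]doubleK half_leq// trunc_log_max.
split; apply: cvgn0P => e e0.
  have [N hN] := hlim 4 (ler0n _ _) e e0; exists N => n /hN[n0 h].
  rewrite ger0_norm ?mulr_ge0 ?exprn_ge0//; exact: le_trans (h1 n n0) h.
have [|N hN] := hlim (1 + 2 * r%:R) _ e e0; first by rewrite addr_ge0// mulr_ge0.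
exists N => n /hN[n0 h].
rewrite ger0_norm ?divr_ge0 ?addr_ge0//; exact: le_trans (h2 n n0) h.
Qed.

End Sequences.

Section Means.
Context {R : realType} {A : finType}.
Variable p : A -> R.
Hypothesis hA : (2 <= #|A|)%N.
Hypothesis p_gt0 : forall a, 0 < p a.
Hypothesis p_sum1 : \sum_a p a = 1.
Variable d : nat -> nat.
Hypothesis d_tail : (fun n => n%:R ^+ 2 * (\sum_a p a ^+ 2) ^+ d n) @ \oo --> (0 : R).

(** At [t = ln n] the left sum is [fsum], and its distance to the renewal solution is at most
    [K * n * q ^+ d n], which [d_tail] makes small. *)
Lemma mean_asymptotics (f : R -> R) : renewal_asymptotics p f ->
  (fun n => (\sum_(s <- words (d n)) f (n%:R * wt p s)) / n%:R -
     psi p f (ln n%:R) / entropy p) @ \oo --> 0.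
Proof.
move=> [F [K [hF FK hK]]].
have hd := cvgn0_le d_tail.
have h1 := cvgn0_le (cvgn_vanishing hF).
apply: cvgn0P => e e0.
have K0 : 0 <= K by have /andP[] := FK 0; exact: le_trans.
have [N1 hN1] := h1 _ (divr_gt0 e0 (ltr0n _ 2)).
have [|N2 hN2] := hd (e / 2 / (K + 1)).
  by rewrite !divr_gt0// ltr_wpDl.
exists (maxn 1 (maxn N1 N2)) => n; rewrite !geq_max => /and3P[n0 /hN1 g1 /hN2 g2].
have N0 : 0 < n%:R :> R by rewrite ltr0n.
have -> : (\sum_(s <- words (d n)) f (n%:R * wt p s)) / n%:R = fsum p f (d n) (ln n%:R).
  by rewrite /fsum expRN lnK// mulrC.
have := hK (d n) (ln n%:R); rewrite lnK// => /andP[k0 k1].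
have k2 : F (ln n%:R) - fsum p f (d n) (ln n%:R) <= e / 2.
  apply: (le_trans k1); move: g2; rewrite ger0_norm; last first.
    by rewrite mulr_ge0 ?exprn_ge0// sumr_ge0// => a _; rewrite sqr_ge0.
  set Q := (_ ^+ d n); have Q0 : 0 <= Q.
    by rewrite exprn_ge0// sumr_ge0// => a _; rewrite sqr_ge0.
  move=> g2; have n2 : n%:R * Q <= e / 2 / (K + 1).
    apply: le_trans g2; rewrite ler_wpM2r// expr2 ler_peMl ?ler0n// ler1n//.
  rewrite -mulrA; apply: (@le_trans _ _ ((K + 1) * (n%:R * Q))).
    by rewrite ler_wpM2r ?mulr_ge0// lerDl.
  by rewrite mulrC -ler_pdivlMr// ltr_wpDl.
have -> : fsum p f (d n) (ln n%:R) - psi p f (ln n%:R) / entropy p =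
  - (F (ln n%:R) - fsum p f (d n) (ln n%:R)) +
  (F (ln n%:R) - psi p f (ln n%:R) / entropy p) by ring.
apply: (le_trans (ler_normD _ _)); rewrite normrN ger0_norm//.
by rewrite [leRHS]splitr lerD.
Qed.

End Means.

Section Truncation.
Context {R : realType}.

(** Cuts the Poisson mean at the same level as [indic_gt1_split] cuts the random count, so that the
    two can be compared term by term. *)
Lemma fEi_split K (y : R) : fEi y = \sum_(i < K) fE i.+2 y + fE_tail K.+2 y.
Proof.
rewrite fEiE /fE_tail [in RHS]big_ord_recl [in RHS]big_ord_recl.
rewrite big_ord_recl big_ord1 /=.
have -> : \sum_(i < K) fE (bump 0%N (bump 0%N i)) y = \sum_(i < K) fE i.+2 y.
  by apply: eq_bigr.
ring.
Qed.

Lemma indic_gt1_split K (v : nat) :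
  (1 < v)%N%:R = \sum_(i < K) (v == i.+2)%:R + (K.+1 < v)%N%:R :> R.
Proof.
have [v1|v1] := leqP v 1.
  rewrite big1 => [|i _]; last by case: v v1 => [|[]].
  by rewrite add0r ltnNge (leq_trans v1).
have [vK|vK] := leqP v K.+1; last first.
  rewrite big1 ?add0r// => i _; case: eqP => // vE.
  by move: vK; rewrite vE !ltnS leqNgt ltn_ord.
case: v v1 vK => [|[|v]]// _ vK.
have vK' : (v < K)%N by [].
rewrite (bigD1 (Ordinal vK'))//= eqxx [X in _ + X + _]big1 => [|i /eqP iv].
  by rewrite !addr0.
by case: eqP => // -[e']; case: iv; apply/val_inj.
Qed.

End Truncation.

Section MeanConvergence.
Context {R : realType} {A : finType}.
Variable p : A -> R.
Hypothesis hA : (2 <= #|A|)%N.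
Hypothesis p_gt0 : forall a, 0 < p a.
Hypothesis p_sum1 : \sum_a p a = 1.
Variable a0 : A.
Variable d : nat -> nat.
Hypothesis d_small : (fun n => (1 + (d n)%:R) / n%:R : R) @ \oo --> 0.

Definition internal n M (tau : {ffun 'I_n -> {ffun 'I_M -> A}}) : R :=
  \sum_(s <- words M) (1 < nuw a0 tau s)%N%:R.

Lemma profile_L1 k : (2 <= k)%N ->
  (fun n => (\sum_tau @tweight R A p n (d n) tau *
    `|profile a0 k tau - \sum_(s <- words (d n)) fE k (n%:R * wt p s)|) / n%:R)
  @ \oo --> 0.
Proof.
move=> k2; have [D D0 hD] := @profile_concentration R A p hA p_gt0 p_sum1 a0 k k2.
apply: cvgn0P => e e0; have e2 : 0 < e / 2 by rewrite divr_gt0.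
have [|N hN] := cvgn0_le d_small (e := (e / 2) * (e / 2) / (D + 1)).
  by rewrite divr_gt0 ?mulr_gt0// ltr_wpDl.
exists (maxn 1 (maxn N (k + k))) => n; rewrite !geq_max => /and3P[n0 /hN h kn].
have N0 : 0 < n%:R :> R by rewrite ltr0n.
rewrite ger0_norm; last first.
  by rewrite divr_ge0// sumr_ge0// => tau _; rewrite mulr_ge0// (tweight_ge0 p_gt0).
rewrite ger0_norm ?divr_ge0 ?addr_ge0// in h.
pose c := \sum_(s <- words (d n)) fE k (n%:R * wt p s); rewrite -/c.
have := hD n (d n) kn; rewrite -/c => hE.
(* This replaces the Cauchy-Schwarz inequality: with [y = (e / 2) * n] the first term gives [e / 2]
   after division by [n], and the second is governed by the variance. *)
have pt (z : R) : `|z| <= (e / 2) * n%:R + z ^+ 2 / ((e / 2) * n%:R).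
  set y := (e / 2) * n%:R; have y0 : 0 < y by rewrite mulr_gt0.
  rewrite -real_normK ?num_real//; have z0 := normr_ge0 z.
  move: `|z| z0 => v v0; rewrite -(ler_pM2r y0) mulrDl divfK ?gt_eqF//; nra.
apply: (@le_trans _ _ ((\sum_tau @tweight R A p n (d n) tau *
   ((e / 2) * n%:R + (profile a0 k tau - c) ^+ 2 / ((e / 2) * n%:R))) / n%:R)).
  rewrite ler_pM2r ?invr_gt0//; apply: ler_sum => tau _.
  by apply: ler_wpM2l; [exact: (tweight_ge0 p_gt0)|exact: pt].
rewrite ler_pdivrMr//; under eq_bigr do rewrite mulrDr mulrA.
rewrite big_split/= -!mulr_suml (tweight_sum1 p_sum1) mul1r.
have -> : e * n%:R = e / 2 * n%:R + e / 2 * n%:R by field.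
rewrite lerD2l ler_pdivrMr ?mulr_gt0//; apply: (le_trans hE).
rewrite ler_pdivlMr ?ltr_wpDl// in h.
have h' : (1 + (d n)%:R) * (D + 1) <= e / 2 * (e / 2) * n%:R.
  by rewrite -ler_pdivrMr// mulrAC.
have -> : e / 2 * n%:R * (e / 2 * n%:R) = (e / 2 * (e / 2) * n%:R) * n%:R by ring.
rewrite ler_pM2r//; apply: le_trans h'; rewrite mulrC ler_wpM2l ?addr_ge0//.
by rewrite lerDl.
Qed.

(** Finitely many profiles converge by [profile_L1]. With [K.+1 = m^2], the mean number of words
    shared by more than [m^2] strings and the sum of the Poisson tails are both of order [n / m],
    uniformly in [n]; the choice of [m] makes their total at most [e / 2] after division by [n]. *)
Lemma internal_L1 :
  (fun n => (\sum_tau @tweight R A p n (d n) tau *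
    `|internal tau - \sum_(s <- words (d n)) fEi (n%:R * wt p s)|) / n%:R)
  @ \oo --> 0.
Proof.
have [C C0 hC] := @prob_nuw_gt R A p hA p_gt0 p_sum1 a0.
have [C' C'0 hC'] := @sum_bump2_linear R A p hA p_gt0 p_sum1.
apply: cvgn0P => e e0.
pose m := (Num.truncn ((C + 4 * C') / (e / 2))).+1.
have m0 : 0 < m%:R :> R by rewrite ltr0n.
have m1 : 1 <= m%:R :> R by rewrite ler1n.
have hm : (C + 4 * C') / m%:R <= e / 2.
  rewrite ler_pdivrMr// [leRHS]mulrC -ler_pdivrMr ?divr_gt0//.
  by apply/ltW; exact: truncnS_gt.
pose K := (m ^ 2).-1.
have KE : K.+1 = (m ^ 2)%N by rewrite prednK// expn_gt0.
pose E1 (k n : nat) : R := (\sum_tau @tweight R A p n (d n) tau *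
    `|profile a0 k tau - \sum_(s <- words (d n)) fE k (n%:R * wt p s)|) / n%:R.
have cs : (fun n => \sum_(i < K) E1 i.+2 n) @ \oo --> 0.
  by apply: cvgn0_sum => i; exact: profile_L1.
have [|N hN] := cvgn0_le cs (e := e / 2); first by rewrite divr_gt0.
exists (maxn 1 N) => n; rewrite geq_max => /andP[n0 /hN h].
have N0 : 0 < n%:R :> R by rewrite ltr0n.
rewrite ger0_norm; last first.
  by rewrite divr_ge0// sumr_ge0// => tau _; rewrite mulr_ge0// (tweight_ge0 p_gt0).
have l0 s : 0 < n%:R * wt p s by rewrite mulr_gt0// wt_gt0.
pose tail : R := \sum_(s <- words (d n)) fE_tail K.+2 (n%:R * wt p s).
pose rest (tau : {ffun 'I_n -> {ffun 'I_(d n) -> A}}) : R :=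
  \sum_(s <- words (d n)) (K.+1 < nuw a0 tau s)%N%:R.
have tail0 : 0 <= tail by apply: sumr_ge0 => s _; apply: fE_tail_ge0; exact: ltW.
have tail1 : tail <= 4 * C' * (n%:R / m%:R).
  rewrite -mulrA; apply: le_trans (ler_wpM2l _ (hC' (d n) _ _)) => //; last first.
    by rewrite divr_gt0.
  rewrite mulr_sumr; apply: ler_sum => s _; have w0 := wt_gt0 p_gt0 s.
  apply: min_le_bump2.
  - by rewrite mulr_ge0 ?divr_ge0// ltW.
  - by apply: fE_tail_le1; exact: ltW.
  - apply: le_trans (fE_tail_sqr (ltW (l0 s)) _) _ => //.
    rewrite KE natrX le_eqVlt; apply/orP; left; apply/eqP; field.
    by rewrite gt_eqF.
have pt (tau : {ffun 'I_n -> {ffun 'I_(d n) -> A}}) :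
    `|internal tau - \sum_(s <- words (d n)) fEi (n%:R * wt p s)| <=
    \sum_(i < K) `|profile a0 i.+2 tau - \sum_(s <- words (d n)) fE i.+2 (n%:R * wt p s)|
    + rest tau + tail.
  have -> : internal tau = \sum_(i < K) profile a0 i.+2 tau + rest tau.
    rewrite /internal /profile exchange_big/= /rest -big_split/=.
    by apply: eq_bigr => s _; exact: indic_gt1_split.
  have -> : \sum_(s <- words (d n)) fEi (n%:R * wt p s) =
      \sum_(i < K) \sum_(s <- words (d n)) fE i.+2 (n%:R * wt p s) + tail.
    rewrite exchange_big/= /tail -big_split/=.
    by apply: eq_bigr => s _; exact: fEi_split.
  rewrite opprD addrACA -sumrB.
  have r0 : 0 <= rest tau by apply: sumr_ge0.
  apply: (le_trans (ler_normD _ _)); rewrite -addrA; apply: lerD.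
    exact: ler_norm_sum.
  by rewrite (le_trans (ler_normB _ _))// !ger0_norm.
apply: (@le_trans _ _ ((\sum_tau @tweight R A p n (d n) tau *
    (\sum_(i < K) `|profile a0 i.+2 tau - \sum_(s <- words (d n)) fE i.+2 (n%:R * wt p s)|
    + rest tau + tail)) / n%:R)).
  rewrite ler_pM2r ?invr_gt0//; apply: ler_sum => tau _.
  by apply: ler_wpM2l; [exact: (tweight_ge0 p_gt0)|exact: pt].
under eq_bigr do rewrite !mulrDr.
rewrite !big_split/= -mulr_suml (tweight_sum1 p_sum1) mul1r !mulrDl.
have s1 : (\sum_tau @tweight R A p n (d n) tau * \sum_(i < K) `|profile a0 i.+2 tau -
    \sum_(s <- words (d n)) fE i.+2 (n%:R * wt p s)|) / n%:R <= e / 2.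
  apply: (@le_trans _ _ (\sum_(i < K) E1 i.+2 n)); last exact: le_trans (ler_norm _) h.
  rewrite /E1 -mulr_suml; under eq_bigr do rewrite mulr_sumr.
  by rewrite exchange_big.
have s2 : (\sum_tau @tweight R A p n (d n) tau * rest tau) / n%:R <= C / m%:R.
  rewrite ler_pdivrMr//; apply: (le_trans (hC n (d n) K.+1 n0 isT)).
  rewrite KE natrX expr2 invfM.
  have -> : C / m%:R * n%:R = C * (n%:R * m%:R^-1) by ring.
  rewrite ler_wpM2l// ler_wpM2l// ler_piMr ?invr_ge0 ?(ltW m0)//.
  by rewrite invf_le1.
have s3 : tail / n%:R <= 4 * C' / m%:R.
  by rewrite ler_pdivrMr// (le_trans tail1)// mulrA mulrAC.
rewrite [leRHS]splitr -addrA; apply: lerD => //; apply: le_trans hm.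
by rewrite mulrDl lerD.
Qed.

End MeanConvergence.

Lemma sum_indic_count (R : realType) (T : Type) (b : pred T) (l : seq T) :
  \sum_(s <- l) (b s)%:R = (count b l)%:R :> R.
Proof. by rewrite -sum1_count natr_sum [RHS]big_mkcond; apply: eq_bigr => s _; case: (b s). Qed.

(** Since the first ratio is at most 1, exchanging the denominators costs no more than [|b - b'|].
    If [1 + b = 0] then [a = 0], and the first ratio is 0 as well. *)
Lemma ratio_dist (R : realType) (a b a' b' : R) : 0 <= a <= 1 + b -> 0 <= b' ->
  `|a / (1 + b) - a' / (1 + b')| <= `|a - a'| + `|b - b'|.
Proof.
move=> /andP[a0 ab] b'0; have [b0|b0] := eqVneq (1 + b) 0.
  have a00 : a = 0 by apply/eqP; rewrite eq_le a0 andbT -b0.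
  rewrite a00 mul0r !sub0r !normrN normrM (@ger0_norm _ (_^-1)) ?invr_ge0; last lra.
  apply: (@le_trans _ _ `|a'|); last by rewrite lerDl.
  rewrite ler_piMr// invf_le1; lra.
have b1 : 0 < 1 + b by rewrite lt_neqAle eq_sym b0 (le_trans a0).
have b'1 : 0 < 1 + b' by lra.
have -> : a / (1 + b) - a' / (1 + b') =
  (a - a') / (1 + b') + (a / (1 + b)) * ((b' - b) / (1 + b')).
  by field; rewrite !gt_eqF.
have i1 : (1 + b')^-1 <= 1 by rewrite invf_le1//; lra.
have i0 : 0 <= (1 + b')^-1 by rewrite invr_ge0 ltW.
apply: (le_trans (ler_normD _ _)); apply: lerD.
  by rewrite normrM (ger0_norm i0) ler_piMr.
rewrite normrM [X in _ * X]normrM (ger0_norm i0) (@ger0_norm _ (a / (1 + b))) ?divr_ge0 ?(ltW b1)//.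
rewrite [X in _ * (X * _)]distrC; apply: (@le_trans _ _ (1 * (`|b - b'| * 1))).
  have a1 : 0 <= a / (1 + b) by rewrite divr_ge0// ltW.
  have a2 : a / (1 + b) <= 1 by rewrite ler_pdivrMr// mul1r.
  by apply: (ler_pM a1 _ a2); [exact: mulr_ge0|rewrite ler_wpM2l].
by rewrite mul1r mulr1.
Qed.

Section Final.
Context {R : realType} {A : finType} {disp : measure_display}
  {Omega : measurableType disp}.
Variables (p : A -> R) (P : probability Omega R) (Xi : nat -> Omega -> infstr A)
  (V : nat -> Omega -> seq A).
Hypothesis hA : (2 <= #|A|)%N.
Hypothesis p_gt0 : forall a, 0 < p a.
Hypothesis p_sum1 : \sum_a p a = 1.
Hypothesis hXi : iid_strings P p Xi.
Hypothesis hV : forall n, (1 <= n)%N -> uniform_node P (random_trie Xi n) (V n).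
Variable a0 : A.

Let H := entropy p.
Let prob k n := cprob_given P
    [set w | nleaves (random_fringe Xi V n w) = k] (random_trie Xi n).

Lemma Phi_ratio n M k (tau : {ffun 'I_n -> {ffun 'I_M -> A}}) :
  (0 < n)%N -> (0 < k)%N -> injectiveb tau ->
  (Phi k (trie (fun i => ext a0 (tau i))))%:R /
    (nnodes (trie (fun i => ext a0 (tau i))))%:R =
  ((if k == 1%N then n%:R else profile a0 k tau) / n%:R) / (1 + internal a0 tau / n%:R) :> R.
Proof.
move=> n0 k0 /(separated_ext a0) sep.
have N0 : n%:R != 0 :> R by rewrite pnatr_eq0 -lt0n.
have iE : internal a0 tau =
    (count (fun s => 1 < nu (fun i => ext a0 (tau i)) s)%N (words M))%:R :> R.
  by rewrite -sum_indic_count.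
have -> : (Phi k (trie (fun i => ext a0 (tau i))))%:R =
    if k == 1%N then n%:R else profile a0 k tau :> R.
  case: eqP => [->|k1]; first by rewrite (Phi1_trie sep).
  rewrite (Phi_trie sep) -?sum_indic_count//.
  by case: (k) k0 k1 => [|[]].
rewrite (nnodes_trie sep) natrD -iE.
have nI : n%:R + internal a0 tau != 0 :> R.
  by rewrite gt_eqF// ltr_wpDr ?ltr0n// iE.
move: (internal a0 tau) (if _ then _ else _) nI => y z nI.
by field; rewrite nI N0.
Qed.

Lemma psiEi_ge0 t : 0 <= psiEi p t.
Proof.
rewrite /psiEi /psi; case: eqP => [_|d0]; first by rewrite (renewal_fEi hA p_gt0 p_sum1).1.
have dp0 : 0 <= dp p.
  by have [[/ltW]|[->]] := dpP hA p_gt0 p_sum1.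
rewrite mulr_ge0// fine_ge0// esum_ge0// => j _.
by rewrite lee_fin mulr_ge0 ?expR_ge0//; have /andP[] := fEi_bump (expR_gt0 (t - j%:~R * dp p)).
Qed.

(** Markov's inequality in pointwise form: the indicator of a deviation by [e] is at most the
    deviation divided by [e]. By [ratio_dist] convergence in mean of numerator and denominator is
    then enough. The free sequence [a'] covers both cases, [psiE p k / H] for [k >= 2] and the
    constant 1 for the leaves. *)
Lemma op1_ratio k (a' : nat -> R) (d : nat -> nat) : (0 < k)%N ->
  (fun n => n%:R ^+ 2 * (\sum_a p a ^+ 2) ^+ d n) @ \oo --> (0 : R) ->
  (fun n => (1 + (d n)%:R) / n%:R : R) @ \oo --> 0 ->
  (fun n => \sum_tau @tweight R A p n (d n) tau *
    `|(if k == 1%N then n%:R else profile a0 k tau) / n%:R - a' n|) @ \oo --> 0 ->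
  op1 P (fun n w => prob k n w - a' n / (1 + psiEi p (ln n%:R) / H)).
Proof.
move=> k0 d1 d2 ha e e0.
have H0 : 0 < H by exact: entropy_gt0.
pose b' n := psiEi p (ln n%:R) / H.
have b'0 n : 0 <= b' n by rewrite divr_ge0 ?psiEi_ge0// ltW.
pose ci n := \sum_(s <- words (d n)) fEi (n%:R * wt p s).
have vi := mean_asymptotics d1 (renewal_fEi hA p_gt0 p_sum1).2.
have ui := internal_L1 hA p_gt0 p_sum1 a0 d2.
pose Ea n := \sum_tau @tweight R A p n (d n) tau *
    `|(if k == 1%N then n%:R else profile a0 k tau) / n%:R - a' n|.
pose Ui n := (\sum_tau @tweight R A p n (d n) tau * `|internal a0 tau - ci n|) / n%:R.
pose Vi n := ci n / n%:R - psi p fEi (ln n%:R) / entropy p.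
pose g n := n%:R ^+ 2 * (\sum_a p a ^+ 2) ^+ d n + e^-1 * (Ea n + (Ui n + `|Vi n|)).
have g0 : g @ \oo --> 0.
  exact: cvgn0D d1 (cvgn0Z _ (cvgn0D ha (cvgn0D ui (cvgn0_norm vi)))).
have key n : (0 < n)%N ->
    (P [set w | (e <= `|prob k n w - a' n / (1 + b' n)|)%R] <= (g n)%:E)%E.
  move=> n0; have N0 : 0 < n%:R :> R by rewrite ltr0n.
  apply: (le_trans (prob_deviation_le p_gt0 p_sum1 hXi a0 hA (hV n0) k0 _ _ (d n))).
  rewrite lee_fin /g lerD2l.
  have W0 tau : 0 <= @tweight R A p n (d n) tau by exact: tweight_ge0.
  apply: (@le_trans _ _ (\sum_tau @tweight R A p n (d n) tau *
    (e^-1 * (`|(if k == 1%N then n%:R else profile a0 k tau) / n%:R - a' n| +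
      (`|internal a0 tau - ci n| / n%:R + `|Vi n|))))).
    apply: ler_sum => tau _; apply: ler_wpM2l => //.
    set rhs := e^-1 * _; have rhs0 : 0 <= rhs.
      by rewrite mulr_ge0 ?invr_ge0 ?(ltW e0)// !addr_ge0// divr_ge0// ltW.
    case inj: (injectiveb tau) => //=; case: (boolP (e <= _)) => //= he.
    apply: (@le_trans _ _ (e^-1 * e)); first by rewrite mulVf ?gt_eqF.
    rewrite /rhs ler_pM2l ?invr_gt0//; apply: (le_trans he).
    rewrite Phi_ratio//.
    apply: (le_trans (ratio_dist _ _ (b'0 n))); last first.
      rewrite lerD2l.
      have -> : internal a0 tau / n%:R - b' n =
          (internal a0 tau - ci n) / n%:R + Vi n.
        by rewrite /Vi /b' /psiEi mulrBl addrA subrK.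
      apply: (le_trans (ler_normD _ _)).
      by rewrite normrM (@ger0_norm _ (n%:R^-1)) ?invr_ge0// ltW.
    have I0 : 0 <= internal a0 tau :> R by apply: sumr_ge0.
    have [_|k1] := eqVneq k 1%N.
      by rewrite divff ?gt_eqF// ler01 lerDl divr_ge0// ltW.
    rewrite divr_ge0 ?(ltW N0)//=; last by apply: sumr_ge0.
    apply: (@le_trans _ _ (internal a0 tau / n%:R)); last by rewrite lerDr.
    rewrite ler_pM2r ?invr_gt0//; apply: ler_sum => s _; rewrite ler_nat.
    case: eqP => // ->; rewrite ltn_neqAle eq_sym k1 k0//.
  under eq_bigr do rewrite mulrCA.
  rewrite -mulr_sumr ler_wpM2l ?invr_ge0 ?(ltW e0)//.
  under eq_bigr do rewrite !mulrDr mulrA.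
  rewrite !big_split/= -!mulr_suml (tweight_sum1 p_sum1) mul1r.
  by [].
apply: (@squeeze_cvge _ _ _ _ (fun=> 0%E) _ (fun n => (g n)%:E)).
- exists 1%N => // n /= n0; rewrite measure_ge0 /=.
  exact: key.
- exact: cvg_cst.
- by apply: cvg_EFin; [exact: nearW|].
Qed.

Lemma profile_mean k (d : nat -> nat) : (2 <= k)%N ->
  (fun n => n%:R ^+ 2 * (\sum_a p a ^+ 2) ^+ d n) @ \oo --> (0 : R) ->
  (fun n => (1 + (d n)%:R) / n%:R : R) @ \oo --> 0 ->
  (fun n => \sum_tau @tweight R A p n (d n) tau *
    `|profile a0 k tau / n%:R - psiE p k (ln n%:R) / H|) @ \oo --> 0.
Proof.
move=> k2 d1 d2.
have v := mean_asymptotics d1 (renewal_fE hA p_gt0 p_sum1 k2).2.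
have u := profile_L1 hA p_gt0 p_sum1 a0 d2 k2.
apply: (cvgn0_squeeze (cvgn0D u (cvgn0_norm v))) => n n0.
have N0 : 0 < n%:R :> R by rewrite ltr0n.
have W0 tau : 0 <= @tweight R A p n (d n) tau by exact: tweight_ge0.
set c := \sum_(s <- words (d n)) fE k (n%:R * wt p s).
set z := c / n%:R - _.
rewrite ger0_norm ?sumr_ge0// => [|tau _]; last by rewrite mulr_ge0.
apply: (@le_trans _ _ (\sum_tau @tweight R A p n (d n) tau *
   (`|profile a0 k tau - c| / n%:R + `|z|))).
  apply: ler_sum => tau _; apply: ler_wpM2l => //.
  have -> : profile a0 k tau / n%:R - psiE p k (ln n%:R) / H =
      (profile a0 k tau - c) / n%:R + z.
    by rewrite /z /psiE mulrBl addrA subrK.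
  apply: (le_trans (ler_normD _ _)).
  by rewrite normrM (@ger0_norm _ (n%:R^-1)) ?invr_ge0// ltW.
under eq_bigr do rewrite mulrDr mulrA.
by rewrite big_split/= -!mulr_suml (tweight_sum1 p_sum1) mul1r.
Qed.

End Final.

Theorem theorem4p4 (R : realType) (A : finType) (hA : (2 <= #|A|)%N)
    (p : A -> R) (p_gt0 : forall a, 0 < p a) (p_sum1 : \sum_(a : A) p a = 1)
    (disp : measure_display) (Omega : measurableType disp)
    (P : probability Omega R)
    (Xi : nat -> Omega -> infstr A) (hXi : iid_strings P p Xi)
    (V : nat -> Omega -> seq A)
    (hV : forall n, (1 <= n)%N -> uniform_node P (random_trie Xi n) (V n)) :
  let H := entropy p in
  let prob k n := cprob_given P
    [set w | nleaves (random_fringe Xi V n w) = k] (random_trie Xi n) in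
  [/\ (forall k n, (1 <= k)%N -> (1 <= n)%N ->
         \forall w \ae P, prob k n w =
           (Phi k (random_trie Xi n w))%:R / (nnodes (random_trie Xi n w))%:R),
      (forall k, (2 <= k)%N ->
         op1 P (fun n w => prob k n w -
           psiE p k (ln n%:R) / (psiEi p (ln n%:R) + H))),
      op1 P (fun n w => prob 1%N n w - H / (psiEi p (ln n%:R) + H)) &
      dp p = 0 ->
        (forall k, (2 <= k)%N ->
           cvg_in_probability P (prob k)
             (1 / ((1 + H) * k%:R * (k%:R - 1)))) /\
        cvg_in_probability P (prob 1%N) (H / (1 + H))].
Proof.
move=> H prob.
have [a0 _] : exists a : A, true.
  by have /card_gt0P[a _] : (0 < #|A|)%N by [exact: ltnW]; exists a.
have H0 : 0 < H by exact: entropy_gt0.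
have [c /andP[c0 _] hc] := p_gap p_gt0 p_sum1 hA.
have [|d [d1 d2]] := @depth_sequence R (\sum_a p a ^+ 2).
  have /andP[-> q1] := sump_sqr p_gt0 p_sum1 c0 hc.
  by rewrite (le_lt_trans q1)// ltrBlDr ltrDl.
have psi0 n : 0 <= psiEi p (ln n%:R) by exact: psiEi_ge0.
have main k : (2 <= k)%N -> op1 P (fun n w => prob k n w -
    psiE p k (ln n%:R) / (psiEi p (ln n%:R) + H)).
  move=> k2; have k0 : (0 < k)%N by exact: ltnW.
  have hk : (k == 1%N) = false by case: (k) k2 => [|[|]].
  have := op1_ratio hA p_gt0 p_sum1 hXi hV (a0 := a0) (k := k)
    (a' := fun n => psiE p k (ln n%:R) / H) k0 d1 d2.
  rewrite hk => /(_ (profile_mean hA p_gt0 p_sum1 a0 k2 d1 d2)).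
  congr op1; apply/funext => n; apply/funext => w; congr (_ - _).
  by field; rewrite !gt_eqF// ltr_wpDl.
have main1 : op1 P (fun n w => prob 1%N n w - H / (psiEi p (ln n%:R) + H)).
  have h0 : (fun n => \sum_tau @tweight R A p n (d n) tau *
      `|n%:R / n%:R - 1 : R|) @ \oo --> (0 : R).
    apply: (cvgn0_squeeze (v := fun=> 0)); first exact: cvg_cst.
    move=> n n0; rewrite big1 ?normr0// => tau _.
    by rewrite divff ?subrr ?normr0 ?mulr0// pnatr_eq0 -lt0n.
  have := op1_ratio hA p_gt0 p_sum1 hXi hV (a0 := a0) (k := 1%N)
    (a' := fun=> 1) isT d1 d2 h0.
  congr op1; apply/funext => n; apply/funext => w; congr (_ - _).
  by field; rewrite !gt_eqF// ltr_wpDl.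
split=> //.
- by move=> k n k0 n0; exact: (cprob_ae p_gt0 p_sum1 hXi a0 hA (hV n n0) k0).
move=> d0; split=> [k k2|].
  have := main k k2; congr op1; apply/funext => n; apply/funext => w; congr (_ - _).
  (* Without a span both [psi] are constant, equal to the Mellin values [1 / (k (k - 1))] and [1]
     found from the explicit primitives. *)
  rewrite /psiE /psiEi /psi d0 eqxx.
  rewrite (renewal_fE hA p_gt0 p_sum1 k2).1 (renewal_fEi hA p_gt0 p_sum1).1.
  by rewrite div1r -[in RHS]mulrA [RHS]invfM mulrC.
have := main1; congr op1; apply/funext => n; apply/funext => w; congr (_ - _).
by rewrite /psiEi /psi d0 eqxx (renewal_fEi hA p_gt0 p_sum1).1.
Qed.
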